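(* For each $N$, let $\mathbf T$ be an $N\times N$ (deterministic, complex) diagonal matrix such that, as $N\to\infty$, $$\operatorname{Tr}\mathbf T=0,\qquad\frac1N\operatorname{Tr}\mathbf T\mathbf T^*\to\sigma^2,\qquad\frac1N\operatorname{Tr}\mathbf T^2\to\tau^2,\qquad\forall k\ge1,\ \frac1N\operatorname{Tr}(\mathbf T\mathbf T^* )^k=O(1).$$ Let $\mathbf u_{t_1},\dots,\mathbf u_{t_p}$ be $p$ distinct columns of an $N\times N$ Haar-distributed unitary matrix ($p$ fixed). Then $$\Big(\sqrt N\,\langle\mathbf u_{t_i},\mathbf T\mathbf u_{t_j}\rangle\Big)_{i,j=1}^p$$ converges in distribution, as $N\to\infty$, to a centered complex Gaussian vector $(\mathcal G_{i,j})_{i,j=1}^p$ with covariance $$\mathbb E[\mathcal G_{i,j}\mathcal G_{k,\ell}]=\delta_{i,\ell}\delta_{j,k}\,\tau^2,\qquad\mathbb E[\mathcal G_{i,j}\overline{\mathcal G_{k,\ell}}]=\delta_{i,k}\delta_{j,\ell}\,\sigma^2.$$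
   Context: Here $\langle\mathbf u,\mathbf v\rangle=\mathbf u^*\mathbf v$. $\sigma^2\ge0$ is real and $\tau^2$ denotes a complex number. A centered complex Gaussian vector is a $\mathbb C^d$-valued random vector whose real and imaginary parts are jointly Gaussian and centered. *)

(* Defs.v *)
From HB Require Import structures.
From mathcomp Require Import all_boot all_order all_algebra.
From mathcomp Require Import complex.
From mathcomp Require Import all_classical all_reals all_analysis.

Set Implicit Arguments.
Unset Strict Implicit.
Unset Printing Implicit Defensive.

Import Order.TTheory GRing.Theory Num.Theory.
Import numFieldNormedType.Exports.

Local Open Scope classical_set_scope.
Local Open Scope ring_scope.
Local Open Scope complex_scope.
Local Open Scope sesquilinear_scope.

(* [R[i]^o] already carries the metric topology of the modulus; this makes the
   same structure available on [R[i]], hence the entrywise one on matrices. *)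
HB.instance Definition _ (R : realType) :=
  NormedModule.copy R[i] R[i]^o.

Notation borel T := (g_sigma_algebraType (@open T)).

Section haar.
Context (R : realType) (N : nat).

(* [unitarymx] is the library's predicate [A *m A^* = 1]. Left invariance
   characterises the Haar probability measure of the compact group U(N). *)
Definition haar_unitary (mu : probability (borel 'M[R[i]]_N) R) : Prop :=
  mu [set V | V \is unitarymx] = 1%E /\
  forall V : 'M[R[i]]_N, V \is unitarymx ->
  forall A : set (borel 'M[R[i]]_N), measurable A ->
    mu ((mulmx V) @^-1` A) = mu A.

End haar.

Definition inner (R : realType) n (u v : 'cV[R[i]]_n) : R[i] :=
  (u ^t* *m v) 0 0.

Definition cvg_in_distribution (R : realType) (T : topologicalType)
    (d : nat -> measure_display) (Omega : forall n, measurableType (d n))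
    (P : forall n, probability (Omega n) R) (X : forall n, Omega n -> T)
    (d' : measure_display) (Omega' : measurableType d')
    (Q : probability Omega' R) (Y : Omega' -> T) : Prop :=
  forall f : T -> R, continuous f -> [bounded f x | x in [set: T]] ->
    'E_(P n)[f \o X n]%E @[n --> \oo] --> 'E_Q[f \o Y]%E.

Section gaussian.
Context (R : realType) (d : measure_display) (Omega : measurableType d)
        (P : probability Omega R).

(* The library's [normal_prob m 0] is the uniform law on [0, 1], not the point
   mass at [m], so the degenerate case is separated. *)
Definition gaussian_law (m s : R) : set R -> \bar R :=
  if s == 0 then \d_m else normal_prob m s.

Definition gaussian_variable (X : Omega -> R) : Prop :=
  measurable_fun [set: Omega] X /\
  exists m s : R, forall A : set R, measurable A ->
    P (X @^-1` A) = gaussian_law m s A.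

(* [complex_mean Z c] reads E[Z] = c. As +oo - +oo = -oo in [\bar R], a finite
   expectation implies integrability, so no default value is involved. *)
Definition complex_mean (Z : Omega -> R[i]) (c : R[i]) : Prop :=
  'E_P[fun w => complex.Re (Z w)]%E = (complex.Re c)%:E /\
  'E_P[fun w => complex.Im (Z w)]%E = (complex.Im c)%:E.

(* Joint Gaussianity of a real vector means that all its real linear
   combinations are Gaussian variables. *)
Definition centered_complex_gaussian (I : finType) (G : I -> Omega -> R[i]) :=
  (forall a b : I -> R, gaussian_variable (fun w =>
     \sum_i (a i * complex.Re (G i w) + b i * complex.Im (G i w)))) /\
  (forall i, complex_mean (G i) 0).

End gaussian.

(* Main.v *)
Require Import Defs.
From HB Require Import structures.
From mathcomp Require Import all_boot all_order all_algebra.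
From mathcomp Require Import complex ring lra.
From mathcomp Require Import all_classical all_reals all_analysis.
From mathcomp Require Import measurable_realfun.

Set Implicit Arguments.
Unset Strict Implicit.
Unset Printing Implicit Defensive.

Import Order.TTheory GRing.Theory Num.Theory.
Import numFieldNormedType.Exports.

Local Open Scope classical_set_scope.
Local Open Scope ring_scope.

(** Let [X = sqrt N (<u_i, T u_j>)] be the [p x p] block of a Haar unitary [V]
    and [Y = Re Tr (A X)] a real linear statistic of it. By the Cramer-Wold
    principle it is enough that every [Y] is asymptotically Gaussian. This is
    Stein's method, with left invariance of the Haar measure as the source of
    the integration by parts.

    Invariance along the unitary curves [1 + i t w w^* + O(t^2)] gives
    [E (D_K f) = 0] for every direction [K]: first for [K = i w w^*], then for
    all matrices because these span them over the complex numbers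
    ([stein_direction], [polarization], [stein_identity]). Applied to
    the entries of [V B V^* S] times [f] and summed over the elementary
    directions, it becomes the Schwinger-Dyson equation
    [N E (Tr (B V^* S V) f) = Tr B Tr S E f - E (D f)]
    ([schwinger_dyson]). It is used for three functions [f].
    - With [f = 1], the diagonal entries of [V^* S V] have mean [Tr S / N].
    - With [f] the conjugate of an entry of [V^* T V], where [Tr T = 0], the
      entries of [V^* T V] have second moment [O(1/N)] ([second_moment]).
    - With [f = sin (s Y + theta)], one finds
      [E (Y sin (s Y + theta)) = s/2 Re E (cos (s Y + theta) W)]
      ([stein_main_identity]), where [W] is
      [Tr (A A m(T T)) + Tr (A^* A m(T T^* ))] minus two products of blocks,
      [m(S)] being the block of [V^* S V]. The products are [O(1/N)], and the
      second moment bound for [T T] and [T T^*] after centring shows that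
      [W] concentrates at [c = tau2 Tr (A A) + sigma2 Tr (A^* A)]
      ([remainder_bound]).

    Hence [s |-> E cos (s Y + theta)] solves [y' = - (Re c / 2) s y] up to a
    vanishing error, and [E cos (Y + theta)] tends to
    [cos theta exp (- Re c / 4)] ([gaussian_ode], [charfun_estimate]).

    The limit is realised as [G i j = alpha z i j + beta (z j i)^*] with
    independent standard complex normal variables [z i j] and
    [2 alpha beta = tau2], [alpha^2 + |beta|^2 = sigma2]; this is solvable
    because [|tau2| <= sigma2] ([elliptic_gram], [norm_tau_le_sigma],
    [gaussian_matrix_exists]).

    Characteristic functions control weak convergence without a continuity
    theorem, since second moments are bounded: a bounded continuous [f] is
    within [e (1 + |x|^2)] of a trigonometric polynomial ([trig_approx]), so
    [E f (X)] is uniformly close to an expectation that converges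
    ([cvg_in_distribution_charfun]). *)

(** * Trigonometric estimates and a differential inequality *)

Section Trigo.
Variable R : realType.
Implicit Types a b x : R.

Lemma sin_lipschitz a b : `|sin b - sin a| <= `|b - a|.
Proof.
wlog ab : a b / a <= b.
  move=> h; have [/h//|/ltW/h] := leP a b.
  by rewrite distrC [leRHS]distrC.
have [c _ ->] : exists2 c, c \in `[a, b]%R & sin b - sin a = cos c * (b - a).
  by apply: MVT_segment => //; apply: continuous_subspaceT; exact: continuous_sin.
by rewrite normrM ler_piMl// ler_norml cos_geN1 cos_le1.
Qed.

Lemma cos_lipschitz a b : `|cos b - cos a| <= `|b - a|.
Proof.
rewrite -!sinDpihalf; apply: le_trans (sin_lipschitz _ _) _.
by rewrite opprD addrACA subrr addr0.
Qed.

Lemma sin_taylor a b : `|sin b - sin a - (b - a) * cos a| <= (b - a) ^+ 2.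
Proof.
have [c abc ->] : exists2 c, `|c - a| <= `|b - a| & sin b - sin a = cos c * (b - a).
  wlog ab : a b / a <= b.
    move=> h; have [/h//|ba] := leP a b.
    have ba' := ltW ba.
    have [c abc e] : exists2 c, c \in `[b, a]%R & sin a - sin b = cos c * (a - b).
      by apply: MVT_segment => //; apply: continuous_subspaceT; exact: continuous_sin.
    exists c; last by rewrite -opprB e -mulrN opprB.
    move: abc; rewrite in_itv/= => /andP[bc ca].
    by rewrite !ler0_norm ?subr_le0// lerN2 lerB.
  have [c abc e] : exists2 c, c \in `[a, b]%R & sin b - sin a = cos c * (b - a).
    by apply: MVT_segment => //; apply: continuous_subspaceT; exact: continuous_sin.
  exists c => //; move: abc; rewrite in_itv/= => /andP[bc ca].
  by rewrite !ger0_norm ?subr_ge0// lerB.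
rewrite mulrC -mulrBr normrM -real_normK ?num_real// expr2 ler_wpM2l//.
exact: le_trans (cos_lipschitz _ _) abc.
Qed.

Lemma cos_taylor a b : `|cos b - cos a + (b - a) * sin a| <= (b - a) ^+ 2.
Proof.
have := sin_taylor (a + pi / 2) (b + pi / 2).
by rewrite !sinDpihalf cosDpihalf opprD addrACA subrr addr0 mulrN opprK.
Qed.

Lemma sin_norm_le1 x : `|sin x| <= 1.
Proof. by rewrite ler_norml sin_geN1 sin_le1. Qed.

Lemma cos_norm_le1 x : `|cos x| <= 1.
Proof. by rewrite ler_norml cos_geN1 cos_le1. Qed.

(** Turns a first order expansion along a curve into an exact identity: the
    constant term vanishes because it is bounded by a multiple of [t] *)
Lemma le_linear_eq0 (z B : R) : 0 <= z ->
  (forall t, 0 < t <= 1 -> z <= B * t) -> z = 0.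
Proof.
move=> z0 zB; apply/eqP; rewrite eq_le z0 andbT; apply/ler_addgt0Pr => e e0.
rewrite add0r; pose t := Num.min 1 (e / (`|B| + 1)).
have B1 : 0 < `|B| + 1 by rewrite ltr_wpDl.
have t01 : 0 < t <= 1.
  by rewrite lt_min ltr01 divr_gt0//= ge_min lexx.
apply: le_trans (zB t t01) _; case/andP: t01 => t0 _.
apply: (@le_trans _ _ ((`|B| + 1) * t)).
  by rewrite ler_pM2r// (le_trans (ler_norm _))// lerDl.
by rewrite mulrC -ler_pdivlMr// ge_min lexx orbT.
Qed.

End Trigo.

Section GaussianODE.
Variable R : realType.
Implicit Types (c : R -> R).

(** A quadratic error bound is inherited by expectations; their derivatives are
    obtained from it *)
Lemma quadratic_is_derive c (d s K : R) :
  (forall h, `|c (s + h) - c s - h * d| <= K * h ^+ 2) -> is_derive s 1 c d.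
Proof.
move=> cK; suff cv : h^-1 *: (c (h *: 1 + s) - c s) @[h --> 0^'] --> d.
  by apply: DeriveDef; [apply/cvg_ex; exists d|exact: cvg_lim].
apply/cvgrPdist_le => e e0; near=> h.
have h0 : h != 0 by near: h; exact: nbhs_dnbhs_neq.
have -> : d - h^-1 *: (c (h *: 1 + s) - c s) =
    - (h^-1 * (c (s + h) - c s - h * d)).
  rewrite [h *: 1]mulr1 [h + s]addrC -[h^-1 *: _]/(h^-1 * _).
  by rewrite [in RHS]mulrBr mulKf// opprB.
rewrite normrN normrM normfV ler_pdivrMl ?normr_gt0//.
apply: (le_trans (cK h)); rewrite -real_normK ?num_real// expr2 mulrCA.
rewrite ler_wpM2l//; apply: (@le_trans _ _ ((`|K| + 1) * `|h|)).
  by rewrite ler_wpM2r// (le_trans (ler_norm _))// lerDl.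
rewrite mulrC -ler_pdivlMr; last by rewrite ltr_wpDl.
near: h; apply: dnbhs0_le.
by rewrite divr_gt0// ltr_wpDl.
Unshelve. all: by end_near. Qed.

(** Mean value theorem for [s |-> c s * exp (v s^2 / 2)], whose derivative
    is [exp (v s^2 / 2)] times the defect of the equation [c' = - v s c] *)
Lemma gaussian_ode c (d : R -> R) (v e K : R) :
  (forall s h, `|c (s + h) - c s - h * d s| <= K * h ^+ 2) ->
  (forall s, 0 <= s <= 1 -> `|d s + v * s * c s| <= e) ->
  `|c 1 - c 0 * expR (- v / 2)| <= e * expR `|v|.
Proof.
move=> cK dv.
have dc (s : R) : is_derive s 1 c (d s) := quadratic_is_derive (cK s).
pose g s := c s * expR (v / 2 * s ^+ 2).
have dg (s : R) : is_derive s 1 g ((d s + v * s * c s) * expR (v / 2 * s ^+ 2)).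
  have dq : is_derive s (1 : R) (fun x : R => v / 2 * x ^+ 2) (v * s).
    apply: (@quadratic_is_derive _ _ _ `|v / 2|) => h.
    have -> : v / 2 * (s + h) ^+ 2 - v / 2 * s ^+ 2 - h * (v * s) =
      v / 2 * h ^+ 2 by field.
    by rewrite normrM [X in _ * X <= _]ger0_norm ?sqr_ge0.
  have de := @is_derive1_comp _ expR (fun x : R => v / 2 * x ^+ 2) s _ _ (@is_derive_expR R (v / 2 * s ^+ 2)) dq.
  have := is_deriveM (dc s) de.
  have -> : c s *: (expR (v / 2 * s ^+ 2) * (v * s))
      + (expR \o (fun x : R => v / 2 * x ^+ 2)) s *: d s =
      (d s + v * s * c s) * expR (v / 2 * s ^+ 2).
    by rewrite -![_ *: _]/(_ * _) /=; ring.
  exact.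
have [x x01 gx] : exists2 x, x \in `[0, 1]%R & g 1 - g 0 =
    (d x + v * x * c x) * expR (v / 2 * x ^+ 2) * (1 - 0).
  apply: (@MVT_segment _ g (fun s => (d s + v * s * c s) * expR (v / 2 * s ^+ 2))).
  - exact: ler01.
  - apply: derivable_within_continuous => x _.
    exact: (@ex_derive _ _ _ _ _ _ _ (dg x)).
have g01 : `|g 1 - g 0| <= e * expR (`|v| / 2).
  rewrite gx subr0 mulr1 normrM; apply: ler_pM => //; first exact: dv.
  rewrite ger0_norm ?expR_ge0// ler_expR.
  move: x01; rewrite in_itv/= => /andP[x0 x1].
  apply: (@le_trans _ _ (`|v| / 2 * x ^+ 2)).
    by rewrite ler_wpM2r ?sqr_ge0// ler_wpM2r// ler_norm.
  by rewrite ler_piMr// ?divr_ge0// expr_le1.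
have -> : c 1 - c 0 * expR (- v / 2) = (g 1 - g 0) * expR (- v / 2).
  rewrite /g expr1n expr0n mulr1 mulr0 expR0 mulr1 mulrBl -mulrA -expRD.
  by rewrite mulNr subrr expR0 mulr1.
rewrite normrM; have -> : expR `|v| = expR (`|v| / 2) * expR (`|v| / 2).
  by rewrite -expRD -splitr.
rewrite mulrA; apply: ler_pM => //.
rewrite ger0_norm ?expR_ge0// ler_expR ler_wpM2r//.
by rewrite -normrN ler_norm.
Qed.

End GaussianODE.

(** * Uniform approximation by trigonometric polynomials *)

Section TrigonometricPolynomials.
Variables (R : realType) (m : nat).
Implicit Types (f g : 'rV[R]_m -> R) (a x : 'rV[R]_m).

Definition dotr a x : R := \sum_k a 0 k * x 0 k.

Lemma dotrDl a b x : dotr (a + b) x = dotr a x + dotr b x.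
Proof. by rewrite -big_split; apply: eq_bigr => k _; rewrite mxE mulrDl. Qed.

Lemma dotrNl a x : dotr (- a) x = - dotr a x.
Proof. by rewrite -sumrN; apply: eq_bigr => k _; rewrite mxE mulNr. Qed.

(** Closed under products thanks to the phases [theta]: they make both [cos]
    and [sin] available and hence the product formulas *)
Inductive trigpoly : ('rV[R]_m -> R) -> Prop :=
| trigpoly_cos a theta : trigpoly (fun x => cos (dotr a x + theta))
| trigpolyD f g : trigpoly f -> trigpoly g -> trigpoly (fun x => f x + g x)
| trigpolyZ (c : R) f : trigpoly f -> trigpoly (fun x => c * f x).

Lemma trigpoly_cst (c : R) : trigpoly (fun=> c).
Proof.
have := trigpolyZ c (trigpoly_cos 0 0).
congr trigpoly; apply/funext => x.
by rewrite /dotr big1 ?addr0 ?cos0 ?mulr1// => k _; rewrite mxE mul0r.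
Qed.

Lemma trigpolyM f g : trigpoly f -> trigpoly g -> trigpoly (fun x => f x * g x).
Proof.
move=> tf; elim: tf g => {f} [a th|f1 f2 _ IH1 _ IH2|c f _ IH] g tg; first last.
- have := trigpolyZ c (IH g tg).
  by congr trigpoly; apply/funext => x; rewrite mulrA.
- have := trigpolyD (IH1 g tg) (IH2 g tg).
  by congr trigpoly; apply/funext => x; rewrite mulrDl.
elim: tg => {g} [b th'|g1 g2 _ IH1 _ IH2|c g _ IH]; first last.
- have := trigpolyZ c IH.
  by congr trigpoly; apply/funext => x; rewrite mulrCA.
- have := trigpolyD IH1 IH2.
  by congr trigpoly; apply/funext => x; rewrite mulrDr.
have := trigpolyD (trigpolyZ 2^-1 (trigpoly_cos (a + b) (th + th')))
                  (trigpolyZ 2^-1 (trigpoly_cos (a - b) (th - th'))).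
congr trigpoly; apply/funext => x.
rewrite !dotrDl dotrNl.
have -> : dotr a x + dotr b x + (th + th') =
  (dotr a x + th) + (dotr b x + th') by ring.
have -> : dotr a x - dotr b x + (th - th') =
  (dotr a x + th) - (dotr b x + th') by ring.
by rewrite cosD cosB; field.
Qed.

Lemma trigpoly_sum (I : Type) (r : seq I) (F : I -> 'rV[R]_m -> R) :
  (forall i, trigpoly (F i)) -> trigpoly (fun x => \sum_(i <- r) F i x).
Proof.
move=> tF; elim: r => [|i r IH].
  by under eq_fun do rewrite big_nil; exact: trigpoly_cst.
by under eq_fun do rewrite big_cons; exact: trigpolyD.
Qed.

Lemma trigpoly_prod (I : Type) (r : seq I) (F : I -> 'rV[R]_m -> R) :
  (forall i, trigpoly (F i)) -> trigpoly (fun x => \prod_(i <- r) F i x).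
Proof.
move=> tF; elim: r => [|i r IH].
  by under eq_fun do rewrite big_nil; exact: trigpoly_cst.
by under eq_fun do rewrite big_cons; exact: trigpolyM.
Qed.

Lemma trigpoly_sin (u : R) k : trigpoly (fun x => sin (u * x 0 k)).
Proof.
have := trigpoly_cos (u *: delta_mx 0 k) (- (pi / 2)).
congr trigpoly; apply/funext => x.
have -> : dotr (u *: delta_mx 0 k) x = u * x 0 k.
  rewrite /dotr (bigD1 k)//= big1 ?addr0 => [|l lk].
    by rewrite !mxE !eqxx mulr1.
  by rewrite !mxE (negbTE lk) andbF mulr0 mul0r.
by rewrite cosBpihalf.
Qed.

End TrigonometricPolynomials.

Section Bernstein.
Variable R : realType.
Implicit Types (s a : R) (phi : nat -> R).

(** The law of the number of successes in [n] trials of probability [s]. The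
    recursion on the last trial makes the moments and the stability under
    [trigpoly] immediate inductions *)
Fixpoint bernstein n j s : R :=
  if n is n'.+1 then
    s * (if j is j'.+1 then bernstein n' j' s else 0) + (1 - s) * bernstein n' j s
  else (j == 0%N)%:R.

Lemma bernstein_big n j s : (n < j)%N -> bernstein n j s = 0.
Proof.
elim: n j => [|n IH] [|j]//= nj.
by rewrite !IH ?mulr0 ?addr0// ltnW.
Qed.

Lemma bernstein_ge0 n j s : 0 <= s <= 1 -> 0 <= bernstein n j s.
Proof.
move=> /andP[s0 s1]; elim: n j => [|n IH] j /=; first by case: (j == 0%N).
apply: addr_ge0; apply: mulr_ge0 => //; last by rewrite subr_ge0.
by case: j.
Qed.

Lemma bernstein_sumS n s phi :
  \sum_(j < n.+2) bernstein n.+1 j s * phi j =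
  s * (\sum_(j < n.+1) bernstein n j s * phi j.+1)
  + (1 - s) * (\sum_(j < n.+1) bernstein n j s * phi j).
Proof.
rewrite (eq_bigr (fun j : 'I_n.+2 =>
  s * ((if j : nat is j'.+1 then bernstein n j' s else 0) * phi j)
  + (1 - s) * (bernstein n j s * phi j))); last first.
  by move=> j _ /=; rewrite mulrDl !mulrA.
rewrite big_split/= -!mulr_sumr; congr (_ * _ + _ * _).
  by rewrite big_ord_recl/= mul0r add0r.
by rewrite big_ord_recr/= bernstein_big// mul0r addr0.
Qed.

Lemma bernstein_sum1 n s : \sum_(j < n.+1) bernstein n j s = 1.
Proof.
elim: n => [|n IH]; first by rewrite big_ord1.
have := bernstein_sumS n s (fun=> 1).
under eq_bigr do rewrite mulr1; move=> ->.
by under eq_bigr do rewrite mulr1; rewrite IH; ring.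
Qed.

(** The second moment about an arbitrary centre [a], the form in which the
    induction on [n] goes through *)
Lemma bernstein_variance n s a :
  \sum_(j < n.+1) bernstein n j s * (j%:R - a) ^+ 2 =
  (n%:R * s - a) ^+ 2 + n%:R * s * (1 - s).
Proof.
elim: n a => [|n IH] a.
  by rewrite big_ord1 /= mul1r !mul0r addr0.
rewrite (bernstein_sumS n s (fun j => (j%:R - a) ^+ 2)).
under eq_bigr do rewrite -natr1 -addrA -[1 - a]opprB.
by rewrite !IH -natr1; ring.
Qed.

End Bernstein.

Section Modulus.
Variables (R : realType) (m : nat) (f : 'rV[R]_m -> R) (sg : R -> R) (B L : R).
Hypotheses (f_cont : continuous f) (fB : forall x, `|f x| <= B).
Hypotheses (sg_cont : continuous sg)
  (sg_inj : {in `[- L, L] &, injective sg}).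

Lemma real_continuous_sum (T : topologicalType) (I : Type) (r : seq I)
    (F : I -> T -> R) : (forall i, continuous (F i)) ->
  continuous (fun x => \sum_(i <- r) F i x).
Proof.
move=> cF; elim: r => [|i r IH].
  by under eq_fun do rewrite big_nil; move=> x; exact: cvg_cst.
under eq_fun do rewrite big_cons.
by move=> x; apply: cvgD; [exact: cF|exact: IH].
Qed.

Lemma row_continuous (T : topologicalType) n (F : T -> 'rV[R]_n) :
  (forall k, continuous (fun x => F x 0 k)) -> continuous F.
Proof.
move=> cF x U [P Px PU]; rewrite /nbhs /=.
have : \forall y \near x, forall k : 'I_n, P 0 k (F y 0 k).
  by apply: filter_forall => k; exact: cF.
by apply: filterS => y Py; apply: PU => i k; rewrite ord1.
Qed.

(** On the pairs [(x, y)] of a cube, [e + n * D (x, y)] with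
    [D = \sum_k (sg x_k - sg y_k)^2] eventually exceeds [|f x - f y|]: near the
    diagonal [f x - f y] is small, and off the diagonal [D] is positive because
    [sg] is injective. Compactness makes [n] uniform *)
Lemma compact_modulus (e : R) : 0 < e -> exists K : nat,
  forall x y : 'rV[R]_m, (forall k, `|x 0 k| <= L) -> (forall k, `|y 0 k| <= L) ->
  `|f x - f y| <= e + K%:R * \sum_k (sg (x 0 k) - sg (y 0 k)) ^+ 2.
Proof.
move=> e0.
(* A pair of vectors is encoded as one vector of double length, so that the
   cube of pairs is a product of segments. *)
pose cube := [set z : 'rV[R]_(m + m) | forall i, `[- L, L]%classic (z ord0 i)].
have ccube : compact cube.
  by apply: (@rV_compact R (m + m) (fun=> `[- L, L]%classic)) => i; exact: segment_compact.
pose X (z : 'rV[R]_(m + m)) : 'rV[R]_m := \row_k z 0 (lshift m k).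
pose Y (z : 'rV[R]_(m + m)) : 'rV[R]_m := \row_k z 0 (rshift m k).
have cX : continuous X.
  by apply: row_continuous => k; under eq_fun do rewrite mxE; exact: coord_continuous.
have cY : continuous Y.
  by apply: row_continuous => k; under eq_fun do rewrite mxE; exact: coord_continuous.
pose D (z : 'rV[R]_(m + m)) := \sum_k (sg (z 0 (lshift m k)) - sg (z 0 (rshift m k))) ^+ 2.
have cD : continuous D.
  apply: real_continuous_sum => k z.
  have csg l : {for z, continuous (fun z : 'rV[R]_(m + m) => sg (z 0 l))}.
    apply: (@continuous_comp _ _ _ (fun z : 'rV[R]_(m + m) => z 0 l) sg z).
      exact: coord_continuous.
    exact: sg_cont.
  have cdif := cvgB (csg (lshift m k)) (csg (rshift m k)).
  apply: (@continuous_comp _ _ _ (fun z : 'rV[R]_(m + m) =>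
    sg (z 0 (lshift m k)) - sg (z 0 (rshift m k))) (fun x : R => x ^+ 2) z).
    exact: cdif.
  exact: exprn_continuous.
pose F (z : 'rV[R]_(m + m)) := `|f (X z) - f (Y z)|.
have cF : continuous F.
  move=> z.
  have c1 : {for z, continuous (fun z => f (X z))}.
    by apply: (@continuous_comp _ _ _ X f z); [exact: cX|exact: f_cont].
  have c2 : {for z, continuous (fun z => f (Y z))}.
    by apply: (@continuous_comp _ _ _ Y f z); [exact: cY|exact: f_cont].
  exact: (cvg_norm (cvgB c1 c2)).
have D_ge0 z : 0 <= D z by apply: sumr_ge0 => k _; exact: sqr_ge0.
have F_le z : F z <= B + B by rewrite (le_trans (ler_normB _ _))// lerD.
have [K _ HK] : \forall n \near \oo, cube `<=` (fun z => F z < e + n%:R * D z).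
  move/compact_near_coveringP : ccube; apply => z cz.
  have [Dz0|Dz] := eqVneq (D z) 0.
    have XY : X z = Y z.
      apply/rowP => k; rewrite !mxE.
      apply: sg_inj; [exact: cz|exact: cz|].
      apply/eqP; rewrite -subr_eq0 -sqrf_eq0; move/eqP: Dz0.
      by rewrite psumr_eq0 => [/allP/(_ k)|l _]; [apply; rewrite mem_index_enum|exact: sqr_ge0].
    have Fz : F z < e by rewrite /F XY subrr normr0.
    near=> z' n => /=; apply: (@lt_le_trans _ _ e); last first.
      by rewrite lerDl mulr_ge0.
    near: z'; exact: (cvgr_lt (F z) (cF z)).
  have Dz_gt0 : 0 < D z by rewrite lt_def Dz D_ge0.
  near=> z' n => /=.
  apply: (@le_lt_trans _ _ (B + B)); first exact: F_le.
  apply: (@lt_le_trans _ _ (e + n%:R * (D z / 2))); last first.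
    rewrite lerD2l ler_wpM2l// ltW//.
    near: z'; apply: (cvgr_gt (D z) (cD z)).
    by rewrite ltr_pdivrMr// ltr_pMr// ltr1n.
  rewrite -ltrBlDl -ltr_pdivrMr ?divr_gt0//.
  near: n; exact: nbhs_infty_gtr.
exists K => x y xL yL.
pose z : 'rV[R]_(m + m) := row_mx x y.
have cz : cube z.
  move=> i; rewrite /= in_itv/= -ler_norml /z.
  by case: (split_ordP i) => k ->; rewrite ?row_mxEl ?row_mxEr; [exact: xL|exact: yL].
have := HK K (leqnn K) z cz; rewrite /F /D => /ltW.
have -> : X z = x by apply/rowP => k; rewrite mxE row_mxEl.
have -> : Y z = y by apply/rowP => k; rewrite mxE row_mxEr.
by under eq_bigr do rewrite row_mxEl row_mxEr.
Unshelve. all: by end_near. Qed.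

End Modulus.

Section MultiBernstein.
Variables (R : realType) (m n : nat) (s : 'I_m -> R).
Hypothesis s01 : forall k, 0 <= s k <= 1.
Notation nodes := {ffun 'I_m -> 'I_n.+1}.

(** Product of one-dimensional Bernstein weights, that is the law of [m]
    independent binomial variables *)
Definition bweight (kappa : nodes) : R := \prod_k bernstein n (kappa k) (s k).

Lemma bweight_ge0 kappa : 0 <= bweight kappa.
Proof. by apply: prodr_ge0 => k _; exact: bernstein_ge0. Qed.

Lemma bweight_sum1 : \sum_(kappa : nodes) bweight kappa = 1.
Proof.
rewrite -(bigA_distr_bigA (fun k (j : 'I_n.+1) => bernstein n j (s k))).
by apply: big1 => k _; exact: bernstein_sum1.
Qed.

(** The other coordinates sum to one, which leaves the variance of a
    binomial variable divided by [n ^ 2] *)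
Lemma bweight_variance l : (0 < n)%N ->
  \sum_(kappa : nodes) bweight kappa * (s l - (kappa l)%:R / n%:R) ^+ 2
  <= n%:R^-1.
Proof.
move=> n0; pose F k (j : 'I_n.+1) := bernstein n j (s k) *
  (if k == l then (s l - j%:R / n%:R) ^+ 2 else 1).
rewrite (eq_bigr (fun kappa : nodes => \prod_k F k (kappa k))); last first.
  move=> kappa _; rewrite big_split/=; congr (_ * _).
  by rewrite -big_mkcond/= big_pred1_eq.
rewrite -(bigA_distr_bigA F) (bigD1 l)//= [X in _ * X]big1 ?mulr1; last first.
  move=> k kl; rewrite /F (negbTE kl).
  by under eq_bigr do rewrite mulr1; exact: bernstein_sum1.
have nN : n%:R != 0 :> R by rewrite pnatr_eq0 -lt0n.
rewrite /F eqxx (eq_bigr (fun j : 'I_n.+1 => (n%:R ^+ 2)^-1 *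
    (bernstein n j (s l) * (j%:R - n%:R * s l) ^+ 2))); last first.
  by move=> j _; field.
rewrite -mulr_sumr bernstein_variance subrr expr0n add0r.
have /andP[s0 s1] := s01 l.
rewrite [leLHS](_ : _ = n%:R^-1 * (s l * (1 - s l))); last by field.
rewrite ler_piMr ?invr_ge0//; nra.
Qed.

End MultiBernstein.

Section TrigApproximation.
Variables (R : realType) (m : nat).

(** Bernstein approximation in the variables [(1 + sin (u x_k)) / 2]. The
    frequency [u] is so small that these are injective on the cube of half side [L];
    outside the cube the periodic approximant is only bounded by [B], and the
    quadratic weight absorbs the error [2 B] *)
Theorem trig_approx (f : 'rV[R]_m -> R) (B e : R) : continuous f ->
  (forall x, `|f x| <= B) -> 0 < e ->
  exists2 g, trigpoly g &
    forall x, `|f x - g x| <= e * (1 + \sum_k x 0 k ^+ 2).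
Proof.
move=> cf fB e0.
have B0 : 0 <= B := le_trans (normr_ge0 _) (fB 0).
(* [L >= 1] gives [x_k^2 >= |x_k| >= L] outside the cube, and there
   [e * L >= 2 B]. *)
pose L : R := 1 + 2 * B / e.
have L1 : 1 <= L by rewrite lerDl divr_ge0 ?mulr_ge0// ltW.
have L0 : 0 < L := lt_le_trans ltr01 L1.
pose u : R := pi / 2 / L.
have u0 : 0 < u by rewrite !divr_gt0// pi_gt0.
have uL : u * L = pi / 2 by rewrite mulfVK// gt_eqF.
pose sg (x : R) : R := (1 + sin (u * x)) / 2.
have sg01 x : 0 <= sg x <= 1.
  rewrite /sg; have := sin_geN1 (u * x); have := sin_le1 (u * x) => h1 h2.
  by apply/andP; split; lra.
have sg_cont : continuous sg.
  move=> x; apply: cvgM; last exact: cvg_cst.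
  apply: cvgD; first exact: cvg_cst.
  apply: (@continuous_comp _ _ _ (fun x : R => u * x) sin x).
    exact: mulrl_continuous.
  exact: continuous_sin.
have in_pihalf x : x \in `[- L, L] -> u * x \in `[- (pi / 2), pi / 2].
  rewrite !in_itv/= -!ler_norml => xL; rewrite normrM gtr0_norm//.
  by rewrite -uL ler_pM2l.
have sg_inj : {in `[- L, L] &, injective sg}.
  move=> x y xL yL /eqP; rewrite /sg (inj_eq (mulIf _)) ?invr_eq0//.
  rewrite (inj_eq (addrI _)) => /eqP.
  move/(sin_inj (in_pihalf _ xL) (in_pihalf _ yL)).
  by apply: mulfI; rewrite gt_eqF.
have [K HK] := compact_modulus cf fB sg_cont sg_inj (divr_gt0 e0 (ltr0n R 2)).
(* The variance of each Bernstein coordinate is at most [1 / n], and there are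
   [m] of them. *)
pose n := (Num.truncn (2 * K%:R * m%:R / e)).+1.
have n_big : K%:R * (m%:R * n%:R^-1) <= e / 2.
  have : 2 * K%:R * m%:R / e < n%:R := truncnS_gt _.
  by rewrite ltr_pdivrMr// mulrA ler_pdivrMr ?ltr0n// => hn; lra.
have n0 : (0 < n)%N by [].
(* The preimages under [sg] of the grid points [kappa_k / n]. *)
pose node (kappa : {ffun 'I_m -> 'I_n.+1}) : 'rV[R]_m :=
  \row_k (asin (2 * (kappa k)%:R / n%:R - 1) / u).
have node_arg (j : 'I_n.+1) : -1 <= (2 * j%:R / n%:R - 1 : R) <= 1.
  have jn : j%:R / n%:R <= 1 :> R.
    by rewrite ler_pdivrMr ?ltr0n// mul1r ler_nat -ltnS.
  have j0 : 0 <= j%:R / n%:R :> R by rewrite divr_ge0.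
  by rewrite -mulrA; apply/andP; split; lra.
have node_cube kappa k : `|node kappa 0 k| <= L.
  rewrite mxE normrM normfV (gtr0_norm u0) ler_pdivrMr// [leRHS]mulrC uL ler_norml.
  by rewrite asin_geNpi2// asin_lepi2.
have sg_node kappa k : sg (node kappa 0 k) = (kappa k)%:R / n%:R.
  rewrite mxE /sg [u * _]mulrC mulfVK ?gt_eqF// asinK; last by rewrite in_itv/= node_arg.
  by field; rewrite pnatr_eq0.
pose g (x : 'rV[R]_m) := \sum_(kappa : {ffun 'I_m -> 'I_n.+1})
  f (node kappa) * bweight (fun k => sg (x 0 k)) kappa.
have w0 (x : 'rV[R]_m) (kappa : {ffun 'I_m -> 'I_n.+1}) :
    0 <= bweight (fun k => sg (x 0 k)) kappa by apply: bweight_ge0.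
exists g.
  apply: trigpoly_sum => kappa; apply: trigpolyZ; apply: trigpoly_prod => k.
  have tsg : trigpoly (fun x : 'rV[R]_m => sg (x 0 k)).
    have := trigpolyZ 2^-1 (trigpolyD (trigpoly_cst m 1) (trigpoly_sin u k)).
    by congr trigpoly; apply/funext => x; rewrite mulrC.
  move: (nat_of_ord (kappa k)) => j; elim: n {n_big n0 node node_arg node_cube sg_node g w0 kappa} j => [|n IH] j /=.
    exact: trigpoly_cst.
  apply: trigpolyD; apply: trigpolyM => //.
    by case: j => [|j]; [exact: trigpoly_cst|exact: IH].
  have := trigpolyD (trigpoly_cst m 1) (trigpolyZ (-1) tsg).
  by congr trigpoly; apply/funext => x; rewrite mulN1r.
move=> x.
have fgE : f x - g x = \sum_(kappa : {ffun 'I_m -> 'I_n.+1})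
    bweight (fun k => sg (x 0 k)) kappa * (f x - f (node kappa)).
  rewrite -[f x in LHS]mul1r -(@bweight_sum1 R m n (fun k => sg (x 0 k))).
  rewrite mulr_suml -sumrB; apply: eq_bigr => kappa _.
  by rewrite mulrBr [f (node _) * _]mulrC.
have [xL|] := pselect (forall k, `|x 0 k| <= L).
  apply: (@le_trans _ _ e); last first.
    by rewrite ler_peMr ?(ltW e0)// lerDl sumr_ge0// => k _; exact: sqr_ge0.
  rewrite fgE (le_trans (ler_norm_sum _ _ _))//.
  apply: (@le_trans _ _ (\sum_(kappa : {ffun 'I_m -> 'I_n.+1})
    (bweight (fun k => sg (x 0 k)) kappa * (e / 2) + K%:R * \sum_k
      (bweight (fun k => sg (x 0 k)) kappa * (sg (x 0 k) - (kappa k)%:R / n%:R) ^+ 2)))).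
    apply: ler_sum => kappa _; rewrite normrM ger0_norm//.
    apply: le_trans (ler_wpM2l (w0 x kappa) (HK x (node kappa) xL (node_cube kappa))) _.
    rewrite mulrDr lerD2l mulrCA ler_wpM2l// mulr_sumr.
    by apply: ler_sum => k _; rewrite sg_node.
  rewrite big_split/= -mulr_suml bweight_sum1 mul1r -mulr_sumr exchange_big/=.
  rewrite [leRHS]splitr lerD2l; apply: le_trans n_big; rewrite ler_wpM2l//.
  apply: (@le_trans _ _ (\sum_(k < m) n%:R^-1)); last first.
    by rewrite sumr_const card_ord mulr_natl.
  by apply: ler_sum => k _; exact: bweight_variance.
move=> /existsNP[k /negP]; rewrite -ltNge => xk.
have gB : `|g x| <= B.
  rewrite (le_trans (ler_norm_sum _ _ _))// -[leRHS]mulr1.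
  rewrite -(@bweight_sum1 R m n (fun k => sg (x 0 k))) mulr_sumr.
  by apply: ler_sum => kappa _; rewrite normrM [X in _ * X]ger0_norm// ler_wpM2r.
apply: (le_trans (ler_normB _ _)); apply: (@le_trans _ _ (B + B)); first exact: lerD.
apply: (@le_trans _ _ (e * L)).
  by rewrite /L mulrDr mulr1 mulrC mulfVK ?gt_eqF// -mulr2n mulr_natl lerDr ltW.
rewrite ler_pM2l//; apply: (@le_trans _ _ (x 0 k ^+ 2)).
  rewrite -real_normK ?num_real// expr2; apply: (@le_trans _ _ (`|x 0 k| * 1)).
    by rewrite mulr1 ltW.
  by rewrite ler_wpM2l// (le_trans L1)// ltW.
rewrite (bigD1 k)//= addrCA lerDl addr_ge0// sumr_ge0// => i _; exact: sqr_ge0.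
Qed.

End TrigApproximation.

(** * The standard normal law *)

Section NormalIntegral.
Context {R : realType}.
Notation mu := (@lebesgue_measure R).
Local Open Scope ereal_scope.

Lemma ge0_integral_normal (m s : R) (f : R -> \bar R) :
  measurable_fun [set: R] f -> (forall x, 0 <= f x) ->
  \int[normal_prob m s]_x f x = \int[mu]_x (f x * (normal_pdf m s x)%:E).
Proof.
move=> mf f0.
have dom := normal_prob_dominates m s.
rewrite -(Radon_Nikodym_SigmaFinite.change_of_variables dom)//=.
apply: ae_eq_integral => //.
- apply: emeasurable_funM => //; apply: (measurable_int mu).
  exact: Radon_Nikodym_SigmaFinite.f_integrable.
- apply: emeasurable_funM => //=; apply/measurableT_comp => //=.
  exact: measurable_normal_pdf.
- apply: ae_eqe_mul2l => /=.
  apply: integral_ae_eq => //=.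
  + exact: Radon_Nikodym_SigmaFinite.f_integrable.
  + by apply/measurableT_comp => //; exact: measurable_normal_pdf.
  + by move=> E _ mE; rewrite -Radon_Nikodym_SigmaFinite.f_integral.
Qed.

Lemma integral_normal (m s : R) (f : R -> R) :
  measurable_fun [set: R] f ->
  mu.-integrable setT (fun x => (f x * normal_pdf m s x)%:E) ->
  (normal_prob m s).-integrable setT (EFin \o f) /\
  \int[normal_prob m s]_x (f x)%:E = \int[mu]_x (f x * normal_pdf m s x)%:E.
Proof.
move=> mf intf.
have mEf : measurable_fun [set: R] (EFin \o f) by exact/measurable_EFinP.
have p0 x : 0 <= (normal_pdf m s x)%:E by rewrite lee_fin normal_pdf_ge0.
split.
  apply/integrableP; split => //.
  rewrite ge0_integral_normal//; last exact: measurableT_comp.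
  move/integrableP : intf => [_]; apply: le_lt_trans.
  rewrite le_eqVlt; apply/orP; left; apply/eqP; apply: eq_integral => x _ /=.
  by rewrite normrM EFinM (ger0_norm (normal_pdf_ge0 _ _ _)).
rewrite integralE ge0_integral_normal//; last exact: measurable_funepos.
rewrite (ge0_integral_normal m s (f := (EFin \o f)^\-))//; last first.
  exact: measurable_funeneg.
rewrite [RHS]integralE; congr (_ - _); apply: eq_integral => x _.
  rewrite /= !funeposE /= -!EFin_max -EFinM maxr_pMl ?mul0r//.
  exact: normal_pdf_ge0.
rewrite /= !funenegE /= -!EFin_max -EFinM maxr_pMl ?mul0r ?mulNr//.
exact: normal_pdf_ge0.
Qed.

End NormalIntegral.

Section NormalAffine.
Context {R : realType}.
Notation mu := (@lebesgue_measure R).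
Implicit Types (m s b x : R).

Definition affine x b (y : measurableTypeR R) : measurableTypeR R := x + b * y.

Lemma measurable_affine x b : measurable_fun setT (affine x b).
Proof. by apply: measurable_funD => //; apply: measurable_funM. Qed.

(** Uniqueness of the Lebesgue measure: the scaled image measure has the
    right value on half-open intervals *)
Lemma lebesgue_measure_affine x b (A : set (measurableTypeR R)) : 0 < b -> measurable A ->
  (b%:E * pushforward mu (affine x b) A)%E = mu A.
Proof.
move=> b0 mA.
have := @lebesgue_measure_unique R
  (mscale (NngNum (ltW b0)) (pushforward mu (affine x b))).
move=> /(_ (measurable_affine x b)) H.
apply/esym; apply: H => // _ [[l u]] _ <-; apply/esym.
rewrite -[LHS]/(b%:E * mu (affine x b @^-1` `]l, u]%classic))%E.
have -> : affine x b @^-1` `]l, u] = `](l - x) / b, (u - x) / b]%classic.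
  apply/seteqP; split => y /=; rewrite !in_itv/= /affine.
    by rewrite ltr_pdivrMr// ler_pdivlMr// ltrBlDl lerBrDl mulrC.
  by rewrite ltr_pdivrMr// ler_pdivlMr// ltrBlDl lerBrDl mulrC.
rewrite !lebesgue_measure_itv/= !lte_fin ltr_pM2r ?invr_gt0// ltrD2r.
case: ifP => _; last by rewrite mule0.
by rewrite -!EFinB -EFinM -mulrBl mulrC mulfVK ?gt_eqF// opprB addrA subrK.
Qed.

Lemma normal_pdf_affine x b y : 0 < b ->
  normal_pdf 0 1 y = b * normal_pdf x b (affine x b y).
Proof.
move=> b0; have bN : b != 0 by rewrite gt_eqF.
rewrite !normal_pdfE ?oner_eq0// mulrA; congr (_ * _).
  rewrite /normal_peak expr1n mul1r -mulrnAr sqrtrM ?sqr_ge0// sqrtr_sqr gtr0_norm//.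
  by rewrite invfM mulVKf.
rewrite /normal_fun /affine; congr expR; rewrite subr0 addrAC subrr add0r.
by rewrite expr1n; field; rewrite bN.
Qed.

Lemma normal_prob_affine x b (A : set (measurableTypeR R)) : 0 < b -> measurable A ->
  normal_prob 0 1 (affine x b @^-1` A) = normal_prob x b A.
Proof.
move=> b0 mA; rewrite /normal_prob.
have mpdf := measurable_normal_pdf x b.
have mEpdf : measurable_fun setT (fun z => (normal_pdf x b z)%:E) by exact/measurable_EFinP.
have maff := measurable_affine x b.
transitivity (b%:E * \int[mu]_(y in affine x b @^-1` A)
    (((fun z => (normal_pdf x b z)%:E) \o affine x b) y))%E.
  rewrite -ge0_integralZl//.
  - by apply: eq_integral => y _; rewrite (normal_pdf_affine x y b0) EFinM.
  - by rewrite -[X in measurable X]setTI; exact: maff.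
  - by apply: measurable_funTS; exact: measurableT_comp.
  - by move=> y _; rewrite lee_fin normal_pdf_ge0.
  - by rewrite lee_fin ltW.
rewrite -(@ge0_integral_pushforward _ _ _ _ _ _ maff mu A)//; last 2 first.
- exact: measurable_funTS.
- by move=> y _; rewrite lee_fin normal_pdf_ge0.
rewrite -[b%:E]/((NngNum (ltW b0))%:num%:E) -ge0_integral_mscale//; last 2 first.
- exact: measurable_funTS.
- by move=> y _; rewrite lee_fin normal_pdf_ge0.
apply: eq_measure_integral => /= B mB _.
exact: lebesgue_measure_affine.
Qed.

End NormalAffine.

Section NormalConvolution.
Context {R : realType}.
Notation mu := (@lebesgue_measure R).
Implicit Types (s b : R).

(** Completing the square: the joint density of a centred normal mean and a
    normal variable around it, written with the conditioning reversed *)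
Lemma normal_pdf_product s b (r := Num.sqrt (s ^+ 2 + b ^+ 2)) (x z : R) :
  0 < s -> 0 < b ->
  normal_pdf x b z * normal_pdf 0 s x =
  normal_pdf 0 r z * normal_pdf (z * s ^+ 2 / r ^+ 2) (s * b / r) x.
Proof.
move=> s0 b0.
have r2 : r ^+ 2 = s ^+ 2 + b ^+ 2 by rewrite sqr_sqrtr// addr_ge0// sqr_ge0.
have r0 : 0 < r by rewrite sqrtr_gt0 addr_gt0// exprn_gt0.
have sN : s != 0 by rewrite gt_eqF.
have bN : b != 0 by rewrite gt_eqF.
have rN : r != 0 by rewrite gt_eqF.
have sbr0 : 0 < s * b / r by rewrite divr_gt0// mulr_gt0.
rewrite !normal_pdfE// ?(gt_eqF sbr0)//.
rewrite mulrACA [RHS]mulrACA; congr (_ * _).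
  rewrite /normal_peak -!invfM -!sqrtrM; try by rewrite mulrn_wge0// mulr_ge0 ?sqr_ge0// pi_ge0.
  congr (Num.sqrt _)^-1; field.
  by rewrite rN.
rewrite /normal_fun -!expRD; congr expR.
have bq : s ^+ 2 + b ^+ 2 != 0 by rewrite -r2 expf_neq0.
rewrite !exprMn exprVn r2; field.
by rewrite sN bN bq.
Qed.

Lemma normal_convolution s b (A : set (measurableTypeR R)) : 0 < s -> 0 < b -> measurable A ->
  (\int[normal_prob 0 s]_x normal_prob x b A)%E =
  normal_prob 0 (Num.sqrt (s ^+ 2 + b ^+ 2)) A.
Proof.
move=> s0 b0 mA; set r := Num.sqrt _.
pose g (w : measurableTypeR R * measurableTypeR R) : \bar R :=
  (normal_pdf w.1 b w.2 * \1_A w.2)%:E.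
pose h (w : measurableTypeR R * measurableTypeR R) : \bar R :=
  (normal_pdf w.1 b w.2 * normal_pdf 0 s w.1 * \1_A w.2)%:E.
have mpdf : measurable_fun setT (fun w : measurableTypeR R * measurableTypeR R =>
    normal_pdf w.1 b w.2).
  under eq_fun do rewrite normal_pdfE ?(gt_eqF b0)//.
  apply: measurable_funM => //; apply: measurableT_comp => //.
  apply: measurable_funM => //; apply: measurableT_comp => //.
  by apply: measurable_funX; apply: measurable_funB.
have mind : measurable_fun setT (fun w : measurableTypeR R * measurableTypeR R => \1_A w.2 : R).
  by apply: measurableT_comp => //; exact: measurable_indic.
have mg : measurable_fun setT g by apply/measurable_EFinP; exact: measurable_funM.
have mh : measurable_fun setT h.
  apply/measurable_EFinP; apply: measurable_funM => //; apply: measurable_funM => //.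
  by apply: measurableT_comp => //; exact: measurable_normal_pdf.
have g0 w : (0 <= g w)%E by rewrite lee_fin mulr_ge0// normal_pdf_ge0.
have h0 w : (0 <= h w)%E by rewrite lee_fin mulr_ge0// mulr_ge0// normal_pdf_ge0.
have NE x : normal_prob x b A = (\int[mu]_z g (x, z))%E.
  rewrite /normal_prob integral_mkcond; apply: eq_integral => z _.
  by rewrite patchE /g /= indicE; case: ifPn => zA; rewrite ?mulr1 ?mulr0.
have mN : measurable_fun setT (fun x : measurableTypeR R => normal_prob x b A).
  under eq_fun do rewrite NE.
  exact: measurable_fun_fubini_tonelli_F.
rewrite ge0_integral_normal//.
transitivity (\int[mu]_x \int[mu]_z h (x, z))%E.
  apply: eq_integral => x _; rewrite NE muleC -ge0_integralZl//.
  - by apply: eq_integral => z _; rewrite /g /h/= -EFinM mulrA [normal_pdf 0 s x * _]mulrC.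
  - exact: (measurableT_comp mg).
  - by rewrite lee_fin normal_pdf_ge0.
rewrite (@fubini_tonelli _ _ _ _ _ mu mu h)//.
rewrite /normal_prob [RHS]integral_mkcond; apply: eq_integral => z _.
rewrite patchE /h/=.
under eq_integral do rewrite normal_pdf_product// -/r mulrAC EFinM.
rewrite ge0_integralZl//; last 3 first.
- by apply/measurable_EFinP; exact: measurable_normal_pdf.
- by move=> x _; rewrite lee_fin normal_pdf_ge0.
- by rewrite lee_fin mulr_ge0// normal_pdf_ge0.
rewrite integral_normal_pdf mule1 indicE.
by case: ifPn => zA; rewrite ?mulr1 ?mulr0.
Qed.

End NormalConvolution.

Section StandardNormal.
Context {R : realType}.
Notation mu := (@lebesgue_measure R).
Notation phi := (normal_pdf (0 : R) 1).
Implicit Types (x y r s theta : R).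

Lemma phiE x : phi x = normal_peak 1 * expR (- (x ^+ 2 / 2)).
Proof.
rewrite normal_pdfE ?oner_eq0//; congr (_ * expR _).
by rewrite subr0 expr1n mulNr.
Qed.

Lemma is_derive_phi x : is_derive x 1 phi (- (x * phi x)).
Proof.
have dq : is_derive x (1 : R) (fun x : R => - (x ^+ 2 / 2)) (- x).
  apply: (@quadratic_is_derive _ _ _ _ 1) => h.
  have -> : - ((x + h) ^+ 2 / 2) - - (x ^+ 2 / 2) - h * - x = - (h ^+ 2 / 2) by field.
  have h0 := sqr_ge0 h; rewrite normrN ger0_norm; last by rewrite divr_ge0.
  by lra.
have de := @is_derive1_comp _ expR (fun x : R => - (x ^+ 2 / 2)) x _ _
  (@is_derive_expR R (- (x ^+ 2 / 2))) dq.
have dc := @is_deriveM R R (cst (normal_peak (1 : R))) _ x 1 _ _ (is_derive_cst _ _ _) de.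
have phi_eq : cst (normal_peak (1 : R)) * (expR \o (fun x : R => - (x ^+ 2 / 2))) = phi.
  by apply/funext => y; rewrite phiE.
rewrite phi_eq in dc; apply: is_derive_eq.
by rewrite phiE -![_ *: _]/(_ * _)/=; ring.
Qed.

Lemma phi_ge0 x : 0 <= phi x. Proof. exact: normal_pdf_ge0. Qed.

Lemma phi_continuous : continuous phi.
Proof. exact: continuous_normal_pdf (oner_neq0 _). Qed.

Lemma phi_even x : phi (- x) = phi x.
Proof. by rewrite !phiE sqrrN. Qed.

(** From [exp (n^2 / 2) >= 1 + n^2 / 2]; it kills the boundary terms in the
    integrations by parts below *)
Lemma phi_decay : n.+1%:R * phi n.+1%:R @[n --> \oo] --> (0 : R).
Proof.
have c0 : 0 <= normal_peak (1 : R) by exact: normal_peak_ge0.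
apply: (@squeeze_cvgr _ _ _ _ (cst 0) (fun n => 2 * normal_peak 1 * n.+1%:R^-1)).
- apply: nearW => n; have n0 : 0 < n.+1%:R :> R by rewrite ltr0n.
  rewrite mulr_ge0 ?phi_ge0//= phiE.
  rewrite mulrCA -mulrA [leRHS]mulrCA ler_wpM2l//.
  rewrite expRN ler_pdivrMr ?expR_gt0//.
  have h := @expR_ge1Dx R (n.+1%:R ^+ 2 / 2).
  have k0 : 0 <= 2 / n.+1%:R :> R by rewrite divr_ge0.
  apply: (le_trans _ (ler_wpM2l k0 h)).
  rewrite mulrDr mulr1 -[leLHS]add0r lerD//.
  by rewrite le_eqVlt; apply/orP; left; apply/eqP; field; rewrite gt_eqF.
- exact: cvg_cst.
- rewrite -[X in _ --> X](mulr0 (2 * normal_peak 1)).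
  by apply: cvgM; [exact: cvg_cst|exact: cvg_harmonic].
Qed.

Definition window n : set (measurableTypeR R) := `[- n.+1%:R, n.+1%:R]%classic.

Lemma measurable_window n : measurable (window n).
Proof. exact: measurable_itv. Qed.

Lemma window_nd : nondecreasing_seq window.
Proof.
move=> n k nk; rewrite subsetEset => y; rewrite /window/= !in_itv/=.
move=> /andP[ny yn]; have nk' : n.+1%:R <= k.+1%:R :> R by rewrite ler_nat.
by rewrite (le_trans _ ny) ?lerN2//= (le_trans yn).
Qed.

Lemma bigcup_window : \bigcup_n window n = setT.
Proof.
apply/seteqP; split => // x _; exists (Num.truncn `|x|) => //.
by rewrite /window/= in_itv/= -ler_norml ltW// truncnS_gt.
Qed.

(** Improper integrals over the line are limits over these bounded windows,
    where the fundamental theorem of calculus applies *)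
Lemma window_FTC (F f : R -> R) n : (forall x, is_derive x 1 F (f x)) ->
  continuous f ->
  (\int[mu]_(x in window n) (f x)%:E = (F n.+1%:R - F (- n.+1%:R))%:E)%E.
Proof.
move=> dF cf; rewrite EFinB.
have cF : continuous F.
  by move=> x; apply/differentiable_continuous/derivable1_diffP/(@ex_derive _ _ _ _ _ _ _ (dF x)).
apply: (@continuous_FTC2 R f F (- n.+1%:R) n.+1%:R).
- by rewrite (@lt_trans _ _ 0)// ?oppr_lt0 ltr0n.
- exact: continuous_subspaceT.
- split.
  + by move=> x _; exact: (@ex_derive _ _ _ _ _ _ _ (dF x)).
  + by apply: cvg_at_right_filter; exact: cF.
  + by apply: cvg_at_left_filter; exact: cF.
- by move=> x _; rewrite derive1E (@derive_val _ _ _ _ _ _ _ (dF x)).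
Qed.

Lemma window_integrable (f : R -> R) n : continuous f ->
  mu.-integrable (window n) (EFin \o f).
Proof.
move=> cf; apply: continuous_compact_integrable; first exact: segment_compact.
exact: continuous_subspaceT.
Qed.

Lemma continuous_real_fun_M (f g : R -> R) : continuous f -> continuous g ->
  continuous (fun x => f x * g x).
Proof. by move=> cf cg x; apply: cvgM; [exact: cf|exact: cg]. Qed.

(** Integration by parts on windows, from
    [(x phi x)' = phi x - x^2 phi x] *)
Lemma second_moment_phi : (\int[mu]_x (x ^+ 2 * phi x)%:E = 1)%E.
Proof.
have cx2 : continuous (fun x : R => x ^+ 2) by exact: exprn_continuous.
have cx2phi := continuous_real_fun_M cx2 phi_continuous.
have mphi := measurable_normal_pdf (0 : R) 1.
have mx2phi := continuous_measurable_fun cx2phi.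
have cphi_lim : (\int[mu]_(x in window n) (phi x)%:E @[n --> \oo] --> 1)%E.
  rewrite -(@integral_normal_pdf R 0 1) -bigcup_window.
  apply: ge0_nondecreasing_set_cvg_integral.
  - exact: window_nd.
  - exact: measurable_window.
  - by move=> n; apply: measurable_funTS; exact/measurable_EFinP.
  - by move=> n x _; rewrite lee_fin phi_ge0.
have lim2 : (\int[mu]_(x in window n) (x ^+ 2 * phi x)%:E @[n --> \oo] -->
    \int[mu]_x (x ^+ 2 * phi x)%:E)%E.
  rewrite -bigcup_window; apply: ge0_nondecreasing_set_cvg_integral.
  - exact: window_nd.
  - exact: measurable_window.
  - by move=> n; apply: measurable_funTS; exact/measurable_EFinP.
  - by move=> n x _; rewrite lee_fin mulr_ge0 ?phi_ge0 ?sqr_ge0.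
have dxphi x : is_derive x 1 (fun x => x * phi x) (phi x - x ^+ 2 * phi x).
  have := @is_deriveM R R id phi x 1 _ _ (is_derive_id _ _) (is_derive_phi x).
  have -> : id x *: - (x * phi x) + phi x *: 1 = phi x - x ^+ 2 * phi x.
    by rewrite -![_ *: _]/(_ * _); ring.
  exact.
have eqn n : (\int[mu]_(x in window n) (x ^+ 2 * phi x)%:E =
    \int[mu]_(x in window n) (phi x)%:E - (2 * (n.+1%:R * phi n.+1%:R))%:E)%E.
  have cdif : continuous (fun x => phi x - x ^+ 2 * phi x).
    by move=> x; apply: cvgB; [exact: phi_continuous|exact: cx2phi].
  have := window_FTC n dxphi cdif.
  rewrite phi_even mulNr opprK -mulr2n -[_ *+ 2]mulr_natl => <-.
  have i1 := window_integrable n phi_continuous.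
  have i2 := window_integrable n cx2phi.
  under [X in (_ - X)%E]eq_integral do rewrite EFinB.
  rewrite integralB//; last exact: measurable_window.
  have f1 : (\int[mu]_(x in window n) (phi x)%:E)%E \is a fin_num.
    exact: (integrable_fin_num (measurable_window n) i1).
  have f2 : (\int[mu]_(x in window n) (x ^+ 2 * phi x)%:E)%E \is a fin_num.
    exact: (integrable_fin_num (measurable_window n) i2).
  by rewrite -(fineK f1) -(fineK f2) -!EFinB; congr _%:E; ring.
have lim3 : (\int[mu]_(x in window n) (x ^+ 2 * phi x)%:E @[n --> \oo] --> 1)%E.
  rewrite (_ : (fun n => _) = fun n =>
    (\int[mu]_(x in window n) (phi x)%:E - (2 * (n.+1%:R * phi n.+1%:R))%:E)%E); last first.
    by apply/funext => n; exact: eqn.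
  rewrite -[X in _ --> X]sube0; apply: cvgeB => //.
  apply: cvg_EFin; first by apply: nearW.
  rewrite -[X in _ --> X](mulr0 2).
  by apply: cvgM; [exact: cvg_cst|exact: phi_decay].
exact: (cvg_unique _ lim2 lim3).
Qed.

End StandardNormal.

Section StandardNormalExpectation.
Context {R : realType}.
Notation mu := (@lebesgue_measure R).
Notation phi := (normal_pdf (0 : R) 1).
Notation gauss := (normal_prob (0 : R) 1).
Implicit Types (x y r s theta : R).

Lemma window_cvg (h : R -> R) : mu.-integrable setT (EFin \o h) ->
  (\int[mu]_(x in window n) (h x)%:E @[n --> \oo] --> \int[mu]_x (h x)%:E)%E.
Proof.
move=> ih.
have mh : measurable_fun setT (EFin \o h) := measurable_int mu ih.
pose hn n := (EFin \o h) \_ (window n).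
have mhn n : measurable_fun setT (hn n).
  apply/(measurable_restrictT _ (measurable_window n)).
  exact: measurable_funTS.
have cvg_h : {ae mu, forall x, setT x -> hn ^~ x @ \oo --> (EFin \o h) x}.
  apply: aeW => x _; apply: cvg_near_cst.
  have [N _ Nx] : (\bigcup_n window n) x by rewrite bigcup_window.
  near=> n; rewrite /hn patchE mem_set//.
  have Nn : (window N <= window n :> set R)%O.
    by apply: window_nd; near: n; exact: nbhs_infty_ge.
  by move: Nn; rewrite subsetEset; apply.
have iabs : mu.-integrable setT (abse \o (EFin \o h)) by exact: integrable_abse.
have le_h : {ae mu, forall x n, setT x -> (`|hn n x| <= (abse \o (EFin \o h)) x)%E}.
  apply: aeW => x n _ /=; rewrite /hn patchE; case: ifPn => // _.
  by rewrite abse0.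
have [_ _] := dominated_convergence measurableT mhn mh cvg_h iabs le_h.
rewrite (_ : (fun n => \int[mu]_(x in window n) _)%E =
  fun n => (\int[mu]_x hn n x)%E)//.
by apply/funext => n; rewrite integral_mkcond.
Unshelve. all: by end_near. Qed.

Lemma integrable_phi_growth (f : R -> R) (a b : R) : continuous f ->
  0 <= a -> 0 <= b -> (forall x, `|f x| <= a + b * x ^+ 2) ->
  mu.-integrable setT (fun x => (f x * phi x)%:E).
Proof.
move=> cf a0 b0 fab.
have mphi := measurable_normal_pdf (0 : R) 1.
have cx2 : continuous (fun x : R => x ^+ 2) by exact: exprn_continuous.
have mx2phi := continuous_measurable_fun (continuous_real_fun_M cx2 phi_continuous).
have mfphi := continuous_measurable_fun (continuous_real_fun_M cf phi_continuous).
have i2 : mu.-integrable setT (EFin \o (fun x => x ^+ 2 * phi x)).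
  apply/integrableP; split; first exact/measurable_EFinP.
  under eq_integral => x _.
    rewrite gee0_abs; last by rewrite lee_fin mulr_ge0 ?sqr_ge0 ?phi_ge0.
    over.
  by rewrite /= second_moment_phi ltry.
have i0 := integrable_normal_pdf (0 : R) 1.
have iab := integrableD measurableT (integrableZl measurableT a i0)
  (integrableZl measurableT b i2).
apply: (le_integrable measurableT _ _ iab) => /=.
  exact/measurable_EFinP.
move=> x _; rewrite [leRHS](_ : _ = `|(a * phi x + b * (x ^+ 2 * phi x))%:E|%E)//.
rewrite /= lee_fin normrM.
have K0 : 0 <= a * phi x + b * (x ^+ 2 * phi x).
  by rewrite addr_ge0// mulr_ge0 ?phi_ge0// mulr_ge0 ?sqr_ge0 ?phi_ge0.
rewrite (ger0_norm (phi_ge0 x)) (ger0_norm K0).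
by rewrite mulrA -mulrDl ler_wpM2r ?phi_ge0.
Qed.

Lemma gauss_integrable (f : R -> R) (a b : R) : continuous f ->
  0 <= a -> 0 <= b -> (forall x, `|f x| <= a + b * x ^+ 2) ->
  gauss.-integrable setT (EFin \o f) /\
  (\int[gauss]_x (f x)%:E = \int[mu]_x (f x * phi x)%:E)%E.
Proof.
move=> cf a0 b0 fab; apply: integral_normal.
  exact: continuous_measurable_fun.
exact: integrable_phi_growth fab.
Qed.

Lemma gauss_second_moment : (\int[gauss]_x (x ^+ 2)%:E = 1)%E.
Proof.
have sq_growth x : `|x ^+ 2| <= 0 + 1 * x ^+ 2.
  by rewrite add0r mul1r ger0_norm// sqr_ge0.
have [_ ->] := gauss_integrable (@exprn_continuous R 2) (lexx _) ler01 sq_growth.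
exact: second_moment_phi.
Qed.

Lemma linear_continuous r theta : continuous (fun x : R => r * x + theta).
Proof.
move=> x; apply: cvgD; last exact: cvg_cst.
exact: mulrl_continuous.
Qed.

Lemma cos_linear_continuous r theta : continuous (fun x : R => cos (r * x + theta)).
Proof.
move=> x; apply: (@continuous_comp _ _ _ (fun x => r * x + theta) cos x).
  exact: linear_continuous.
exact: continuous_cos.
Qed.

Lemma sin_linear_continuous r theta : continuous (fun x : R => sin (r * x + theta)).
Proof.
move=> x; apply: (@continuous_comp _ _ _ (fun x => r * x + theta) sin x).
  exact: linear_continuous.
exact: continuous_sin.
Qed.

Lemma xsin_continuous r theta : continuous (fun x : R => x * sin (r * x + theta)).
Proof.
apply: continuous_real_fun_M; last exact: sin_linear_continuous.
by move=> x; exact: cvg_id.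
Qed.

Lemma xsin_growth r theta x : `|x * sin (r * x + theta)| <= 1 + 1 * x ^+ 2.
Proof.
rewrite normrM mul1r; apply: (@le_trans _ _ `|x|).
  by rewrite ler_piMr// sin_norm_le1.
rewrite -[x ^+ 2]real_normK ?num_real//.
have := sqr_ge0 (`|x| - 1); set y := `|x|; nra.
Qed.

Lemma cos_growth r theta x : `|cos (r * x + theta)| <= 1 + 0 * x ^+ 2.
Proof. by rewrite mul0r addr0 cos_norm_le1. Qed.

(** Integral of the derivative of [sin (r x + theta) * phi x], which vanishes
    at infinity *)
Lemma gauss_stein r theta :
  (\int[gauss]_x (x * sin (r * x + theta)) =
   r * \int[gauss]_x cos (r * x + theta))%R.
Proof.
have [_ E1] := gauss_integrable (@xsin_continuous r theta) ler01 ler01 (xsin_growth r theta).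
have [_ E2] := gauss_integrable (@cos_linear_continuous r theta) ler01 (lexx 0) (cos_growth r theta).
have i1 := integrable_phi_growth (@xsin_continuous r theta) ler01 ler01 (xsin_growth r theta).
have i2 := integrable_phi_growth (@cos_linear_continuous r theta) ler01 (lexx 0) (cos_growth r theta).
rewrite /Rintegral E1 E2 -![fine _]/(Rintegral mu setT _).
have ir2 := integrableZl measurableT r i2.
rewrite -RintegralZl//; apply/eqP; rewrite eq_sym -subr_eq0 -RintegralB//; apply/eqP.
pose h x := r * (cos (r * x + theta) * phi x) - x * sin (r * x + theta) * phi x.
rewrite -[LHS]/(fine (\int[mu]_x (h x)%:E)).
have ih : mu.-integrable setT (EFin \o h).
  by have := integrableB measurableT ir2 i1.
have dh x : is_derive x 1 (fun x => sin (r * x + theta) * phi x) (h x).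
  have dl : is_derive x (1 : R) (fun x => r * x + theta) r.
    apply: (@quadratic_is_derive _ _ _ _ 0) => y.
    by rewrite mul0r (_ : _ - _ = 0) ?normr0//; ring.
  have ds := @is_derive1_comp _ sin (fun x => r * x + theta) x _ _
    (is_derive_sin (r * x + theta)) dl.
  have := is_deriveM ds (is_derive_phi x).
  have -> : (sin \o (fun x => r * x + theta)) x *: - (x * phi x)
      + phi x *: (cos (r * x + theta) * r) = h x.
    by rewrite -![_ *: _]/(_ * _) /h /=; ring.
  exact.
have ch : continuous h.
  have c1 := continuous_real_fun_M (@cos_linear_continuous r theta) phi_continuous.
  have c2 := continuous_real_fun_M (@xsin_continuous r theta) phi_continuous.
  move=> x; apply: cvgB; last exact: c2.
  by apply: cvgM; [exact: cvg_cst|exact: c1].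
have lim1 := window_cvg ih.
have lim2 : (\int[mu]_(x in window n) (h x)%:E @[n --> \oo] --> 0)%E.
  rewrite (_ : (fun n => _) = fun n =>
    ((sin (r * n.+1%:R + theta) - sin (r * - n.+1%:R + theta)) * phi n.+1%:R)%:E); last first.
    by apply/funext => n; rewrite (window_FTC n dh ch) phi_even mulrBl.
  apply: cvg_EFin; first by apply: nearW.
  apply/cvgrPdist_le => e e0; near=> n; rewrite sub0r normrN /=.
  have pe : `|n.+1%:R * phi n.+1%:R| <= e / 2.
    near: n; have := @phi_decay R => /cvgrPdist_le /(_ (e / 2)).
    rewrite divr_gt0// => /(_ isT); apply: filterS => n.
    by rewrite sub0r normrN.
  rewrite normrM; apply: (@le_trans _ _ (2 * `|n.+1%:R * phi n.+1%:R|)).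
    apply: ler_pM => //.
      apply: (le_trans (ler_normB _ _)).
      by rewrite (_ : 2 = 1 + 1)// lerD// sin_norm_le1.
    by rewrite normrM ler_peMl// ger0_norm// ler1n.
  by rewrite mulrC -ler_pdivlMr.
have := cvg_unique _ lim1 lim2.
by move=> ->.
Unshelve. all: by end_near. Qed.

(** The Stein identity says that [r |-> E cos (r s x + theta)] solves exactly
    the differential equation of [gaussian_ode] *)
Lemma gauss_charfun s theta :
  (\int[gauss]_x cos (s * x + theta) = cos theta * expR (- (s ^+ 2) / 2))%R.
Proof.
pose c r := (\int[gauss]_x cos (r * s * x + theta))%R.
(* The derivative of [c], differentiating under the integral. *)
pose d r := (- (s * \int[gauss]_x (x * sin (r * s * x + theta))))%R.
have ic r := (gauss_integrable (@cos_linear_continuous r theta) ler01 (lexx 0) (cos_growth r theta)).1.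
have ix r := (gauss_integrable (@xsin_continuous r theta) ler01 ler01 (xsin_growth r theta)).1.
have i2 : gauss.-integrable setT (EFin \o (fun x : R => x ^+ 2)).
  have sq_growth x : `|x ^+ 2| <= 0 + 1 * x ^+ 2.
    by rewrite add0r mul1r ger0_norm// sqr_ge0.
  exact: (gauss_integrable (@exprn_continuous R 2) (lexx _) ler01 sq_growth).1.
have E2 : (\int[gauss]_x (x ^+ 2) = 1)%R by rewrite /Rintegral gauss_second_moment.
have c_taylor r h : `|c (r + h) - c r - h * d r| <= s ^+ 2 * h ^+ 2.
  have icB := integrableB measurableT (ic ((r + h) * s)) (ic (r * s)).
  have ihs := integrableZl measurableT (h * s) (ix (r * s)).
  have i3 := integrableD measurableT icB ihs.
  rewrite /c /d mulrN opprK mulrA -RintegralB// -RintegralZl// -RintegralD//.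
  apply: (le_trans (le_normr_Rintegral _ i3)) => //.
  have -> : s ^+ 2 * h ^+ 2 = (\int[gauss]_x (s ^+ 2 * h ^+ 2 * x ^+ 2))%R.
    by rewrite (RintegralZl _ measurableT i2) E2 mulr1.
  apply: le_Rintegral; first exact: measurableT.
  - exact: (integrable_norm i3).
  - exact: (integrableZl measurableT _ i2).
  move=> x _; have := cos_taylor (r * s * x + theta) ((r + h) * s * x + theta).
  have -> : (r + h) * s * x + theta - (r * s * x + theta) = h * s * x by ring.
  rewrite -[h * s * x * _]mulrA => /le_trans; apply.
  by rewrite !exprMn [s ^+ 2 * _]mulrC.
have d_ode r : 0 <= r <= 1 -> `|d r + s ^+ 2 * r * c r| <= 0.
  move=> _; rewrite /d gauss_stein -/(c r).
  by rewrite (_ : _ + _ = 0) ?normr0//; ring.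
have := gaussian_ode c_taylor d_ode.
rewrite mul0r normr_le0 subr_eq0 => /eqP.
rewrite /c; under eq_Rintegral do rewrite mul1r.
move=> ->; congr (_ * _).
under eq_Rintegral do rewrite mul0r mul0r add0r.
rewrite Rintegral_cst//.
rewrite [X in fine X](_ : _ = 1%E) ?mulr1//.
exact: (probability_setT (normal_prob (0 : R) 1)).
Qed.

End StandardNormalExpectation.

(** * Independent standard normal variables *)

Section ProductProbability.
Context d1 d2 (T1 : measurableType d1) (T2 : measurableType d2) (R : realType).
Variables (P1 : probability T1 R) (P2 : probability T2 R).

Definition product_probability : set (T1 * T2) -> \bar R := (P1 \x P2)%E.

HB.instance Definition _ := Measure.on product_probability.

Let product_probability_setT : product_probability setT = 1%E.
Proof.
have E := @product_measure1E _ _ _ _ _ P1 P2 setT setT measurableT measurableT.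
have E1 : P1 setT = 1%E := probability_setT P1.
have E2 : P2 setT = 1%E := probability_setT P2.
by rewrite /product_probability -setXTT; apply: (etrans E); rewrite [X in (X * _)%E]E1 [X in (_ * X)%E]E2 mule1.
Qed.

HB.instance Definition _ := Measure_isProbability.Build _ _ _
  product_probability product_probability_setT.

End ProductProbability.

Section GaussianFamily.
Context {R : realType}.
Notation gauss := (normal_prob (0 : R) 1).
Notation RR := (measurableTypeR R).

(** The law of [s u] for [u] standard normal. Unlike [normal_prob 0 s] it
    is the point mass at [0] when [s = 0], so no case is distinguished in the
    statements about linear combinations *)
Definition scaled_gauss (s : R) (A : set RR) : \bar R := gauss (affine 0 s @^-1` A).

Lemma scaled_gaussE (s : R) (A : set RR) : 0 < s -> measurable A ->
  scaled_gauss s A = normal_prob 0 s A.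
Proof. by move=> s0 mA; exact: normal_prob_affine. Qed.

Lemma gauss_sym (A : set RR) : measurable A ->
  gauss ((-%R : RR -> RR) @^-1` A) = gauss A.
Proof.
move=> mA; rewrite /normal_prob.
have mopp : measurable_fun setT (-%R : RR -> RR) by exact: oppr_measurable.
have mE : measurable_fun setT (fun z : RR => (normal_pdf (0 : R) 1 z)%:E).
  by apply/measurable_EFinP; exact: measurable_normal_pdf.
transitivity (\int[lebesgue_measure]_(y in (-%R : RR -> RR) @^-1` A)
    (((fun z => (normal_pdf (0 : R) 1 z)%:E) \o (-%R : RR -> RR)) y))%E.
  by apply: eq_integral => y _ /=; rewrite phi_even.
rewrite -(@ge0_integral_pushforward _ _ _ _ _ _ mopp lebesgue_measure A)//; last 2 first.
- exact: measurable_funTS.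
- by move=> y _; rewrite lee_fin phi_ge0.
by apply: eq_measure_integral => /= B mB _; exact: lebesgue_measureN.
Qed.

Lemma gauss_affine_norm (x b : R) (A : set RR) : measurable A ->
  gauss (affine x b @^-1` A) = gauss (affine x `|b| @^-1` A).
Proof.
move=> mA; have [b0|b0] := leP 0 b; first by rewrite ger0_norm.
rewrite ltr0_norm// -[LHS]gauss_sym; last first.
  by rewrite -[X in measurable X]setTI; exact: measurable_affine.
congr (normal_prob _ _); apply/funext => y; rewrite /preimage /affine /=.
by rewrite mulrN mulNr.
Qed.

(** Adding an independent normal variable to a scaled one, degenerate cases
    included; the nondegenerate case is the convolution formula *)
Lemma gauss_mixture (s b : R) (A : set RR) : 0 <= s -> measurable A ->
  (\int[gauss]_u gauss (affine (affine 0 s u) b @^-1` A))%E =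
  scaled_gauss (Num.sqrt (s ^+ 2 + b ^+ 2)) A.
Proof.
move=> s0 mA.
under eq_integral do rewrite gauss_affine_norm//.
have -> : s ^+ 2 + b ^+ 2 = s ^+ 2 + `|b| ^+ 2 by rewrite real_normK ?num_real.
have [->|bN] := eqVneq `|b| 0.
  rewrite expr0n addr0 sqrtr_sqr ger0_norm// /scaled_gauss.
  have m0 x : affine x 0 @^-1` A = if x \in A then setT else set0.
    apply/seteqP; split => y; rewrite /affine /= mul0r addr0; case: ifPn => //.
    + by rewrite notin_setE.
    + by rewrite inE.
  rewrite (eq_integral (fun u => (\1_(affine 0 s @^-1` A) u)%:E)); last first.
    move=> u _; rewrite m0 indicE; rewrite (_ : (u \in _) = (affine 0 s u \in A)).
      case: ifPn => _; last by rewrite measure0.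
      exact: (probability_setT gauss).
    by apply/idP/idP; rewrite !inE.
  rewrite integral_indic ?setIT//.
  by rewrite -[X in measurable X]setTI; exact: measurable_affine.
have b0 : 0 < `|b| by rewrite lt_def bN normr_ge0.
have [->|sN] := eqVneq s 0.
  rewrite expr0n add0r sqrtr_sqr normr_id.
  under eq_integral do rewrite /(affine 0 0 _) mul0r addr0.
  rewrite integral_cst// -/(scaled_gauss `|b| A).
  by rewrite [X in (_ * X)%E](probability_setT gauss) mule1.
have sp : 0 < s by rewrite lt_def sN s0.
rewrite scaled_gaussE//; last by rewrite sqrtr_gt0 addr_gt0// exprn_gt0.
rewrite -(normal_convolution sp b0 mA).
pose g x := normal_prob x `|b| A.
have gE x : gauss (affine x `|b| @^-1` A) = g x by rewrite normal_prob_affine.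
under eq_integral do rewrite gE.
have mg : measurable_fun setT (g : RR -> \bar R).
  rewrite (_ : g = fun x => gauss (xsection [set w : RR * RR | (affine w.1 `|b| w.2) \in A] x)).
    apply: measurable_fun_xsection.
    rewrite (_ : [set w | _] = setT `&` (fun w : RR * RR => (w.1 + `|b| * w.2 : RR)) @^-1` A).
      have mf : measurable_fun setT (fun w : RR * RR => (w.1 + `|b| * w.2 : RR)).
        by apply: measurable_funD => //; apply: measurable_funM.
      exact: mf.
    by rewrite setTI; apply/seteqP; split => w /=; rewrite inE.
  apply/funext => x; rewrite -gE; congr (normal_prob _ _).
  by apply/seteqP; split => y /=; rewrite xsectionE /= inE.
have g0 x : (0 <= g x)%E by apply: measure_ge0.
have maff := @measurable_affine R 0 s.
transitivity (\int[pushforward gauss (affine 0 s)]_x g x)%E.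
  by rewrite ge0_integral_pushforward//.
apply: eq_measure_integral => /= B mB _.
exact: normal_prob_affine.
Qed.

End GaussianFamily.

Section ScaledLaw.
Context {R : realType} d (T : measurableType d) (Q : probability T R).
Notation gauss := (normal_prob (0 : R) 1).
Notation RR := (measurableTypeR R).
Variables (X : T -> RR) (s : R).
Hypothesis mX : measurable_fun setT X.
Hypothesis X_law : forall A : set RR, measurable A -> Q (X @^-1` A) = scaled_gauss s A.

Lemma law_ge0_integral (f : RR -> \bar R) : measurable_fun setT f ->
  (forall x, 0 <= f x)%E ->
  (\int[Q]_w f (X w) = \int[gauss]_u f (s * u)%R)%E.
Proof.
move=> mf f0; have maff := @measurable_affine R 0 s.
transitivity (\int[pushforward Q X]_x f x)%E.
  by rewrite ge0_integral_pushforward.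
transitivity (\int[pushforward gauss (affine 0 s)]_x f x)%E.
  apply: eq_measure_integral => /= B mB _; exact: X_law.
rewrite ge0_integral_pushforward//.
by apply: eq_integral => u _; rewrite /affine /= add0r.
Qed.

Lemma law_integral (f : RR -> R) : measurable_fun setT f ->
  gauss.-integrable setT (EFin \o (fun u => f (s * u))) ->
  Q.-integrable setT (EFin \o (fun w => f (X w))) /\
  (\int[Q]_w (f (X w))%:E = \int[gauss]_u (f (s * u))%:E)%E.
Proof.
move=> mf intf; have maff := @measurable_affine R 0 s.
have mEf : measurable_fun setT (EFin \o f) by exact/measurable_EFinP.
have iQ : Q.-integrable setT (EFin \o (fun w => f (X w))).
  apply/integrableP; split; first exact: (measurableT_comp mEf mX).
  have := @law_ge0_integral (abse \o (EFin \o f)) (measurableT_comp (@abse_measurable R setT) mEf) (fun x => abse_ge0 _).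
  rewrite /= => ->.
  by move/integrableP : intf => [].
split => //.
transitivity (\int[pushforward Q X]_x (EFin \o f) x)%E.
  by rewrite (integral_pushforward mX mEf).
transitivity (\int[pushforward gauss (affine 0 s)]_x (EFin \o f) x)%E.
  apply: eq_measure_integral => /= B mB _; exact: X_law.
have fE : (EFin \o f) \o affine 0 s = EFin \o (fun u => f (s * u)).
  by apply/funext => u; rewrite /affine /= add0r.
rewrite (integral_pushforward maff mEf); last exact: measurableT.
  by rewrite preimage_setT fE.
by rewrite preimage_setT fE.
Qed.

End ScaledLaw.

Section GaussianFamilyExists.
Context {R : realType}.
Notation gauss := (normal_prob (0 : R) 1).
Notation RR := (measurableTypeR R).

Definition combination m T (Z : 'I_m -> T -> R) (a : 'I_m -> R) (w : T) : R :=
  \sum_i a i * Z i w.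

(** Independent standard normal variables, characterised by the laws of their
    linear combinations as in the Cramer-Wold principle *)
Definition standard_family d (T : measurableType d) (Q : probability T R) m
    (Z : 'I_m -> T -> RR) :=
  (forall i, measurable_fun setT (Z i)) /\
  forall a (A : set RR), measurable A ->
    Q (combination Z a @^-1` A) = scaled_gauss (Num.sqrt (\sum_i a i ^+ 2)) A.

Lemma measurable_combination d (T : measurableType d) m (Z : 'I_m -> T -> RR) a :
  (forall i, measurable_fun setT (Z i)) -> measurable_fun setT (combination Z a : T -> RR).
Proof.
move=> mZ; apply: measurable_sum => i.
by apply: measurable_funM => //; exact: mZ.
Qed.

(** One more coordinate is adjoined by a product with the line; its linear
    combinations are handled by [gauss_mixture] *)
Theorem standard_family_exists m : exists (d : measure_display)
  (T : measurableType d) (Q : probability T R) (Z : 'I_m -> T -> RR),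
  standard_family Q Z.
Proof.
elim: m => [|m [d [T [Q [Z [mZ Z_law]]]]]].
  exists _, RR, (normal_prob (0 : R) 1 : probability _ _), (fun i _ => 0); split => [i|a A mA].
    exact: measurable_cst.
  rewrite /scaled_gauss big_ord0 sqrtr0; congr (normal_prob _ _).
  apply/funext => w; rewrite /preimage /combination /affine /= big_ord0.
  by rewrite mul0r add0r.
pose Q' := product_probability Q (normal_prob (0 : R) 1 : probability RR R) : probability (T * RR)%type R.
pose Z' i (w : T * RR) : RR := if unlift ord0 i is Some j then Z j w.1 else w.2.
exists _, (T * RR)%type, Q', Z'; split.
  move=> i; rewrite /Z'; case: (unlift ord0 i) => [j|]; last exact: measurable_snd.
  by apply: measurableT_comp => //; exact: mZ.
move=> a A mA.
pose X : T -> RR := combination Z (fun j => a (lift ord0 j)).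
have mX : measurable_fun setT X := measurable_combination _ mZ.
have combE (w : T * RR) : combination Z' a w = affine (X w.1) (a ord0) w.2.
  rewrite /combination big_ord_recl /Z' unlift_none addrC /affine; congr (_ + _).
  by apply: eq_bigr => j _; rewrite liftK.
have mg : measurable_fun setT (fun x : RR => gauss (affine x (a ord0) @^-1` A)).
  rewrite (_ : (fun x => _) = fun x => gauss (xsection
      ((fun w : RR * RR => (w.1 + a ord0 * w.2 : RR)) @^-1` A) x)).
    apply: measurable_fun_xsection.
    have mf : measurable_fun setT (fun w : RR * RR => (w.1 + a ord0 * w.2 : RR)).
      by apply: measurable_funD => //; apply: measurable_funM.
    by rewrite -[X in measurable X]setTI; exact: mf.
  apply/funext => x; congr (normal_prob _ _).
  by apply/seteqP; split => y; rewrite xsectionE.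
transitivity (\int[Q]_w gauss (affine (X w) (a ord0) @^-1` A))%E.
  rewrite /Q' /product_probability /= /product_measure1; apply: eq_integral => w _ /=.
  congr (normal_prob _ _).
  by apply/seteqP; split => y; rewrite xsectionE /= combE.
have X_law B (mB : measurable B) := Z_law (fun j => a (lift ord0 j)) B mB.
rewrite (law_ge0_integral mX X_law mg)//.
set s := Num.sqrt _ in X_law *.
have s0 : 0 <= s by exact: sqrtr_ge0.
have -> : \sum_i a i ^+ 2 = s ^+ 2 + a ord0 ^+ 2.
  rewrite big_ord_recl addrC sqr_sqrtr//.
  by apply: sumr_ge0 => j _; exact: sqr_ge0.
rewrite -(gauss_mixture (a ord0) s0 mA); apply: eq_integral => u _.
by rewrite /(affine 0 s u) add0r.
Qed.

End GaussianFamilyExists.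

Section StandardFamily.
Context {R : realType} d (T : measurableType d) (Q : probability T R) (m : nat).
Notation gauss := (normal_prob (0 : R) 1).
Notation RR := (measurableTypeR R).
Variable Z : 'I_m -> T -> RR.
Hypothesis Z_std : standard_family Q Z.
Implicit Types a b : 'I_m -> R.

Definition dotf a b : R := \sum_i a i * b i.
Definition normf a : R := Num.sqrt (\sum_i a i ^+ 2).

Let mZ a : measurable_fun setT (combination Z a : T -> RR) :=
  measurable_combination a Z_std.1.
Let Z_law a := Z_std.2 a.

Lemma normf_sqr a : normf a ^+ 2 = \sum_i a i ^+ 2.
Proof. by rewrite sqr_sqrtr// sumr_ge0// => i _; exact: sqr_ge0. Qed.

Lemma combination_gaussian a : gaussian_variable Q (combination Z a).
Proof.
split; first exact: mZ.
exists 0, (normf a) => A mA; rewrite Z_law// -/(normf a) /gaussian_law.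
case: eqVneq => [->|s0].
  rewrite /scaled_gauss diracE.
  rewrite (_ : affine 0 0 @^-1` A = if 0 \in A then setT else set0).
    by case: ifPn => _; [exact: (probability_setT gauss)|exact: (measure0 gauss)].
  apply/seteqP; split => y; rewrite /affine /= mul0r addr0; case: ifPn => //.
  - by rewrite notin_setE.
  - by rewrite inE.
by rewrite scaled_gaussE// lt_def s0 sqrtr_ge0.
Qed.

Lemma combination_square a :
  Q.-integrable setT (EFin \o (fun w => combination Z a w ^+ 2)) /\
  (\int[Q]_w (combination Z a w ^+ 2)%:E = (\sum_i a i ^+ 2)%:E)%E.
Proof.
have sq_growth (x : R) : `|x ^+ 2| <= 0 + 1 * x ^+ 2.
  by rewrite add0r mul1r ger0_norm// sqr_ge0.
have [i2 _] := gauss_integrable (@exprn_continuous R 2) (lexx _) ler01 sq_growth.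
have is2 := integrableZl measurableT (normf a ^+ 2) i2.
have E : (fun u => ((normf a * u) ^+ 2)%:E) = (fun u : R => (normf a ^+ 2)%:E * (u ^+ 2)%:E)%E.
  by apply/funext => u; rewrite exprMn EFinM.
have msq : measurable_fun setT (fun x : RR => x ^+ 2 : R) by exact: exprn_measurable.
have [|iQ ->] := law_integral (mZ a) (Z_law a) msq.
  rewrite (_ : _ \o _ = fun u => ((normf a * u) ^+ 2)%:E)// E.
  exact: is2.
split => //; rewrite E integralZl// gauss_second_moment mule1.
by rewrite normf_sqr.
Qed.

(** The Stein identity at frequency [0] and phase [pi / 2] *)
Lemma gauss_mean : gauss.-integrable setT (EFin \o (fun u : R => u)) /\
  (\int[gauss]_u u%:E = 0)%E.
Proof.
have E : (fun u : R => u * sin (0 * u + pi / 2)) = id.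
  by apply/funext => u; rewrite mul0r add0r sin_pihalf mulr1.
have [i1 _] := gauss_integrable (@xsin_continuous R 0 (pi / 2)) ler01 ler01 (@xsin_growth R 0 (pi / 2)).
have S := @gauss_stein R 0 (pi / 2); rewrite mul0r in S.
rewrite E in i1; split => //.
have /fineK <- : (\int[gauss]_u u%:E)%E \is a fin_num.
  exact: (integrable_fin_num measurableT i1).
congr _%:E; rewrite -[RHS]S /Rintegral; congr fine.
by apply: eq_integral => u _; rewrite mul0r add0r sin_pihalf mulr1.
Qed.

Lemma combination_mean a :
  Q.-integrable setT (EFin \o (fun w => combination Z a w)) /\
  (\int[Q]_w (combination Z a w)%:E = 0)%E.
Proof.
have [i1 E1] := gauss_mean.
have is1 := integrableZl measurableT (normf a) i1.
have mid : measurable_fun setT (fun x : RR => x : R) by exact: measurable_id.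
have [|iQ ->] := law_integral (mZ a) (Z_law a) mid.
  exact: is1.
split => //.
rewrite (_ : (fun u => (normf a * u)%:E) = fun u => ((normf a)%:E * u%:E)%E)//.
by rewrite integralZl// E1 mule0.
Qed.

Lemma combinationD a b w :
  combination Z (fun i => a i + b i) w = combination Z a w + combination Z b w.
Proof. by rewrite -big_split; apply: eq_bigr => i _; rewrite mulrDl. Qed.

Lemma combinationB a b w :
  combination Z (fun i => a i - b i) w = combination Z a w - combination Z b w.
Proof. by rewrite -sumrB; apply: eq_bigr => i _; rewrite mulrBl. Qed.

(** Polarization of [combination_square] *)
Lemma combination_covariance a b :
  Q.-integrable setT (EFin \o (fun w => combination Z a w * combination Z b w)) /\
  (\int[Q]_w (combination Z a w * combination Z b w)%:E = (dotf a b)%:E)%E.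
Proof.
have [ip Ep] := combination_square (fun i => a i + b i).
have [im Em] := combination_square (fun i => a i - b i).
have ip4 := integrableZl measurableT 4^-1 ip.
have im4 := integrableZl measurableT 4^-1 im.
have E : (fun w => (combination Z a w * combination Z b w)%:E) =
  (fun w => (4^-1)%:E * (combination Z (fun i => a i + b i) w ^+ 2)%:E
          - (4^-1)%:E * (combination Z (fun i => (a i - b i)%R) w ^+ 2)%:E)%E.
  apply/funext => w; rewrite combinationD combinationB -!EFinM -EFinB.
  by congr _%:E; field.
split.
  rewrite (_ : _ \o _ = fun w => (combination Z a w * combination Z b w)%:E)// E.
  by have := integrableB measurableT ip4 im4.
rewrite E (integralB measurableT ip4 im4).
rewrite (integralZl measurableT ip) (integralZl measurableT im).
rewrite Ep Em -!EFinM -EFinB; congr _%:E.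
rewrite !mulr_sumr -sumrB /dotf; by apply: eq_bigr => i _; field.
Qed.

Lemma combination_charfun a theta :
  (\int[Q]_w cos (combination Z a w + theta) =
    cos theta * expR (- (\sum_i a i ^+ 2) / 2))%R.
Proof.
have mc : measurable_fun setT (fun x : RR => cos (x + theta) : R).
  have := continuous_measurable_fun (@cos_linear_continuous R 1 theta).
  by under eq_fun do rewrite mul1r.
have [|iQ EQ] := law_integral (mZ a) (Z_law a) mc.
  exact: (gauss_integrable (@cos_linear_continuous R (normf a) theta) ler01 (lexx 0)
    (@cos_growth R (normf a) theta)).1.
by rewrite /Rintegral EQ -[LHS]/(Rintegral _ _ _) gauss_charfun normf_sqr.
Qed.

End StandardFamily.

(** * A Gram factorisation of the limit covariance *)

Section GramFactor.
Variable C : numClosedFieldType.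

(** Squares of [alpha] and [|beta|] have sum [sigma] and product
    [|tau|^2 / 4], so [alpha^2] is the larger root of
    [x^2 - sigma x + |tau|^2 / 4], real exactly when [|tau| <= sigma] *)
Lemma elliptic_coefficients (sigma tau : C) : `|tau| <= sigma ->
  exists alpha beta : C, [/\ alpha^* = alpha, 2 * alpha * beta = tau &
    alpha ^+ 2 + beta * beta^* = sigma].
Proof.
move=> tau_sigma.
have tau0 : 0 <= `|tau| by exact: normr_ge0.
have sigma0 : 0 <= sigma by exact: le_trans tau_sigma.
have D0 : 0 <= sigma ^+ 2 - `|tau| ^+ 2 by rewrite subr_ge0 lerXn2r ?nnegrE.
pose D := sqrtC (sigma ^+ 2 - `|tau| ^+ 2).
have DD : D ^+ 2 = sigma ^+ 2 - `|tau| ^+ 2 by rewrite sqrtCK.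
have DD0 : 0 <= D by rewrite sqrtC_ge0.
have S0 : 0 <= (sigma + D) / 2 by rewrite divr_ge0// addr_ge0.
pose alpha := sqrtC ((sigma + D) / 2).
have alpha2 : alpha ^+ 2 = (sigma + D) / 2 by rewrite sqrtCK.
have alpha0 : 0 <= alpha by rewrite sqrtC_ge0.
have alphaJ : alpha^* = alpha by apply/CrealP; rewrite realE alpha0.
case: (eqVneq alpha 0) => [aE|aN0].
  have /eqP : sigma + D = 0.
    move: alpha2; rewrite aE expr0n /= => /esym/eqP.
    by rewrite mulf_eq0 invr_eq0 pnatr_eq0 orbF => /eqP.
  rewrite paddr_eq0// => /andP[/eqP sE _].
  have /eqP : `|tau| = 0 by apply/le_anti; rewrite tau0 andbT -sE.
  rewrite normr_eq0 => /eqP tE.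
  exists 0, 0; split; first by rewrite rmorph0.
    by rewrite mulr0 tE.
  by rewrite expr0n /= mul0r addr0 sE.
exists alpha, (tau / (2 * alpha)); split => //.
  by field; rewrite aN0.
rewrite rmorphM fmorphV rmorphM /= alphaJ conjC_nat.
have -> : tau / (2 * alpha) * (tau^* / (2 * alpha)) = tau * tau^* / (4 * alpha ^+ 2).
  by field; rewrite aN0.
rewrite -normCK.
have -> : `|tau| ^+ 2 = (sigma + D) * (sigma - D) by rewrite mulrC -subr_sqr DD; ring.
have sDE : sigma + D = 2 * alpha ^+ 2 by rewrite alpha2; field.
have aE : alpha ^+ 2 = (sigma + D) / 2 by rewrite sDE; field.
rewrite sDE [X in X + _]aE.
by field; rewrite aN0.
Qed.

Variable p : nat.
Notation index := ('I_p * 'I_p * bool)%type.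

Let h : C := sqrtC 2^-1.
Let h2 : h * h = 2^-1. Proof. by rewrite -expr2 sqrtCK. Qed.
Let hJ : h^* = h.
Proof. by apply/CrealP; rewrite realE sqrtC_ge0 invr_ge0 ler0n. Qed.

Let z i j (q : index) : C := ((q.1 == (i, j))%:R * (if q.2 then 'i else 1) * h).

Let sum_z i j k l (c1 c2 : C -> C) : c1 0 = 0 -> c2 0 = 0 ->
  \sum_q c1 (z i j q) * c2 (z k l q) =
  ((i, j) == (k, l))%:R * (c1 h * c2 h + c1 ('i * h) * c2 ('i * h)).
Proof.
move=> c10 c20.
rewrite -(pair_bigA _ (fun r s => c1 (z i j (r, s)) * c2 (z k l (r, s)))) /=.
rewrite (bigD1 (i, j))//= [X in _ + X]big1 ?addr0; last first.
  move=> r rN; rewrite big1// => s _.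
  by rewrite /z /= (negPf rN) !mul0r c10 mul0r.
rewrite big_bool /z /= eqxx; case: eqP => _; rewrite ?mul1r ?mul0r ?c20 ?mulr0 ?addr0//.
by rewrite addrC.
Qed.

Let sum_zz i j k l : \sum_q z i j q * z k l q = 0.
Proof.
rewrite (@sum_z i j k l id id)// [X in _ * X](_ : _ = 0) ?mulr0//.
have I2 := @sqrCi C.
have -> : h * h + 'i * h * ('i * h) = (1 + 'i ^+ 2) * (h * h) by ring.
by rewrite I2 subrr mul0r.
Qed.

Let sum_zJ i j k l : \sum_q z i j q * (z k l q)^* = ((i, j) == (k, l))%:R.
Proof.
rewrite (@sum_z i j k l id (fun x => x^*)) ?rmorph0//.
rewrite rmorphM /= hJ conjCi.
have I2 := @sqrCi C.
have -> : h * h + 'i * h * (- 'i * h) = (1 - 'i ^+ 2) * (h * h) by ring.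
rewrite I2 h2 opprK.
by rewrite (_ : (1 + 1) * 2^-1 = 1 :> C) ?mulr1//; field.
Qed.

Let sum_Jz i j k l : \sum_q (z i j q)^* * z k l q = ((i, j) == (k, l))%:R.
Proof.
by under eq_bigr do rewrite mulrC; rewrite sum_zJ eq_sym.
Qed.

Let sum_JJ i j k l : \sum_q (z i j q)^* * (z k l q)^* = 0.
Proof.
under eq_bigr do rewrite -rmorphM; by rewrite -rmorph_sum sum_zz rmorph0.
Qed.

(** Writing [g i j = alpha z i j + beta (z j i)^*] for vectors [z i j] with
    [z z = 0] and [z z^* = 1], the two tables of products are read off from
    [2 alpha beta = tau] and [alpha^2 + |beta|^2 = sigma]. The index set has
    a real and an imaginary coordinate for every entry *)
Theorem elliptic_gram (sigma tau : C) : `|tau| <= sigma ->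
  exists m (g : 'I_p -> 'I_p -> 'I_m -> C), forall i j k l,
    \sum_q g i j q * g k l q = (i == l)%:R * (j == k)%:R * tau /\
    \sum_q g i j q * (g k l q)^* = (i == k)%:R * (j == l)%:R * sigma.
Proof.
move=> /elliptic_coefficients[alpha [beta [alphaJ tauE sigmaE]]].
pose G i j q := alpha * z i j q + beta * (z j i q)^*.
exists #|{: index}|, (fun i j q => G i j (enum_val q)) => i j k l.
have reind (F : index -> C) : \sum_(q < #|{: index}|) F (enum_val q) = \sum_q F q.
  rewrite [RHS](reindex (fun q : 'I_#|{: index}| => enum_val q))//; exact: onW_bij (enum_val_bij _).
rewrite (reind (fun q => G i j q * G k l q)) (reind (fun q => G i j q * (G k l q)^*)).
split.
- transitivity (alpha * alpha * (\sum_q z i j q * z k l q)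
     + alpha * beta * (\sum_q z i j q * (z l k q)^*)
     + alpha * beta * (\sum_q (z j i q)^* * z k l q)
     + beta * beta * (\sum_q (z j i q)^* * (z l k q)^*)).
    by rewrite !mulr_sumr -!big_split /=; apply: eq_bigr => q _; rewrite /G; ring.
  rewrite sum_zz sum_zJ sum_Jz sum_JJ -tauE !xpair_eqE.
  by case: (i == l); case: (j == k); rewrite /=; ring.
- transitivity (alpha * alpha * (\sum_q z i j q * (z k l q)^*)
     + alpha * beta^* * (\sum_q z i j q * z l k q)
     + alpha * beta * (\sum_q (z j i q)^* * (z k l q)^*)
     + beta * beta^* * (\sum_q (z j i q)^* * z l k q)).
    rewrite !mulr_sumr -!big_split /=; apply: eq_bigr => q _.
    rewrite /G; move: (z i j q) (z j i q) (z k l q) (z l k q) => z1 z2 z3 z4.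
    by rewrite rmorphD !rmorphM /= conjCK alphaJ; ring.
  rewrite sum_zz sum_zJ sum_Jz sum_JJ -sigmaE !xpair_eqE.
  by case: (i == k); case: (j == l); rewrite /=; ring.
Qed.

End GramFactor.

Local Open Scope sesquilinear_scope.

(** * Unitary curves through the identity and compressions of matrices *)

Section CayleyCurve.
Variables (C : numClosedFieldType) (n : nat).
Implicit Types (w : 'cV[C]_n) (t q : C).
Local Notation i_ := (@Num.imaginary C).

Definition sqnorm w : C := (w^t* *m w) 0 0.

Definition rank1 w : 'M[C]_n := w *m w^t*.

(** The exact unitary correction of [i t]: the Cayley transform of a rank one
    Hermitian matrix is rational in [t] *)
Definition cayley q t : C := i_ * t / (1 - i_ * t * q / 2).

Definition curve w t : 'M[C]_n := 1%:M + cayley (sqnorm w) t *: rank1 w.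

Lemma sqnorm_real w : sqnorm w \is Num.real.
Proof.
rewrite /sqnorm mxE; apply: ger0_real; apply: sumr_ge0 => k _.
by rewrite !mxE mulrC -normCK exprn_ge0.
Qed.

Lemma rank1_adj w : (rank1 w)^t* = rank1 w.
Proof. by rewrite /rank1 trmx_mul map_mxM -map_trmx trmxK map_mxCK. Qed.

Lemma rank1_sqr w : rank1 w *m rank1 w = sqnorm w *: rank1 w.
Proof.
rewrite /rank1 -mulmxA [w^t* *m (w *m _)]mulmxA.
by rewrite [w^t* *m w]mx11_scalar mul_scalar_mx -scalemxAr.
Qed.

Lemma cayley_den_ge1 q t : q \is Num.real -> t \is Num.real ->
  1 <= `|1 - i_ * t * q / 2|.
Proof.
move=> qR tR.
have yR : - (t * q / 2) \is Num.real by rewrite realN !realM// realV realn.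
have -> : 1 - i_ * t * q / 2 = 1 + i_ * (- (t * q / 2)).
  by rewrite mulrN !mulrA.
rewrite -(@ler_sqr _ 1)// ?nnegrE// expr1n.
by rewrite normC2_rect// expr1n lerDl real_exprn_even_ge0.
Qed.

Lemma cayley_den_neq0 q t : q \is Num.real -> t \is Num.real ->
  1 - i_ * t * q / 2 != 0.
Proof.
move=> qR tR; rewrite -normr_gt0; apply: lt_le_trans (cayley_den_ge1 qR tR).
exact: ltr01.
Qed.

Lemma curve_unitary w t : t \is Num.real -> curve w t \is unitarymx.
Proof.
move=> tR; have qR := sqnorm_real w; set q := sqnorm w in qR *.
apply/unitarymxP; rewrite /curve -/q.
set c := cayley q t.
have -> : (1%:M + c *: rank1 w) ^t* = 1%:M + c^* *: rank1 w.
  rewrite linearD/= trmx1 linearZ/= map_mxD map_mx1 map_mxZ.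
  by rewrite rank1_adj.
rewrite mulmxDl mul1mx mulmxDr mulmx1 -scalemxAl -scalemxAr rank1_sqr -/q.
rewrite !scalerA -addrA -!scalerDl.
suff -> : c^* + (c + c * c^* * q) = 0 by rewrite scale0r addr0.
have d0 := cayley_den_neq0 qR tR.
have cE : c^* = - (i_ * t) / (1 + i_ * t * q / 2).
  rewrite /c /cayley rmorphM fmorphV rmorphB rmorph1 !rmorphM fmorphV/=.
  rewrite rmorph_nat conjCi !conj_Creal// !mulNr opprK//.
have d0' : 1 + i_ * t * q / 2 != 0.
  have := d0; rewrite -conjC_eq0 rmorphB rmorph1 !rmorphM fmorphV/=.
  by rewrite rmorph_nat conjCi !conj_Creal// !mulNr opprK.
rewrite cE /c /cayley; field.
have two0 : (2 : C) != 0 by rewrite pnatr_eq0.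
have -> : 2 + i_ * t * q = 2 * (1 + i_ * t * q / 2) by field.
have -> : 2 - i_ * t * q = 2 * (1 - i_ * t * q / 2) by field.
by rewrite !mulf_neq0.
Qed.

Lemma cayley_taylor q t : q \is Num.real -> t \is Num.real ->
  `|cayley q t - i_ * t| <= `|q| * `|t| ^+ 2.
Proof.
move=> qR tR; have d0 := cayley_den_neq0 qR tR.
have -> : cayley q t - i_ * t =
    - (t ^+ 2 * q / 2) / (1 - i_ * t * q / 2).
  have ii : i_ ^+ 2 = -1 by rewrite sqrCi.
  apply: (mulIf d0); rewrite mulfVK// mulrBl /cayley mulfVK//.
  rewrite mulrBr mulr1 opprB addrC subrK.
  have -> : i_ * t * (i_ * t * q / 2) = i_ ^+ 2 * (t ^+ 2 * q / 2) by ring.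
  by rewrite ii mulN1r.
rewrite normrM normrN normfV; apply: (@le_trans _ _ (`|t ^+ 2 * q / 2|)).
  rewrite ler_piMr// invf_le1 ?cayley_den_ge1//.
  by rewrite normr_gt0.
rewrite -mulrA normrM normrX [leRHS]mulrC ler_wpM2l ?exprn_ge0//.
rewrite normrM normfV [`|2|]ger0_norm// ler_piMr// invf_le1//.
by rewrite (_ : 1 = 1%:R)// ler_nat.
Qed.

End CayleyCurve.

(** The product rule for first order expansions with a quadratic remainder *)
Lemma taylor_mul (K : numFieldType) (t f f1 f' g g1 g' Bf Bf' Bg Bg' Cf Cg : K) :
  0 <= t <= 1 -> 0 <= Bf -> 0 <= Cf ->
  `|f| <= Bf -> `|f'| <= Bf' -> `|g1| <= Bg -> `|g'| <= Bg' ->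
  `|f1 - f - t * f'| <= Cf * t ^+ 2 -> `|g1 - g - t * g'| <= Cg * t ^+ 2 ->
  `|f1 * g1 - f * g - t * (f' * g + f * g')| <=
     (Cf * Bg + (Bf + Bf') * Cg + Bf' * Bg') * t ^+ 2.
Proof.
move=> /andP[t0 t1] Bf0 Cf0 fB f'B gB g'B fC gC.
have -> : f1 * g1 - f * g - t * (f' * g + f * g') =
  (f1 - f - t * f') * g1 + (f + t * f') * (g1 - g - t * g')
  + t ^+ 2 * (f' * g') by ring.
have Bf'0 : 0 <= Bf' := le_trans (normr_ge0 _) f'B.
rewrite [leRHS](_ : _ = Cf * t ^+ 2 * Bg + (Bf + Bf') * (Cg * t ^+ 2)
  + t ^+ 2 * (Bf' * Bg')); last by ring.
apply: (le_trans (ler_normD _ _)); apply: lerD.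
  apply: (le_trans (ler_normD _ _)); apply: lerD; rewrite normrM.
    exact: ler_pM.
  apply: ler_pM => //; apply: (le_trans (ler_normD _ _)); apply: lerD => //.
  rewrite normrM (ger0_norm t0); apply: le_trans f'B.
  by rewrite ler_piMl.
rewrite normrM normrX (ger0_norm t0) normrM ler_wpM2l ?exprn_ge0//.
exact: ler_pM.
Qed.

Section Polarization.
Variables (C : numClosedFieldType) (n : nat).
Local Notation i_ := (@Num.imaginary C).
Implicit Types x y : 'cV[C]_n.

(** Every elementary matrix is a complex combination of rank one Hermitian
    matrices, which is why the skew-Hermitian directions [i w w^*] suffice *)
Lemma polarization x y :
  4%:R *: (x *m y^t*) = \sum_(k < 4) i_ ^+ k *: rank1 (x + i_ ^+ k *: y).
Proof.
have i2 : i_ ^+ 2 = -1 := sqrCi _.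
have i3 : i_ ^+ 3 = - i_ by rewrite exprS i2 mulrN1.
apply/matrixP => a b; rewrite !big_ord_recl big_ord0 /= /bump/=.
rewrite expr0 expr1 i2 i3 /rank1 !mxE !big_ord1 !mxE.
rewrite !(rmorphD, rmorphM, rmorphN, rmorph1)/= conjCi.
set u := x a 0; set v := (y b 0)^*; set u' := (x b 0)^*; set v' := y a 0.
transitivity (2 * u * v * (1 - i_ ^+ 2) + 2 * v' * u' * (1 + i_ ^+ 2)).
  by rewrite i2; ring.
ring.
Qed.

End Polarization.

Section TraceAlgebra.
Variables (C : numClosedFieldType) (n : nat).
Implicit Types (B S Y V : 'M[C]_n).

Definition cj S V : 'M[C]_n := V^t* *m S *m V.

Lemma sum_delta_mul Y :
  \sum_(a < n) \sum_(b < n) ((delta_mx a b : 'M[C]_n) *m Y) a b = n%:R * \tr Y.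
Proof.
have E (a b : 'I_n) : ((delta_mx a b : 'M[C]_n) *m Y) a b = Y b b.
  rewrite mxE (bigD1 b)//= big1 ?addr0 => [|k kb].
    by rewrite mxE !eqxx mul1r.
  by rewrite mxE (negbTE kb) andbF mul0r.
under eq_bigr do under eq_bigr do rewrite E.
by rewrite sumr_const card_ord mulr_natl.
Qed.

Lemma sum_mul_delta_mul Y S :
  \sum_a \sum_b (Y *m delta_mx a b *m S) a b = \tr Y * \tr S.
Proof.
have E a b : (Y *m delta_mx a b *m S) a b = Y a a * S b b.
  rewrite mxE (bigD1 b)//= big1 ?addr0 => [|k kb].
    rewrite mxE (bigD1 a)//= big1 ?addr0 => [|l la].
      by rewrite mxE !eqxx mulr1.
    by rewrite mxE (negbTE la) mulr0.
  rewrite mxE big1 ?mul0r// => l _.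
  by rewrite mxE (negbTE kb) andbF mulr0.
under eq_bigr do under eq_bigr do rewrite E.
by rewrite /mxtrace big_distrlr.
Qed.

Lemma unitary_adjmul V : V \is unitarymx -> V^t* *m V = 1%:M.
Proof.
by move=> VU; rewrite -invmx_unitary// mulVmx// unitarymx_unit.
Qed.

Lemma cj_adj S V : (cj S V)^t* = cj (S^t*) V.
Proof.
rewrite /cj !trmx_mul !map_mxM/= mulmxA; congr (_ *m _).
by rewrite -map_trmx map_mxCK trmxK.
Qed.

Lemma cj_scalar c V : V \is unitarymx -> cj c%:M V = c%:M.
Proof.
move=> VU; rewrite /cj -mulmxA mul_scalar_mx -scalemxAr unitary_adjmul//.
by rewrite scalemx1.
Qed.

Lemma cjB S Y V : cj (S - Y) V = cj S V - cj Y V.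
Proof. by rewrite /cj mulmxBr mulmxBl. Qed.

Lemma mxtrace_conj_unitary B V : V \is unitarymx ->
  \tr (V *m B *m V^t*) = \tr B.
Proof. by move=> VU; rewrite mxtrace_mulC mulmxA unitary_adjmul// mul1mx. Qed.

(** The derivative of [V^* S' V] in the direction [V B V^* S], expressed by
    conjugates of [S], [S'] and [S S'] only *)
Lemma cj_commutator B S S' V : V \is unitarymx ->
  V^t* *m S' *m (V *m B *m V^t* *m S) *m V
    - V^t* *m (V *m B *m V^t* *m S) *m S' *m V
  = cj S' V *m B *m cj S V - B *m cj (S *m S') V.
Proof.
by move=> VU; rewrite /cj !mulmxA unitary_adjmul// mul1mx.
Qed.

End TraceAlgebra.

Section Compression.
Variables (C : numClosedFieldType) (n p : nat) (t : 'I_p -> 'I_n).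
Implicit Types (A : 'M[C]_p) (Q : 'M[C]_n).

Definition compress Q : 'M[C]_p := \matrix_(i, j) Q (t i) (t j).

(** An isometry when [t] is injective; restricting a matrix to the selected
    rows and columns is compression by it *)
Definition inflation : 'M[C]_(n, p) := \matrix_(i, j) (i == t j)%:R.

Definition inflate A : 'M[C]_n := inflation *m A *m inflation^T.

Lemma compressE Q : compress Q = inflation^T *m Q *m inflation.
Proof.
apply/matrixP => i j; rewrite !mxE.
rewrite (bigD1 (t j))//= big1 ?addr0 => [|k kj]; last first.
  by rewrite !mxE (negbTE kj) mulr0.
rewrite !mxE eqxx mulr1 (bigD1 (t i))//= big1 ?addr0 => [|k ki]; last first.
  by rewrite !mxE (negbTE ki) mul0r.
by rewrite !mxE eqxx mul1r.
Qed.

Lemma inflate_adj A : (inflate A)^t* = inflate (A^t*).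
Proof.
have JT : map_mx Num.conj inflation = inflation.
  by apply/matrixP => i j; rewrite !mxE rmorph_nat.
by rewrite /inflate !trmx_mul trmxK !map_mxM/= JT -[map_mx _ inflation^T]map_trmx JT mulmxA.
Qed.

Lemma tr_inflate A Q : \tr (inflate A *m Q) = \tr (A *m compress Q).
Proof.
by rewrite compressE /inflate -!mulmxA mxtrace_mulC -!mulmxA.
Qed.

Lemma tr_inflate2 A A' Q Q' :
  \tr (inflate A *m Q *m inflate A' *m Q') =
  \tr (A *m compress Q *m A' *m compress Q').
Proof.
rewrite !compressE /inflate -!mulmxA mxtrace_mulC.
by rewrite -!mulmxA.
Qed.

Lemma inflateM A A' : injective t ->
  inflate A *m inflate A' = inflate (A *m A').
Proof.
move=> t_inj; rewrite /inflate.
have JJ : inflation^T *m inflation = 1%:M :> 'M[C]_p.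
  apply/matrixP => i j; rewrite !mxE (bigD1 (t i))//= big1 ?addr0.
    by rewrite !mxE eqxx mul1r (inj_eq t_inj).
  by move=> k ki; rewrite !mxE (negbTE ki) mul0r.
by rewrite -!mulmxA [inflation^T *m (inflation *m _)]mulmxA JJ mul1mx.
Qed.

Lemma compressB Q Q' : compress (Q - Q') = compress Q - compress Q'.
Proof. by apply/matrixP => i j; rewrite !mxE. Qed.

Lemma compress_scalar c : injective t -> compress c%:M = c%:M.
Proof. by move=> ti; apply/matrixP => i j; rewrite !mxE (inj_eq ti). Qed.

End Compression.

Section DiagonalTraces.
Variables (C : numClosedFieldType) (n : nat) (T : 'M[C]_n).
Hypothesis T_diag : is_diag_mx T.

Lemma adj_self_adjoint : (T *m T^t*)^t* = T *m T^t*.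
Proof. by rewrite trmx_mul map_mxM /= -map_trmx map_mxCK trmxK. Qed.

Lemma diag_adj_comm : T^t* *m T = T *m T^t*.
Proof.
have /is_diag_mxP D := T_diag.
have E (i k : 'I_n) : i != k -> T i k = 0 by move=> ik; apply: D.
apply/matrixP => i j; rewrite !mxE (bigD1 i)//= big1 ?addr0; last first.
  by move=> k ki; rewrite !mxE (E k i ki) conjC0 mul0r.
rewrite (bigD1 i)//= big1 ?addr0; last first.
  by move=> k ki; rewrite !mxE (E i k) ?mul0r// eq_sym.
rewrite !mxE; case: (eqVneq i j) => [->|ij]; first by rewrite mulrC.
by rewrite (E i j ij) (E j i) ?conjC0 ?mulr0// eq_sym.
Qed.

(** A diagonal matrix commutes with its adjoint, so both fourth order traces
    of the error estimate reduce to the one bounded by hypothesis *)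
Lemma diag_square_norm :
  \tr ((T *m T) *m (T *m T)^t*) = \tr ((T *m T^t*) *m (T *m T^t*)).
Proof.
rewrite trmx_mul map_mxM /=.
have M4 (A B X Y : 'M[C]_n) : A *m B *m (X *m Y) = A *m (B *m X) *m Y by rewrite !mulmxA.
by rewrite [in LHS]M4 [in RHS]M4 diag_adj_comm.
Qed.

Lemma diag_trace_square_le : `|\tr (T *m T)| <= \tr (T *m T^t*).
Proof.
have /is_diag_mxP D := T_diag.
have E (i k : 'I_n) : i != k -> T i k = 0 by move=> ik; apply: D.
apply: (le_trans (ler_norm_sum _ _ _)); apply: ler_sum => i _.
rewrite !mxE (bigD1 i)//= big1 ?addr0; last first.
  by move=> k ki; rewrite (E i k) ?mul0r// eq_sym.
rewrite (bigD1 i)//= big1 ?addr0; last first.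
  by move=> k ki; rewrite (E i k) ?mul0r// eq_sym.
by rewrite !mxE normrM -normCK expr2.
Qed.

End DiagonalTraces.

Local Open Scope complex_scope.

(** * Continuity and measurability of complex matrix functions *)

Section ComplexPrelim.
Variable R : realType.
Implicit Types z w : R[i].

Lemma cReD z w : complex.Re (z + w) = complex.Re z + complex.Re w.
Proof. by case: z; case: w. Qed.

Lemma cImD z w : complex.Im (z + w) = complex.Im z + complex.Im w.
Proof. by case: z; case: w. Qed.

Lemma cReN z : complex.Re (- z) = - complex.Re z.
Proof. by case: z. Qed.

Lemma cImN z : complex.Im (- z) = - complex.Im z.
Proof. by case: z. Qed.

Lemma cReM z w : complex.Re (z * w) =
  complex.Re z * complex.Re w - complex.Im z * complex.Im w.
Proof. by case: z; case: w. Qed.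

Lemma cImM z w : complex.Im (z * w) =
  complex.Re z * complex.Im w + complex.Im z * complex.Re w.
Proof. by case: z; case: w. Qed.

Lemma complexRI z w : complex.Re z = complex.Re w ->
  complex.Im z = complex.Im w -> z = w.
Proof. by case: z => a b; case: w => c d /= -> ->. Qed.

Lemma Re_sum (I : Type) (r : seq I) (P : pred I) (F : I -> R[i]) :
  complex.Re (\sum_(i <- r | P i) F i) = \sum_(i <- r | P i) complex.Re (F i).
Proof. by apply: (big_morph _ cReD). Qed.

Lemma Im_sum (I : Type) (r : seq I) (P : pred I) (F : I -> R[i]) :
  complex.Im (\sum_(i <- r | P i) F i) = \sum_(i <- r | P i) complex.Im (F i).
Proof. by apply: (big_morph _ cImD). Qed.

Lemma Im_Re z : complex.Im z = complex.Re (- 'i * z).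
Proof. by case: z => a b /=; ring. Qed.

Lemma normr_Re z : `|complex.Re z| <= complex.Re `|z|.
Proof. by rewrite normc_def /= -sqrtr_sqr ler_wsqrtr// lerDl sqr_ge0. Qed.

Lemma normr_Im z : `|complex.Im z| <= complex.Re `|z|.
Proof. by rewrite normc_def /= -sqrtr_sqr ler_wsqrtr// lerDr sqr_ge0. Qed.

(** Norms of complex numbers are themselves complex; this is how inequalities
    between them are moved to the reals *)
Lemma normc_ReE z : `|z| = (complex.Re `|z|)%:C.
Proof. by rewrite RRe_real// normr_real. Qed.

Lemma continuous_Re : continuous (fun z : R[i] => complex.Re z).
Proof.
move=> z; apply/(@cvgrPdist_lt _ _ _ _ (nbhs_filter z)) => e e0.
have e0' : 0 < e%:C by rewrite ltcR.
apply/nbhs_ballP; exists e%:C => //= w.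
rewrite -ball_normE /= => zw.
move: zw; rewrite ltcE => /andP[_] /=; apply: le_lt_trans.
by have := normr_Re (z - w); case: z => a b; case: w => c d.
Qed.

Lemma continuous_real_complex : continuous (fun x : R => x%:C).
Proof.
move=> x; apply/(@cvgrPdist_lt _ _ _ _ (nbhs_filter x)) => e e0.
have [e1 ee] : exists e1, e = e1%:C by apply/complex_realP/gtr0_real.
apply/nbhs_ballP; exists e1 => /=; first by rewrite -ltcR -ee.
move=> y; rewrite -ball_normE /= ee => xy.
by rewrite -rmorphB normc_def/= expr0n addr0 sqrtr_sqr ltcR.
Qed.

Section ContinuousFun.
Variable T : topologicalType.
Implicit Types f g : T -> R[i].

Lemma cfun_conj f : continuous f -> continuous (fun x => (f x)^*%C).
Proof.
move=> cf x; apply/cvgrPdist_lt => e e0.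
move/(_ x): cf => /cvgrPdist_lt /(_ e e0); apply: filterS => y.
by rewrite -rmorphB norm_conjC.
Qed.

Lemma cfunM f g : continuous f -> continuous g ->
  continuous (fun x => f x * g x).
Proof. by move=> cf cg x; apply: cvgM; [exact: cf|exact: cg]. Qed.

Lemma cfunD f g : continuous f -> continuous g ->
  continuous (fun x => f x + g x).
Proof. by move=> cf cg x; apply: cvgD; [exact: cf|exact: cg]. Qed.

Lemma cfun_sum (I : Type) (r : seq I) (P : pred I) (F : I -> T -> R[i]) :
  (forall i, continuous (F i)) ->
  continuous (fun x => \sum_(i <- r | P i) F i x).
Proof.
move=> cF; elim: r => [|i r IH].
  by under eq_fun do rewrite big_nil; move=> x; exact: cvg_cst.
under eq_fun do rewrite big_cons.
case: (P i); [exact: (cfunD (cF i) IH)|exact: IH].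
Qed.

Lemma cfun_Re f : continuous f -> continuous (fun x => complex.Re (f x)).
Proof. by move=> cf x; apply: (cvg_comp _ _ (cf x)); exact: continuous_Re. Qed.

Lemma cfun_Im f : continuous f -> continuous (fun x => complex.Im (f x)).
Proof.
move=> cf; under eq_fun do rewrite Im_Re.
apply: cfun_Re; have cc : continuous (fun _ : T => - 'i : R[i]) by move=> x; exact: cvg_cst.
exact: (cfunM cc cf).
Qed.

Lemma cfun_norm f : continuous f -> continuous (fun x => `|f x|).
Proof. by move=> cf x; apply: cvg_norm; exact: cf. Qed.

End ContinuousFun.

Lemma entry_continuous m n i j :
  continuous (fun M : 'M[R[i]]_(m, n) => M i j).
Proof. exact: coord_continuous. Qed.

Lemma matrix_continuous (T : topologicalType) m n (F : T -> 'M[R[i]]_(m, n)) :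
  (forall i j, continuous (fun x => F x i j)) -> continuous F.
Proof.
move=> cF x U [P Px PU]; rewrite /nbhs /=.
have : \forall y \near x, forall ij : 'I_m * 'I_n, P ij.1 ij.2 (F y ij.1 ij.2).
  by apply: filter_forall => -[i j] /=; exact: cF.
by apply: filterS => y Py; apply: PU => i j; exact: (Py (i, j)).
Qed.

End ComplexPrelim.

Section BorelPrelim.
Variable R : realType.

(** The Borel structure generated by open sets on the source is compared with
    the one generated by intervals on the target *)
Lemma borel_continuous_measurable (T : ptopologicalType) (f : T -> R) :
  continuous f -> measurable_fun [set: borel T] (f : borel T -> R).
Proof.
move=> /continuousP cf; apply: (measurability _ (RGenOpens.measurableE R)).
move=> _ [_ [a [b ->] <-]]; rewrite setTI; apply: sub_sigma_algebra.
exact/cf/interval_open.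
Qed.

Lemma borel_continuous_measurable2 (T T' : ptopologicalType) (f : T -> T') :
  continuous f -> measurable_fun [set: borel T] (f : borel T -> borel T').
Proof.
move=> /continuousP cf.
apply: (@measurability _ _ (borel T) (borel T') setT f (@open T')) => //.
move=> _ [A oA <-]; rewrite setTI; apply: sub_sigma_algebra; exact: cf.
Qed.

End BorelPrelim.

(** * Expectation under the Haar measure *)

Lemma unitary_lmul (C : numClosedFieldType) n (V W : 'M[C]_n) :
  W \is unitarymx -> (W *m V \is unitarymx) = (V \is unitarymx).
Proof.
move=> WU; apply/idP/idP => VU; last exact: mul_unitarymx WU VU.
have -> : V = W^t* *m (W *m V).
  by rewrite mulmxA -invmx_unitary// mulVmx ?mul1mx ?unitarymx_unit.
by apply: mul_unitarymx => //; rewrite trmxC_unitary.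
Qed.

Section HaarExpectation.
Variables (R : realType) (N : nat).
Notation C := R[i].
Notation M := 'M[C]_N.
Variable mu : probability (borel M) R.
Hypothesis mu_haar : haar_unitary mu.
Implicit Types (f g : M -> C) (V W : M).

Definition unitaries : set (borel M) := [set V | V \is unitarymx].

Lemma unitary_norm_le1 V i j : V \is unitarymx -> `|V i j| <= 1.
Proof.
move=> /unitarymxP/matrixP/(_ i i); rewrite !mxE eqxx mulr1n.
under eq_bigr do rewrite !mxE -normCK.
move=> VV; rewrite -(@expr_le1 _ 2)// -VV (bigD1 j)//= lerDl.
by apply: sumr_ge0 => k _; rewrite exprn_ge0.
Qed.

Lemma closed_unitaries : closed (unitaries : set M).
Proof.
have -> : unitaries = \bigcap_(ij in [set: 'I_N * 'I_N])
    ((fun V : M => (V *m V ^t*) ij.1 ij.2) @^-1` [set (ij.1 == ij.2)%:R]).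
  apply/seteqP; split => V /=.
    by move=> /unitarymxP VV ij _ /=; rewrite VV mxE.
  move=> VV; apply/unitarymxP/matrixP => i j.
  by have := VV (i, j) I; rewrite /= => ->; rewrite mxE.
apply: closed_bigI => -[i j] _ /=.
have cc : continuous (fun V : M => (V *m V ^t*) i j).
  under eq_fun do rewrite mxE.
  apply: cfun_sum => k.
  have ck : continuous (fun V : M => (V ^t*) k j).
    under eq_fun do rewrite !mxE.
    exact: (cfun_conj (@entry_continuous _ _ _ j k)).
  exact: (cfunM (@entry_continuous _ _ _ i k) ck).
apply: (closed_comp (fun V _ => cc V)).
by apply: accessible_closed_set1; apply: hausdorff_accessible; exact: norm_hausdorff.
Qed.

Lemma measurable_unitaries : measurable unitaries.
Proof.
rewrite -[unitaries]setCK; apply: measurableC; apply: sub_sigma_algebra.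
exact: (closed_openC closed_unitaries).
Qed.

(** Polynomials in the entries of [V] are unbounded on all matrices but
    bounded on unitary ones, and that is where the Haar measure lives *)
Definition tame f := continuous f /\
  exists B : R, forall V, V \is unitarymx -> `|f V| <= B%:C.

Lemma tame_bound f : tame f ->
  exists2 B : R, 0 <= B & forall V, V \is unitarymx -> `|f V| <= B%:C.
Proof.
move=> [_ [B fB]]; exists `|B| => // V VU; apply: (le_trans (fB V VU)).
by rewrite lecR ler_norm.
Qed.

Lemma tame_cst c : tame (fun=> c).
Proof.
split; first by apply: cst_continuous.
by exists (complex.Re `|c|) => V _; rewrite -normc_ReE.
Qed.

Lemma tameD f g : tame f -> tame g -> tame (fun V => f V + g V).
Proof.
move=> [cf [B fB]] [cg [B' gB]]; split; first exact: (cfunD cf cg).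
exists (B + B') => V VU; rewrite rmorphD/=.
by apply: (le_trans (ler_normD _ _)); apply: lerD; [exact: fB|exact: gB].
Qed.

Lemma tameM f g : tame f -> tame g -> tame (fun V => f V * g V).
Proof.
move=> gf gg; split; first exact: (cfunM gf.1 gg.1).
have [B B0 fB] := tame_bound gf; have [B' B'0 gB] := tame_bound gg.
exists (B * B') => V VU; rewrite rmorphM/= normrM.
by apply: ler_pM => //; [exact: fB|exact: gB].
Qed.

Lemma tameN f : tame f -> tame (fun V => - f V).
Proof.
move=> gf; have := tameM (tame_cst (-1)) gf.
by under eq_fun do rewrite mulN1r.
Qed.

Lemma tame_conj f : tame f -> tame (fun V => (f V)^*%C).
Proof.
move=> [cf [B fB]]; split; first exact: (cfun_conj cf).
by exists B => V /fB; rewrite norm_conjC.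
Qed.

Lemma tame_norm f : tame f -> tame (fun V => `|f V|).
Proof.
move=> [cf [B fB]]; split; first exact: (cfun_norm cf).
by exists B => V /fB; rewrite normr_id.
Qed.

Lemma tame_sum (I : Type) (r : seq I) (P : pred I) (F : I -> M -> C) :
  (forall i, tame (F i)) -> tame (fun V => \sum_(i <- r | P i) F i V).
Proof.
move=> gF; elim: r => [|i r IH].
  by under eq_fun do rewrite big_nil; exact: tame_cst.
under eq_fun do rewrite big_cons.
by case: (P i); [exact: (tameD (gF i) IH)|exact: IH].
Qed.

Lemma tame_entry i j : tame (fun V => V i j).
Proof.
split; first exact: entry_continuous.
by exists 1 => V VU; exact: unitary_norm_le1.
Qed.

Lemma tame_comp (h : R -> R) (B : R) f : continuous h ->
  (forall x, `|h x| <= B) -> tame f ->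
  tame (fun V => (h (complex.Re (f V)))%:C).
Proof.
move=> ch hB [cf _]; split.
  have cRf := cfun_Re cf => V.
  have chf : {for V, continuous (fun V => h (complex.Re (f V)))}.
    by apply: (@continuous_comp _ _ _ (fun V => complex.Re (f V)) h V);
      [exact: cRf|exact: ch].
  apply: (@continuous_comp _ _ _ (fun V => h (complex.Re (f V)))
    (fun x : R => x%:C) V); [exact: chf|exact: continuous_real_complex].
by exists B => V _; rewrite normc_def/= expr0n addr0 sqrtr_sqr lecR.
Qed.

(** Integration is over the set of unitary matrices, where tame functions are
    bounded and hence integrable; this set has full measure *)
Definition iE (f : M -> R) : R := \int[mu]_(V in unitaries) f V.

Definition cE f : C :=
  Complex (iE (fun V => complex.Re (f V))) (iE (fun V => complex.Im (f V))).

Lemma Re_cE f : complex.Re (cE f) = iE (fun V => complex.Re (f V)).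
Proof. by []. Qed.

Lemma iE_integrable (f : M -> R) : continuous f ->
  (exists B, forall V, V \is unitarymx -> `|f V| <= B) ->
  mu.-integrable unitaries (EFin \o f).
Proof.
move=> cf [B fB]; apply: measurable_bounded_integrable.
- exact: measurable_unitaries.
- by rewrite (le_lt_trans (probability_le1 _ measurable_unitaries))// ltry.
- apply: measurable_funTS; exact: (borel_continuous_measurable cf).
- exists B; split; [exact: num_real|move=> x Bx V VU /=].
  by apply/ltW; apply: le_lt_trans Bx; exact: fB.
Qed.

Lemma tame_Re_integrable f : tame f ->
  mu.-integrable unitaries (EFin \o (fun V => complex.Re (f V))).
Proof.
move=> [cf [B fB]]; apply: iE_integrable; first exact: (cfun_Re cf).
exists B => V /fB; rewrite normc_ReE lecR; exact/le_trans/normr_Re.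
Qed.

Lemma tame_Im_integrable f : tame f ->
  mu.-integrable unitaries (EFin \o (fun V => complex.Im (f V))).
Proof.
move=> [cf [B fB]]; apply: iE_integrable; first exact: (cfun_Im cf).
exists B => V /fB; rewrite normc_ReE lecR; exact/le_trans/normr_Im.
Qed.

Lemma eq_cE f g : (forall V, V \is unitarymx -> f V = g V) -> cE f = cE g.
Proof.
move=> fg; congr Complex; apply: eq_Rintegral => V; rewrite inE => VU;
  by rewrite fg.
Qed.

Lemma cE_cst c : cE (fun=> c) = c.
Proof.
have U1 : mu unitaries = 1%E by have [] := mu_haar.
have mU := measurable_unitaries.
case: c => a b; rewrite /cE /iE /= !(Rintegral_cst mu mU) [X in fine X]U1.
by rewrite !mulr1.
Qed.

Lemma cED f g : tame f -> tame g -> cE (fun V => f V + g V) = cE f + cE g.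
Proof.
move=> gf gg; rewrite /cE [in RHS]/GRing.add/=.
have mU := measurable_unitaries.
congr Complex.
- rewrite /iE -(RintegralD mU (tame_Re_integrable gf) (tame_Re_integrable gg)).
  by apply: eq_Rintegral => V _; rewrite cReD.
- rewrite /iE -(RintegralD mU (tame_Im_integrable gf) (tame_Im_integrable gg)).
  by apply: eq_Rintegral => V _; rewrite cImD.
Qed.

Lemma cEZ c f : tame f -> cE (fun V => c * f V) = c * cE f.
Proof.
move=> gf.
have mU := measurable_unitaries.
have iR := tame_Re_integrable gf; have iI := tame_Im_integrable gf.
have iRa r := integrableZl mU r iR; have iIa r := integrableZl mU r iI.
apply: complexRI.
  rewrite cReM -[RHS]/(complex.Re c * iE _ - complex.Im c * iE _).
  rewrite -[LHS]/(iE _) /iE -!RintegralZl//.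
  rewrite -RintegralB//; [|exact: iRa|exact: iIa].
  by apply: eq_Rintegral => V _; rewrite cReM.
rewrite cImM -[RHS]/(complex.Re c * iE _ + complex.Im c * iE _).
rewrite -[LHS]/(iE _) /iE -!RintegralZl//.
rewrite -RintegralD//; [|exact: iIa|exact: iRa].
by apply: eq_Rintegral => V _; rewrite cImM.
Qed.

Lemma cEN f : tame f -> cE (fun V => - f V) = - cE f.
Proof.
by move=> gf; rewrite -mulN1r -cEZ//; apply: eq_cE => V _; rewrite mulN1r.
Qed.

Lemma cEB f g : tame f -> tame g -> cE (fun V => f V - g V) = cE f - cE g.
Proof. by move=> gf gg; rewrite cED ?cEN//; exact: tameN. Qed.

Lemma cE_sum (I : Type) (r : seq I) (P : pred I) (F : I -> M -> C) :
  (forall i, tame (F i)) ->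
  cE (fun V => \sum_(i <- r | P i) F i V) = \sum_(i <- r | P i) cE (F i).
Proof.
move=> gF; elim: r => [|i r IH].
  by rewrite big_nil -[RHS]cE_cst; apply: eq_cE => V _; rewrite big_nil.
rewrite big_cons.
have E : cE (fun V => \sum_(j <- i :: r | P j) F j V) =
  cE (fun V => if P i then F i V + \sum_(j <- r | P j) F j V
               else \sum_(j <- r | P j) F j V).
  by apply: eq_cE => V _; rewrite big_cons.
rewrite E; case: (P i); last exact: IH.
by rewrite cED ?IH//; exact: tame_sum.
Qed.

Lemma le_cE f g : tame f -> tame g ->
  (forall V, V \is unitarymx -> complex.Re (f V) <= complex.Re (g V)) ->
  complex.Re (cE f) <= complex.Re (cE g).
Proof.
move=> gf gg fg; rewrite !Re_cE; apply: le_Rintegral.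
- exact: measurable_unitaries.
- exact: tame_Re_integrable.
- exact: tame_Re_integrable.
- exact: fg.
Qed.

Lemma le_norm_Re_cE f g : tame f -> tame g ->
  (forall V, V \is unitarymx -> `|complex.Re (f V)| <= complex.Re (g V)) ->
  `|complex.Re (cE f)| <= complex.Re (cE g).
Proof.
move=> gf gg fg; rewrite ler_norml; apply/andP; split.
  rewrite -cReN -cEN//; apply: le_cE => //; first exact: tameN.
  by move=> V /fg; rewrite cReN lerNl => /(le_trans _)-> //; rewrite -normrN ler_norm.
by apply: le_cE => // V /fg; apply: le_trans; rewrite ler_norm.
Qed.

Lemma cE_real f : (forall V, complex.Im (f V) = 0) ->
  cE f = (complex.Re (cE f))%:C.
Proof.
move=> f0; apply: complexRI => //=.
rewrite /iE (_ : (fun V => complex.Im (f V)) = (fun=> 0)); last exact/funext.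
by rewrite Rintegral_cst ?mul0r//; exact: measurable_unitaries.
Qed.

(** Left multiplication by a unitary matrix maps the unitary matrices onto
    themselves and preserves the measure *)
Lemma cE_lmul f W : W \is unitarymx -> tame f ->
  cE (fun V => f (W *m V)) = cE f.
Proof.
move=> WU gf.
have cW : continuous (fun V : M => W *m V).
  apply: matrix_continuous => i j.
  under eq_fun do rewrite mxE.
  apply: cfun_sum => k.
  have ck : continuous (fun V : M => W i k) by apply: cst_continuous.
  exact: (cfunM ck (@entry_continuous _ _ _ k j)).
have mW := borel_continuous_measurable2 cW.
have UWi V := unitary_lmul V WU.
have UW : (fun V : borel M => W *m V) @^-1` unitaries = unitaries.
  by apply/funext => V; rewrite /unitaries /preimage /= UWi.
have invar (h : M -> R) : continuous h ->
    (exists B, forall V, V \is unitarymx -> `|h V| <= B) ->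
    iE (fun V => h (W *m V)) = iE h.
  move=> ch [B hB]; congr fine.
  have mh := borel_continuous_measurable ch.
  have chW : continuous (fun V : M => h (W *m V)).
    by move=> x; apply: (cvg_comp _ _ (cW x)); exact: ch.
  have ihW : mu.-integrable unitaries (EFin \o (fun V => h (W *m V))).
    by apply: (iE_integrable chW); exists B => V VU; apply: hB; rewrite UWi.
  rewrite [RHS](@eq_measure_integral _ _ _ _ (pushforward mu (fun V : borel M => W *m V : borel M))); last first.
    move=> A mA _; rewrite /pushforward/=; apply/esym.
    have [_ /(_ W WU A mA) muA] := mu_haar; exact: muA.
  have /measurable_EFinP mEh := mh.
  have ihW' : mu.-integrable ((fun V : borel M => W *m V : borel M) @^-1` unitaries)
      ((EFin \o h) \o (fun V : borel M => W *m V : borel M)).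
    by rewrite UW; exact: ihW.
  rewrite (integral_pushforward mW mEh ihW' measurable_unitaries).
  by rewrite UW.
have [cf [B fB]] := gf.
congr Complex.
- apply: (invar (fun V => complex.Re (f V))); first exact: (cfun_Re cf).
  exists B => V /fB; rewrite normc_ReE lecR; exact/le_trans/normr_Re.
- apply: (invar (fun V => complex.Im (f V))); first exact: (cfun_Im cf).
  exists B => V /fB; rewrite normc_ReE lecR; exact/le_trans/normr_Im.
Qed.

End HaarExpectation.

(** * Derivations and the Stein identity on the unitary group *)

Section Derivations.
Variables (R : realType) (N : nat).
Notation C := R[i].
Notation M := 'M[C]_N.
Local Notation i_ := (@Num.imaginary R[i]).
Implicit Types (f g : M -> C) (Df Dg : M -> M -> C) (V K L : M).

Definition direction (w : 'cV[C]_N) : M := i_ *: rank1 w.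

(** [Df K V] is the derivative of [f] at [V] in the direction [K V]. The
    expansion is along the skew-Hermitian [K = i w w^*], which are tangent to
    the unitary group; the complex linear extension in [K] is part of the
    data *)
Definition has_derivation f Df :=
  [/\ tame f, forall K, tame (Df K),
      forall a K L V, Df (a *: K + L) V = a * Df K V + Df L V &
      forall w : 'cV[C]_N, exists2 B : R, 0 <= B &
        forall (t : R) V, 0 <= t <= 1 -> V \is unitarymx ->
        `|f (curve w t%:C *m V) - f V - t%:C * Df (direction w) V|
          <= B%:C * t%:C ^+ 2].

Lemma derivation0 f Df V : has_derivation f Df -> Df 0 V = 0.
Proof.
move=> [_ _ lf _]; have := lf 1 0 0 V.
rewrite scaler0 addr0 mul1r => /esym/eqP.
by rewrite -[eqbRHS]addr0 (inj_eq (addrI _)) => /eqP.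
Qed.

Lemma derivationN f Df K V : has_derivation f Df -> Df (- K) V = - Df K V.
Proof.
move=> df; have [_ _ lf _] := df; have := lf (-1) K 0 V.
by rewrite scaleN1r addr0 mulN1r (derivation0 _ df) addr0.
Qed.

Lemma derivation_sum f Df V (I : Type) (r : seq I) (c : I -> C) (F : I -> M) :
  has_derivation f Df ->
  Df (\sum_(i <- r) c i *: F i) V = \sum_(i <- r) c i * Df (F i) V.
Proof.
move=> df; have [_ _ lf _] := df; elim: r => [|i r IH].
  by rewrite !big_nil (derivation0 _ df).
by rewrite !big_cons lf IH.
Qed.

Lemma real_complex_real (t : R) : t%:C \is Num.real.
Proof. by rewrite complex_real. Qed.

Lemma curve_lmul_unitary w (t : R) V : V \is unitarymx ->
  curve w t%:C *m V \is unitarymx.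
Proof.
by move=> VU; rewrite (unitary_lmul V (curve_unitary w (real_complex_real t))).
Qed.

Lemma has_derivation_cst c : has_derivation (fun=> c) (fun _ _ => 0).
Proof.
split; first exact: tame_cst.
- by move=> K; exact: tame_cst.
- by move=> *; rewrite mulr0 addr0.
- move=> w; exists 0 => // t V _ _.
  by rewrite subrr mulr0 subr0 normr0 mul0r.
Qed.

Lemma has_derivation_entry i j :
  has_derivation (fun V => V i j) (fun K V => (K *m V) i j).
Proof.
split; first exact: tame_entry.
- move=> K; under eq_fun do rewrite mxE.
  by apply: tame_sum => k; apply: tameM; [exact: tame_cst|exact: tame_entry].
- by move=> a K L V; rewrite mulmxDl -scalemxAl !mxE.
move=> w; pose D := rank1 w.
exists (complex.Re (`|sqnorm w| * \sum_k `|D i k|)).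
  suff : 0 <= `|sqnorm w| * \sum_k `|D i k| by rewrite lecE => /andP[].
  by apply: mulr_ge0 => //; apply: sumr_ge0.
move=> t V t01 VU.
have -> : (curve w t%:C *m V) i j - V i j - t%:C * (direction w *m V) i j =
    (cayley (sqnorm w) t%:C - i_ * t%:C) * (D *m V) i j.
  rewrite mulmxDl mul1mx /direction -!scalemxAl -/D; set E := D *m V.
  by rewrite [(V + _) i j]mxE ![(_ *: E) i j]mxE; ring.
rewrite RRe_real; last first.
  by apply: realM; [exact: normr_real|apply: sum_real => k _; exact: normr_real].
rewrite normrM mulrAC; apply: ler_pM => //.
  apply: le_trans (cayley_taylor (sqnorm_real w) (real_complex_real t)) _.
  rewrite [ `|t%:C|]ger0_norm//; by rewrite ler0c; case/andP: t01.
rewrite mxE; apply: (le_trans (ler_norm_sum _ _ _)); apply: ler_sum => k _.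
by rewrite normrM ler_piMr// unitary_norm_le1.
Qed.

Lemma has_derivationD f Df g Dg :
  has_derivation f Df -> has_derivation g Dg ->
  has_derivation (fun V => f V + g V) (fun K V => Df K V + Dg K V).
Proof.
move=> [gf gDf lf tf] [gg gDg lg tg]; split; first exact: tameD.
- by move=> K; exact: tameD.
- by move=> a K L V; rewrite lf lg mulrDr addrACA.
move=> w; have [B B0 hB] := tf w; have [B' B'0 hB'] := tg w.
exists (B + B'); first exact: addr_ge0.
move=> t V t01 VU; rewrite rmorphD/= mulrDl.
rewrite [X in `|X|](_ : _ = (f (curve w t%:C *m V) - f V -
  t%:C * Df (direction w) V) + (g (curve w t%:C *m V) - g V -
  t%:C * Dg (direction w) V)); last by ring.
by apply: (le_trans (ler_normD _ _)); apply: lerD; [exact: hB|exact: hB'].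
Qed.

Lemma has_derivationM f Df g Dg :
  has_derivation f Df -> has_derivation g Dg ->
  has_derivation (fun V => f V * g V) (fun K V => Df K V * g V + f V * Dg K V).
Proof.
move=> [gf gDf lf tf] [gg gDg lg tg]; split; first exact: tameM.
- by move=> K; apply: tameD; exact: tameM.
- by move=> a K L V; rewrite lf lg; ring.
move=> w; have [Cf Cf0 hf] := tf w; have [Cg Cg0 hg] := tg w.
have [Bf Bf0 fB] := tame_bound gf; have [BDf BDf0 DfB] := tame_bound (gDf (direction w)).
have [Bg Bg0 gB] := tame_bound gg; have [BDg BDg0 DgB] := tame_bound (gDg (direction w)).
exists (Cf * Bg + (Bf + BDf) * Cg + BDf * BDg).
  by rewrite !addr_ge0// mulr_ge0// addr_ge0.
move=> t V t01 VU; rewrite !(rmorphD, rmorphM)/=.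
apply: taylor_mul; rewrite ?ler0c//.
- by case/andP: t01 => t0 t1; rewrite t0 -[1]/(1%:C) lecR.
- exact: fB.
- exact: DfB.
- by apply: gB; exact: curve_lmul_unitary.
- exact: DgB.
- exact: hf.
- exact: hg.
Qed.

Lemma has_derivation_sum (I : Type) (r : seq I) (F : I -> M -> C)
    (F' : I -> M -> M -> C) : (forall i, has_derivation (F i) (F' i)) ->
  has_derivation (fun V => \sum_(i <- r) F i V)
                 (fun K V => \sum_(i <- r) F' i K V).
Proof.
move=> dF; elim: r => [|i r IH].
  under eq_fun do rewrite big_nil.
  under [X in has_derivation _ X]eq_fun do under eq_fun do rewrite big_nil.
  exact: has_derivation_cst.
under eq_fun do rewrite big_cons.
under [X in has_derivation _ X]eq_fun do under eq_fun do rewrite big_cons.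
exact: has_derivationD.
Qed.

(** On skew-Hermitian directions [K^* = - K], hence the sign and the adjoint
    in the complex linear extension *)
Lemma has_derivation_conj f Df : has_derivation f Df ->
  has_derivation (fun V => (f V)^*%C) (fun K V => - (Df (K^t*) V)^*%C).
Proof.
move=> df; have [gf gDf lf tf] := df; split; first exact: tame_conj.
- by move=> K; apply: tameN; exact: tame_conj.
- move=> a K L V; rewrite linearD linearZ/= map_mxD map_mxZ lf.
  by rewrite rmorphD rmorphM/= conjcK opprD mulrN.
move=> w; have [B B0 hB] := tf w; exists B => // t V t01 VU.
have -> : (direction w)^t* = - direction w.
  by rewrite /direction linearZ/= map_mxZ rank1_adj/= conjCi scaleNr.
rewrite (derivationN _ _ df) raddfN/= opprK.
set a := f _; set b := f V; set c := Df _ V.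
rewrite [X in `|X|](_ : _ = (a - b - t%:C * c)^*%C); last first.
  by rewrite !rmorphB rmorphM/= [t -i* 0]conjc_real.
rewrite norm_conjC; exact: hB.
Qed.

End Derivations.

Section SteinIdentity.
Variables (R : realType) (N : nat).
Notation C := R[i].
Notation M := 'M[C]_N.
Local Notation i_ := (@Num.imaginary R[i]).
Implicit Types (f g : M -> C) (Df Dg : M -> M -> C) (V K L : M).

Lemma norm_realc (x : R) : `|x%:C| = `|x|%:C.
Proof. by rewrite normc_def/= expr0n addr0 sqrtr_sqr. Qed.

(** Chain rule with a quadratic remainder, for a real valued inner
    function *)
Lemma has_derivation_sin f Df : (forall V, complex.Im (f V) = 0) ->
  has_derivation f Df ->
  has_derivation (fun V => (sin (complex.Re (f V)))%:C)
    (fun K V => (cos (complex.Re (f V)))%:C * Df K V).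
Proof.
move=> f_real [gf gDf lf tf].
have gcos := tame_comp (@continuous_cos R) (@cos_norm_le1 R) gf.
split.
- exact: (tame_comp (@continuous_sin R) (@sin_norm_le1 R) gf).
- by move=> K; exact: tameM.
- by move=> a K L V; rewrite lf; ring.
move=> w; have [B B0 hB] := tf w; have [B' B'0 hB'] := tame_bound (gDf (direction w)).
exists (B + (B + B') ^+ 2); first by rewrite addr_ge0// sqr_ge0.
move=> t V t01 VU; have := hB t V t01 VU; have := hB' V VU.
have fE W : f W = (complex.Re (f W))%:C by apply: complexRI; rewrite ?f_real.
set W := curve _ _ *m V; set d := Df _ V.
set a := complex.Re (f V); set b := complex.Re (f W).
have eV : f V = a%:C := fE V; have eW : f W = b%:C := fE W.
rewrite eV eW => dB tB.
have t0 : 0 <= t by case/andP: t01.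
have t1 : t <= 1 by case/andP: t01.
have ab : `|b - a| <= (B + B') * t.
  rewrite -lecR -norm_realc rmorphB rmorphM rmorphD/= mulrDl.
  rewrite -[X in `|X|](subrK (t%:C * d)); apply: (le_trans (ler_normD _ _)).
  apply: lerD.
    apply: (le_trans tB); rewrite expr2 mulrA ler_piMr ?mulr_ge0 ?ler0c//.
    by rewrite -[1]/(1%:C) lecR.
  rewrite normrM norm_realc (ger0_norm t0) mulrC.
  by apply: ler_wpM2r => //; rewrite ler0c.
have -> : (B + (B + B') ^+ 2)%:C * t%:C ^+ 2 =
    B%:C * t%:C ^+ 2 + ((B + B') ^+ 2 * t ^+ 2)%:C.
  by rewrite -rmorphXn -!rmorphM -rmorphD/=; congr _%:C; ring.
have -> : (sin b)%:C - (sin a)%:C - t%:C * ((cos a)%:C * d) =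
    (sin b - sin a - (b - a) * cos a)%:C
    + (cos a)%:C * (b%:C - a%:C - t%:C * d).
  by rewrite !(rmorphB, rmorphM)/=; ring.
rewrite addrC; apply: (le_trans (ler_normD _ _)); apply: lerD.
  rewrite normrM; apply: le_trans tB; rewrite ler_piMl// norm_realc.
  by rewrite -[1]/(1%:C) lecR cos_norm_le1.
rewrite norm_realc lecR; apply: (le_trans (sin_taylor a b)).
by rewrite -exprMn -real_normK ?num_real// lerXn2r ?nnegrE// mulr_ge0// addr_ge0.
Qed.

Variable mu : probability (borel M) R.
Hypothesis mu_haar : haar_unitary mu.
Notation cE := (cE mu).

Lemma norm_cE_le f (b : R) : tame f ->
  (forall V, V \is unitarymx -> `|f V| <= b%:C) ->
  `|complex.Re (cE f)| <= b /\ `|complex.Im (cE f)| <= b.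
Proof.
have key g : tame g -> (forall V, V \is unitarymx -> `|g V| <= b%:C) ->
    `|complex.Re (cE g)| <= b.
  move=> gg gb; rewrite -[leRHS]/(complex.Re b%:C) -(cE_cst mu_haar b%:C).
  apply: le_norm_Re_cE => //; first exact: tame_cst.
  by move=> V /gb /=; rewrite normc_ReE lecR; apply: le_trans; exact: normr_Re.
move=> gf fb; split; first exact: key.
rewrite Im_Re -cEZ//; apply: key; first by apply: tameM => //; exact: tame_cst.
move=> V VU; rewrite normrM normrN (_ : `|'i| = 1) ?mul1r; first exact: fb.
by rewrite normc_def/= expr0n expr1n add0r sqrtr1.
Qed.

(** Invariance gives [E f (curve V) = E f (V)], so the first order term of the
    expansion has mean [O(t)] for every [t] *)
Lemma stein_direction f Df w : has_derivation f Df -> cE (Df (direction w)) = 0.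
Proof.
move=> [gf gDf lf tf]; have [B B0 hB] := tf w.
have main t : 0 < t <= 1 ->
    `|complex.Re (cE (Df (direction w)))| <= B * t /\
    `|complex.Im (cE (Df (direction w)))| <= B * t.
  move=> /andP[t0 t1].
  have t01 : 0 <= t <= 1 by rewrite ltW.
  have WU := curve_unitary w (real_complex_real t).
  have gfW : tame (fun V => f (curve w t%:C *m V)).
    have [cf [Bf fB]] := gf; split.
      move=> V; apply: (@continuous_comp _ _ _ (fun V => curve w t%:C *m V) f V); last exact: cf.
      apply: matrix_continuous => i j.
      under eq_fun do rewrite mxE.
      by apply: cfun_sum => k; apply: cfunM; [apply: cst_continuous|exact: entry_continuous].
    by exists Bf => V VU; apply: fB; exact: curve_lmul_unitary.
  pose r V := f (curve w t%:C *m V) - f V - t%:C * Df (direction w) V.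
  have gtD : tame (fun V => t%:C * Df (direction w) V).
    by apply: tameM; [exact: tame_cst|exact: gDf].
  have gr : tame r by apply: tameD; [apply: tameD => //|]; exact: tameN.
  have Er : cE r = - (t%:C * cE (Df (direction w))).
    rewrite /r cEB//; last by apply: tameD => //; exact: tameN.
    by rewrite cEB// cE_lmul// subrr sub0r cEZ.
  have rb V : V \is unitarymx -> `|r V| <= (B * t ^+ 2)%:C.
    by move=> VU; rewrite rmorphM rmorphXn; exact: hB.
  have [] := norm_cE_le gr rb; rewrite Er; move: (cE _) => z.
  rewrite cReN cImN !normrN cReM cImM/= !mul0r subr0 addr0.
  by rewrite !normrM (ger0_norm (ltW t0)) expr2 mulrCA !ler_pM2l.
have Re0 : `|complex.Re (cE (Df (direction w)))| = 0.
  by apply: (@le_linear_eq0 _ _ B) => // t t01; have [] := main t t01.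
have Im0 : `|complex.Im (cE (Df (direction w)))| = 0.
  by apply: (@le_linear_eq0 _ _ B) => // t t01; have [] := main t t01.
by apply: complexRI; [exact: normr0_eq0 Re0|exact: normr0_eq0 Im0].
Qed.

(** Complex linearity extends the previous identity from rank one Hermitian
    matrices to elementary matrices and then to all matrices *)
Lemma stein_identity f Df K : has_derivation f Df -> cE (Df K) = 0.
Proof.
move=> df; have [gf gDf lf tf] := df.
have ii : i_ * - i_ = 1 by rewrite mulrN -expr2 sqrCi opprK.
have DfE a b V : Df (delta_mx a b) V = \sum_(k < 4)
    (4%:R^-1 * i_ ^+ k * - i_) *
    Df (direction (delta_mx a 0 + i_ ^+ k *: delta_mx b 0)) V.
  rewrite -(derivation_sum _ _ _ _ df); congr (Df _ V).
  apply: (@scalerI _ _ 4%:R); first by rewrite pnatr_eq0.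
  have -> : delta_mx a b = delta_mx a 0 *m (delta_mx b 0 : 'cV[C]_N)^t*.
    have -> : (delta_mx b 0 : 'cV[C]_N)^t* = delta_mx 0 b.
      by apply/matrixP => i j; rewrite !mxE andbC rmorph_nat.
    by rewrite mul_delta_mx.
  rewrite polarization scaler_sumr; apply: eq_bigr => k _.
  rewrite /direction !scalerA; congr (_ *: _).
  by rewrite -!mulrA [- i_ * i_]mulrC ii mulr1 mulrA mulfV ?mul1r// pnatr_eq0.
have E0 a b : cE (Df (delta_mx a b)) = 0.
  rewrite (eq_cE mu (fun V _ => DfE a b V)) cE_sum//; last first.
    by move=> k; apply: tameM; [exact: tame_cst|exact: gDf].
  by apply: big1 => k _; rewrite cEZ// (stein_direction _ df) mulr0.
have KE V : Df K V = \sum_i \sum_j K i j * Df (delta_mx i j) V.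
  rewrite {1}(matrix_sum_delta K).
  under eq_bigr do rewrite -[\sum_(j < N) _]scale1r.
  rewrite (derivation_sum _ _ _ _ df); apply: eq_bigr => i _.
  by rewrite mul1r (derivation_sum _ _ _ _ df).
rewrite (eq_cE mu (fun V _ => KE V)) cE_sum//; last first.
  move=> i; apply: tame_sum => j; apply: tameM; [exact: tame_cst|exact: gDf].
apply: big1 => i _; rewrite cE_sum//; last first.
  by move=> j; apply: tameM; [exact: tame_cst|exact: gDf].
by apply: big1 => j _; rewrite cEZ// E0 mulr0.
Qed.

End SteinIdentity.

(** * Schwinger-Dyson equation and second moments *)

Section MatrixDerivations.
Variables (R : realType) (N : nat).
Notation C := R[i].
Notation M := 'M[C]_N.

Definition has_mxderivation m n (F : M -> 'M[C]_(m, n))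
    (DF : M -> M -> 'M[C]_(m, n)) :=
  forall i j, has_derivation (fun V => F V i j) (fun K V => DF K V i j).

Lemma has_mxderivation_id : has_mxderivation id (fun K V => K *m V).
Proof. by move=> i j; exact: has_derivation_entry. Qed.

Lemma has_mxderivation_cst m n (A : 'M[C]_(m, n)) :
  has_mxderivation (fun=> A) (fun _ _ => 0).
Proof.
move=> i j; under [X in has_derivation _ X]eq_fun do under eq_fun do rewrite mxE.
exact: has_derivation_cst.
Qed.

Lemma has_mxderivationM m n q (F : M -> 'M[C]_(m, n)) (G : M -> 'M[C]_(n, q))
    DF DG : has_mxderivation F DF -> has_mxderivation G DG ->
  has_mxderivation (fun V => F V *m G V)
    (fun K V => DF K V *m G V + F V *m DG K V).
Proof.
move=> dF dG i j.
have := has_derivation_sum (index_enum 'I_n)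
  (fun k => has_derivationM (dF i k) (dG k j)).
congr has_derivation; first by apply/funext => V; rewrite mxE.
by apply/funext => K; apply/funext => V; rewrite !mxE big_split.
Qed.

Lemma has_mxderivation_adj m n (F : M -> 'M[C]_(m, n)) DF :
  has_mxderivation F DF ->
  has_mxderivation (fun V => (F V)^t*) (fun K V => - (DF (K^t*) V)^t*).
Proof.
move=> dF i j; have := has_derivation_conj (dF j i).
congr has_derivation; first by apply/funext => V; rewrite !mxE.
by apply/funext => K; apply/funext => V; rewrite !mxE.
Qed.

Lemma has_derivation_tr n (F : M -> 'M[C]_n) DF : has_mxderivation F DF ->
  has_derivation (fun V => \tr (F V)) (fun K V => \tr (DF K V)).
Proof.
by move=> dF; exact: (has_derivation_sum (index_enum 'I_n) (fun k => dF k k)).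
Qed.

Lemma has_mxderivation_adjid :
  has_mxderivation (fun V => V^t*) (fun K V => - (V^t* *m K)).
Proof.
have E : (fun K V => - (V^t* *m K)) = (fun K V : M => - (K^t* *m V)^t*).
  apply/funext => K; apply/funext => V; congr (- _).
  by rewrite trmx_mul map_mxM/= -[in X in _ = _ *m X]map_trmx map_mxCK trmxK.
rewrite E; exact: (has_mxderivation_adj has_mxderivation_id).
Qed.

Lemma has_mxderivation_cj (S : M) : has_mxderivation (cj S)
  (fun K V => V^t* *m S *m K *m V - V^t* *m K *m S *m V).
Proof.
have := has_mxderivationM
  (has_mxderivationM has_mxderivation_adjid (has_mxderivation_cst S))
  has_mxderivation_id.
congr has_mxderivation; apply/funext => K; apply/funext => V.
by rewrite mulmx0 addr0 !mulNmx mulmxA addrC.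
Qed.

Lemma tame_mul_entry m n q (F : M -> 'M[C]_(m, n)) (G : M -> 'M[C]_(n, q)) :
  (forall i j, tame (fun V => F V i j)) ->
  (forall i j, tame (fun V => G V i j)) ->
  forall i j, tame (fun V => (F V *m G V) i j).
Proof.
move=> gF gG i j; under eq_fun do rewrite mxE.
by apply: tame_sum => k; apply: tameM; [exact: gF|exact: gG].
Qed.

Lemma tame_cj_entry (S : M) i j : tame (fun V : M => cj S V i j).
Proof. by case: (has_mxderivation_cj S i j). Qed.

Lemma tame_tr n (F : M -> 'M[C]_n) : (forall i j, tame (fun V => F V i j)) ->
  tame (fun V => \tr (F V)).
Proof. by move=> gF; apply: tame_sum => k; exact: gF. Qed.

Lemma tame_cst_entry m n (A : 'M[C]_(m, n)) i j : tame (fun V : M => A i j).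
Proof. exact: tame_cst. Qed.

End MatrixDerivations.

Section SchwingerDyson.
Variables (R : realType) (N : nat).
Notation C := R[i].
Notation M := 'M[C]_N.
Variable mu : probability (borel M) R.
Hypothesis mu_haar : haar_unitary mu.
Local Notation cE := (@cE R N mu).
Implicit Types (f : M -> C) (Df : M -> M -> C) (B S : M).

(** The Stein identity for [(V B V^* S) a b * f] in the elementary direction
    [(a, b)], summed over [a] and [b]: differentiating the first factor [V]
    produces [N Tr (V B V^* S)], differentiating [V^*] produces
    [- Tr B Tr S], and differentiating [f] restores the direction
    [V B V^* S] *)
Lemma schwinger_dyson f Df B S : has_derivation f Df ->
  N%:R * cE (fun V => \tr (B *m cj S V) * f V) =
  \tr B * \tr S * cE f - cE (fun V => Df (V *m B *m V^t* *m S) V).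
Proof.
move=> df; have [gf gDf lf _] := df.
pose X V := V *m B *m V^t* *m S.
pose DX K V := K *m V *m B *m V^t* *m S - V *m B *m V^t* *m K *m S.
have dX : has_mxderivation X DX.
  have := has_mxderivationM (has_mxderivationM (has_mxderivationM
    (@has_mxderivation_id R N) (@has_mxderivation_cst R N _ _ B))
    (@has_mxderivation_adjid R N)) (@has_mxderivation_cst R N _ _ S).
  congr has_mxderivation; apply/funext => K; apply/funext => V.
  by rewrite !mulmx0 !addr0 mulmxDl /DX mulmxN mulNmx !mulmxA.
have gX a b : tame (fun V => X V a b) by case: (dX a b).
have gDX K a b : tame (fun V => DX K V a b) by case: (dX a b).
have SD0 : cE (fun V => \sum_a \sum_b (DX (delta_mx a b) V a b * f V +
    X V a b * Df (delta_mx a b) V)) = 0.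
  rewrite cE_sum//; last first.
    by move=> a; apply: tame_sum => b; apply: tameD; apply: tameM.
  apply: big1 => a _; rewrite cE_sum//; last first.
    by move=> b; apply: tameD; apply: tameM.
  apply: big1 => b _.
  exact: (stein_identity mu_haar (delta_mx a b) (has_derivationM (dX a b) df)).
have DXE V : \sum_a \sum_b DX (delta_mx a b) V a b =
    N%:R * \tr (X V) - \tr (V *m B *m V^t*) * \tr S.
  rewrite -sum_delta_mul -sum_mul_delta_mul -sumrB; apply: eq_bigr => a _.
  rewrite -sumrB; apply: eq_bigr => b _.
  have mxB (P Q : M) : (P - Q) a b = P a b - Q a b by rewrite !mxE.
  by rewrite /DX mxB /X !mulmxA.
have XE V : Df (X V) V = \sum_a \sum_b X V a b * Df (delta_mx a b) V.
  rewrite {1}(matrix_sum_delta (X V)).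
  under eq_bigr do rewrite -[\sum_(j < N) _]scale1r.
  rewrite (derivation_sum _ _ _ _ df); apply: eq_bigr => a _.
  by rewrite mul1r (derivation_sum _ _ _ _ df).
have gDfX : tame (fun V => Df (X V) V).
  under eq_fun do rewrite XE.
  by apply: tame_sum => a; apply: tame_sum => b; apply: tameM.
have gtr : tame (fun V => \tr (B *m cj S V)).
  by apply: tame_tr; apply: tame_mul_entry; [exact: tame_cst_entry|exact: tame_cj_entry].
move: SD0; rewrite (@eq_cE _ _ mu _ (fun V =>
    N%:R * (\tr (B *m cj S V) * f V) - \tr B * \tr S * f V + Df (X V) V)).
  have gtrf := tameM gtr gf.
  have g1 : tame (fun V => N%:R * (\tr (B *m cj S V) * f V)).
    by apply: tameM => //; exact: tame_cst.
  have g2 : tame (fun V => \tr B * \tr S * f V).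
    by apply: tameM => //; exact: tame_cst.
  rewrite cED//; last by apply: tameD => //; exact: tameN.
  rewrite cEB// !cEZ// => /eqP.
  by rewrite addrAC subr_eq0 => /eqP <-; rewrite addrK.
move=> V VU; rewrite XE.
under eq_bigr do rewrite big_split.
rewrite big_split/=; congr (_ + _).
under eq_bigr do rewrite -mulr_suml.
rewrite -mulr_suml DXE mxtrace_conj_unitary// mulrBl -[N%:R * _ * _]mulrA.
suff -> : \tr (X V) = \tr (B *m cj S V) by [].
by rewrite /X /cj -!mulmxA mxtrace_mulC -!mulmxA.
Qed.

End SchwingerDyson.

Lemma tr_delta_mul (C : comNzRingType) n (a b : 'I_n) (Q : 'M[C]_n) :
  \tr (delta_mx b a *m Q) = Q a b.
Proof.
rewrite /mxtrace (bigD1 b)//= big1 ?addr0.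
  rewrite mxE (bigD1 a)//= big1 ?addr0.
    by rewrite mxE !eqxx mul1r.
  by move=> k ka; rewrite mxE (negbTE ka) andbF mul0r.
move=> k kb; rewrite mxE big1// => l _.
by rewrite mxE (negbTE kb) mul0r.
Qed.

Lemma delta_mul_entry (C : comNzRingType) n (a b : 'I_n) (Q Q' : 'M[C]_n) :
  (Q *m delta_mx b a *m Q') b a = Q b b * Q' a a.
Proof.
rewrite mxE (bigD1 a)//= big1 ?addr0; last first.
  move=> k ka; rewrite mxE big1 ?mul0r// => l _.
  by rewrite mxE (negbTE ka) andbF mulr0.
congr (_ * _); rewrite mxE (bigD1 b)//= big1 ?addr0.
  by rewrite mxE !eqxx mulr1.
by move=> k kb; rewrite mxE (negbTE kb) mulr0.
Qed.

Lemma tr_adj (C : numClosedFieldType) n (Q : 'M[C]_n) : \tr (Q^t*) = (\tr Q)^*%R.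
Proof. by rewrite /mxtrace rmorph_sum; apply: eq_bigr => i _; rewrite !mxE. Qed.

Lemma tr_adjM (C : numClosedFieldType) n (Q Q' : 'M[C]_n) :
  \tr (Q^t* *m Q'^t*) = (\tr (Q *m Q'))^*%R.
Proof. by rewrite -map_mxM -trmx_mul tr_adj mxtrace_mulC. Qed.

Lemma cReZ (R : realType) (r : R) (z : R[i]) :
  complex.Re (r%:C * z) = r * complex.Re z.
Proof. by rewrite cReM/= mul0r subr0. Qed.

Section SecondMoment.
Variables (R : realType) (N : nat).
Notation C := R[i].
Notation M := 'M[C]_N.
Variable mu : probability (borel M) R.
Hypothesis mu_haar : haar_unitary mu.
Local Notation cE := (@cE R N mu).
Implicit Types (f g : M -> C).

Definition absmean f : R := complex.Re (cE (fun V => `|f V|)).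
Definition sqmean f : R := complex.Re (cE (fun V => `|f V| ^+ 2)).

Lemma cE_cj_diag (S : M) a : N%:R * cE (fun V => cj S V a a) = \tr S.
Proof.
have := schwinger_dyson mu_haar (delta_mx a a) S (@has_derivation_cst R N 1).
rewrite (cE_cst mu_haar 0) subr0 (cE_cst mu_haar 1) mulr1.
have tr1 : \tr (delta_mx a a : M) = 1.
  by rewrite -[delta_mx a a]mulmx1 tr_delta_mul mxE eqxx.
rewrite tr1 mul1r => <-; congr (_ * _); apply: eq_cE => V _.
by rewrite tr_delta_mul mulr1.
Qed.

(** Schwinger-Dyson with [B] elementary and [f] the conjugate entry; the term
    [Tr B Tr T E f] vanishes because [T] has trace zero *)
Lemma second_moment_entry (T : M) a b : \tr T = 0 ->
  N%:R ^+ 2 * cE (fun V => `|cj T V a b| ^+ 2) =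
  \tr (T *m T^t*) - N%:R * cE (fun V => (cj T V b b)^*%R * cj T V a a).
Proof.
move=> trT.
have adjE V i j : cj (T^t*) V i j = (cj T V j i)^*%R by rewrite -cj_adj !mxE.
have := schwinger_dyson mu_haar (delta_mx b a) T
  (@has_mxderivation_cj R N (T^t*) b a).
rewrite trT mulr0 mul0r sub0r => SD.
rewrite expr2 -mulrA (@eq_cE _ _ mu _
  (fun V => \tr (delta_mx b a *m cj T V) * cj (T^t*) V b a)); last first.
  by move=> V _; rewrite tr_delta_mul adjE normCK.
have gtt := tame_cj_entry (T *m T^t*) a a.
have gb := tame_conj (tame_cj_entry T b b); have ga := tame_cj_entry T a a.
have gba := tameM gb ga.
rewrite SD (@eq_cE _ _ mu _ (fun V =>
  (cj T V b b)^*%R * cj T V a a - cj (T *m T^t*) V a a)); last first.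
  move=> V VU; have mxB (P Q : M) i j : (P - Q) i j = P i j - Q i j by rewrite !mxE.
  rewrite cj_commutator// mxB delta_mul_entry adjE; congr (_ - _).
  by rewrite -[X in X *m _]mul1mx delta_mul_entry mxE eqxx mul1r.
by rewrite cEB// mulrN mulrBr cE_cj_diag opprB.
Qed.

(** Summed over the block, the cross terms of [second_moment_entry] form
    [E |\sum_i (V^* T V) i i|^2],
    which enters with a negative sign *)
Lemma second_moment (T : M) p (t : 'I_p -> 'I_N) : \tr T = 0 ->
  \sum_i \sum_j sqmean (fun V => cj T V (t i) (t j)) * N%:R ^+ 2 <=
  p%:R ^+ 2 * complex.Re (\tr (T *m T^t*)).
Proof.
move=> trT.
pose d i V := cj T V (t i) (t i).
have gd i : tame (d i) := tame_cj_entry T (t i) (t i).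
have gD : tame (fun V => \sum_i d i V) := tame_sum _ _ gd.
have Nr : (N%:R : C) = (N%:R : R)%:C by rewrite rmorph_nat.
have key i j : sqmean (fun V => cj T V (t i) (t j)) * N%:R ^+ 2 =
    complex.Re (\tr (T *m T^t*)) -
    N%:R * complex.Re (cE (fun V => (d j V)^*%R * d i V)).
  have := congr1 (@complex.Re R) (second_moment_entry (t i) (t j) trT).
  rewrite Nr -rmorphXn cReD cReN !cReZ => <-.
  by rewrite mulrC.
under eq_bigr do under eq_bigr do rewrite key.
have sumE : \sum_i \sum_j complex.Re (cE (fun V => (d j V)^*%R * d i V)) =
    complex.Re (cE (fun V => `|\sum_i d i V| ^+ 2)).
  rewrite (@eq_cE _ _ mu (fun V => `|\sum_i d i V| ^+ 2)
    (fun V => \sum_i \sum_j (d j V)^*%R * d i V)); last first.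
    move=> V _; rewrite normCK rmorph_sum mulr_suml; apply: eq_bigr => i _.
    by rewrite mulr_sumr; apply: eq_bigr => j _; rewrite mulrC.
  have gij i j : tame (fun V => (d j V)^*%R * d i V).
    by apply: tameM; [exact: tame_conj|exact: gd].
  rewrite cE_sum//; last by move=> i; apply: tame_sum => j; exact: gij.
  rewrite Re_sum; apply: eq_bigr => i _.
  by rewrite cE_sum// Re_sum.
under eq_bigr do rewrite sumrB sumr_const card_ord -mulr_sumr.
rewrite sumrB sumr_const card_ord -mulr_sumr sumE.
rewrite -mulrnA -[X in X - _]mulr_natl natrM -expr2 lerBlDr lerDl.
apply: mulr_ge0 => //.
have := @le_cE R N mu (fun=> 0) (fun V => `|\sum_i d i V| ^+ 2) (@tame_cst R N 0).
rewrite (cE_cst mu_haar 0); apply.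
  rewrite [X in tame X](_ : _ = fun V => (\sum_i d i V) * (\sum_i d i V)^*%R).
    by apply: tameM => //; exact: tame_conj.
  by apply/funext => V; rewrite normCK.
move=> V _; have : 0 <= `|\sum_i d i V| ^+ 2 by rewrite exprn_ge0.
by rewrite lecE => /andP[].
Qed.

Lemma tame_norm2 f : tame f -> tame (fun V => `|f V| ^+ 2).
Proof.
move=> gf; rewrite [X in tame X](_ : _ = fun V => f V * (f V)^*%R).
  by apply: tameM => //; exact: tame_conj.
by apply/funext => V; rewrite normCK.
Qed.

Lemma Re_norm_ge0 (z : C) : 0 <= complex.Re `|z|.
Proof. by have : 0 <= `|z| by []; rewrite lecE => /andP[]. Qed.

Lemma Re_norm2 (z : C) : complex.Re (`|z| ^+ 2) = complex.Re `|z| ^+ 2.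
Proof. by rewrite normc_ReE -rmorphXn. Qed.

Lemma sqmean_ge0 f : tame f -> 0 <= sqmean f.
Proof.
move=> gf; have := @le_cE R N mu (fun=> 0) _ (@tame_cst R N 0) (tame_norm2 gf).
rewrite (cE_cst mu_haar 0); apply => V _.
by rewrite Re_norm2 exprn_ge0// Re_norm_ge0.
Qed.

Lemma le_absmean f g : tame f -> tame g ->
  (forall V, V \is unitarymx -> `|f V| <= `|g V|) -> absmean f <= absmean g.
Proof.
move=> gf gg fg; apply: le_cE; [exact: tame_norm|exact: tame_norm|].
by move=> V /fg; rewrite lecE => /andP[].
Qed.

Lemma absmeanD f g : tame f -> tame g ->
  absmean (fun V => f V + g V) <= absmean f + absmean g.
Proof.
move=> gf gg; have nf := tame_norm gf; have ng := tame_norm gg.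
rewrite /absmean -cReD -cED//; apply: le_cE.
- exact: tame_norm (tameD gf gg).
- exact: tameD.
- by move=> V _; have := ler_normD (f V) (g V); rewrite lecE => /andP[].
Qed.

Lemma absmeanN f : absmean (fun V => - f V) = absmean f.
Proof.
by rewrite /absmean; congr complex.Re; apply: eq_cE => V _; rewrite normrN.
Qed.

Lemma absmeanZ c f : tame f ->
  absmean (fun V => c * f V) = complex.Re `|c| * absmean f.
Proof.
move=> gf; have nf := tame_norm gf.
rewrite /absmean (@eq_cE _ _ mu _ (fun V => `|c| * `|f V|)); last first.
  by move=> V _; rewrite normrM.
by rewrite cEZ// normc_ReE cReZ.
Qed.

Lemma absmean_cst c : absmean (fun=> c) = complex.Re `|c|.
Proof. by rewrite /absmean cE_cst. Qed.

Lemma absmean_sum (I : Type) (r : seq I) (F : I -> M -> C) :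
  (forall i, tame (F i)) ->
  absmean (fun V => \sum_(i <- r) F i V) <= \sum_(i <- r) absmean (F i).
Proof.
move=> gF; elim: r => [|i r IH].
  under [X in absmean X]eq_fun do rewrite big_nil.
  by rewrite absmean_cst normr0 big_nil.
under [X in absmean X]eq_fun do rewrite big_cons.
rewrite big_cons; apply: le_trans (absmeanD (gF i) (tame_sum _ _ gF)) _.
by rewrite lerD2l.
Qed.

Lemma le_Re_cE f : tame f -> `|complex.Re (cE f)| <= absmean f.
Proof.
move=> gf; apply: le_norm_Re_cE => //; first exact: tame_norm.
by move=> V _; exact: normr_Re.
Qed.

Lemma absmeanM f g : tame f -> tame g ->
  absmean (fun V => f V * g V) <= (sqmean f + sqmean g) / 2.
Proof.
move=> gf gg; have nf := tame_norm2 gf; have ng := tame_norm2 gg.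
have -> : (sqmean f + sqmean g) / 2 =
    complex.Re (cE (fun V => 2^-1%:C * (`|f V| ^+ 2 + `|g V| ^+ 2))).
  rewrite cEZ//; last exact: tameD.
  by rewrite cED// cReZ mulrC cReD.
apply: le_cE.
- exact: tame_norm (tameM gf gg).
- by apply: tameM; [exact: tame_cst|exact: tameD].
move=> V _; rewrite normrM (normc_ReE (f V)) (normc_ReE (g V)).
set a := complex.Re `|f V|; set b := complex.Re `|g V|.
rewrite -!rmorphXn -rmorphD -!rmorphM/=.
have := sqr_ge0 (a - b); nra.
Qed.

(** Arithmetic-geometric mean inequality in place of Cauchy-Schwarz; the free
    parameter [e] is chosen afterwards *)
Lemma absmean_sqmean f (e : R) : 0 < e -> tame f ->
  absmean f <= (e + sqmean f / e) / 2.
Proof.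
move=> e0 gf; have nf := tame_norm2 gf.
have -> : (e + sqmean f / e) / 2 =
    complex.Re (cE (fun V => (e / 2)%:C + ((e * 2)^-1)%:C * `|f V| ^+ 2)).
  have ge : tame (fun V : M => ((e * 2)^-1)%:C * `|f V| ^+ 2).
    by apply: tameM => //; exact: tame_cst.
  rewrite cED//; last exact: tame_cst.
  rewrite cE_cst// cEZ// cReD cReZ -/(sqmean f).
  move: (sqmean f) => x; rewrite -[complex.Re (e / 2)%:C]/(e / 2).
  by field; rewrite gt_eqF.
apply: le_cE.
- exact: tame_norm.
- by apply: tameD; [exact: tame_cst|apply: tameM => //; exact: tame_cst].
move=> V _; rewrite (normc_ReE (f V)).
set a := complex.Re `|f V|; rewrite -rmorphXn -!rmorphM -rmorphD/=.
rewrite -subr_ge0 (_ : _ - a = (e * 2)^-1 * (e - a) ^+ 2).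
  by rewrite mulr_ge0 ?sqr_ge0// invr_ge0 mulr_ge0// ltW.
by field; rewrite gt_eqF.
Qed.

End SecondMoment.

(** * Characteristic function of a block *)

Lemma scaled_addcJ (R : realType) (s r th : R) (z : R[i]) :
  (s * r / 2)%:C * (z + z^*%C) + th%:C = (s * (r * complex.Re z) + th)%:C.
Proof. by case: z => a b; apply: complexRI => /=; field. Qed.

(** The derivative of [2 Re Tr (B V^* T V)] in the direction [V B V^* T],
    written with [p x p] blocks only *)
Lemma block_products (C : numClosedFieldType) n p (t : 'I_p -> 'I_n)
    (A : 'M[C]_p) (T V : 'M[C]_n) : injective t ->
  let B := inflate t A in
  \tr (B *m (cj T V *m B *m cj T V - B *m cj (T *m T) V))
  + \tr (B^t* *m (cj (T^t* ) V *m B *m cj T V - B *m cj (T *m T^t* ) V))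
  = - (\tr (A *m A *m compress t (cj (T *m T) V))
       + \tr (A^t* *m A *m compress t (cj (T *m T^t* ) V))
       - \tr (A *m compress t (cj T V) *m A *m compress t (cj T V))
       - \tr (A^t* *m compress t (cj (T^t* ) V) *m A *m compress t (cj T V))).
Proof.
move=> t_inj B.
move: (cj T V) (cj (T *m T) V) (cj (T^t* ) V) (cj (T *m T^t* ) V) => Q Q2 Q' Q3.
have trB (P Q : 'M[C]_n) : \tr (P - Q) = \tr P - \tr Q := raddfB _ P Q.
have mulA3 (K L S U : 'M[C]_n) : K *m (L *m S *m U) = K *m L *m S *m U.
  by rewrite !mulmxA.
rewrite !mulmxBr !trB !mulA3 /B inflate_adj.
rewrite (mulmxA (inflate t A) (inflate t A)) (inflateM A A t_inj).
rewrite (mulmxA (inflate t (A^t* )) (inflate t A)) (inflateM (A^t* ) A t_inj).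
rewrite !tr_inflate !tr_inflate2.
ring.
Qed.

Section MainIdentity.
Variables (R : realType) (N : nat).
Notation C := R[i].
Notation M := 'M[C]_N.
Variable mu : probability (borel M) R.
Hypothesis mu_haar : haar_unitary mu.
Hypothesis N_gt0 : (0 < N)%N.
Local Notation cE := (@cE R N mu).
Variables (p : nat) (t : 'I_p -> 'I_N).
Hypothesis t_inj : injective t.
Variables (T : M) (A : 'M[C]_p).
Hypothesis T_tr : \tr T = 0.

Let rootN : R := Num.sqrt N%:R.

Let rootN_gt0 : 0 < rootN.
Proof. by rewrite sqrtr_gt0 ltr0n. Qed.

Let rootN_sqr : rootN ^+ 2 = N%:R.
Proof. by rewrite sqr_sqrtr. Qed.

Definition block (S : M) (V : M) : 'M[C]_p := compress t (cj S V).

Definition statistic (V : M) : R :=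
  complex.Re ((Num.sqrt N%:R : R)%:C * \tr (A *m block T V)).

(** Minus the derivative of [Tr (A m(T)) + Tr (A^* m(T^* ))] in the direction
    [V B V^* T], where [B] is the inflation of [A] *)
Definition stein_remainder (V : M) : C :=
  \tr (A *m A *m block (T *m T) V) + \tr (A^t* *m A *m block (T *m T^t*) V)
  - \tr (A *m block T V *m A *m block T V)
  - \tr (A^t* *m block (T^t*) V *m A *m block T V).

Lemma tame_block (S : M) i j : tame (fun V => block S V i j).
Proof.
by rewrite (_ : (fun V => _) = fun V => cj S V (t i) (t j));
  [exact: tame_cj_entry|apply/funext => V; rewrite mxE].
Qed.

Lemma tame_tr_block (B : 'M[C]_p) S : tame (fun V => \tr (B *m block S V)).
Proof.
by apply: tame_tr; apply: tame_mul_entry; [exact: tame_cst_entry|exact: tame_block].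
Qed.

Lemma tame_tr_block2 (B B' : 'M[C]_p) S S' :
  tame (fun V => \tr (B *m block S V *m B' *m block S' V)).
Proof.
apply: tame_tr; apply: tame_mul_entry; last exact: tame_block.
apply: tame_mul_entry; last exact: tame_cst_entry.
by apply: tame_mul_entry; [exact: tame_cst_entry|exact: tame_block].
Qed.

Lemma tame_stein_remainder : tame stein_remainder.
Proof.
apply: tameD; last by apply: tameN; exact: tame_tr_block2.
apply: tameD; last by apply: tameN; exact: tame_tr_block2.
by apply: tameD; exact: tame_tr_block.
Qed.

Let B := inflate t A.

Let phase (s theta : R) (V : M) : C :=
  (s * rootN / 2)%:C * (\tr (B *m cj T V) + \tr (B^t* *m cj (T^t*) V))
  + theta%:C.

Let tr_conj V : \tr (B^t* *m cj (T^t*) V) = (\tr (B *m cj T V))^*%R.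
Proof. by rewrite -cj_adj tr_adjM. Qed.

Let phaseE s theta V : phase s theta V = (s * statistic V + theta)%:C.
Proof.
rewrite /phase tr_conj /statistic cReZ /block -tr_inflate -/B.
exact: scaled_addcJ.
Qed.

Let Dphase (s : R) (K V : M) : C :=
  (s * rootN / 2)%:C *
  (\tr (B *m (V^t* *m T *m K *m V - V^t* *m K *m T *m V)) +
   \tr (B^t* *m (V^t* *m T^t* *m K *m V - V^t* *m K *m T^t* *m V))).

Let has_derivation_tr_cj (D S : M) :
  has_derivation (fun V => \tr (D *m cj S V))
    (fun K V => \tr (D *m (V^t* *m S *m K *m V - V^t* *m K *m S *m V))).
Proof.
have := has_derivation_tr (has_mxderivationM (@has_mxderivation_cst R N _ _ D)
  (@has_mxderivation_cj R N S)).
congr has_derivation; apply/funext => K; apply/funext => V.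
by rewrite mul0mx add0r.
Qed.

Let has_derivation_phase s theta :
  has_derivation (phase s theta) (Dphase s).
Proof.
have := has_derivationD (has_derivationM
  (@has_derivation_cst R N (s * rootN / 2)%:C)
  (has_derivationD (has_derivation_tr_cj B T)
     (has_derivation_tr_cj (B^t*) (T^t* )))) (@has_derivation_cst R N theta%:C).
congr has_derivation; apply/funext => K; apply/funext => V.
by rewrite mul0r add0r addr0.
Qed.

(** Schwinger-Dyson with [f = sin (s Y + theta)]. Two factors [sqrt N], one from
    [Y] and one from the derivative of the phase, compensate the [N] on the
    left *)
Lemma stein_main_identity (s theta : R) :
  iE mu (fun V => statistic V * sin (s * statistic V + theta)) =
  s / 2 * complex.Re (cE (fun V =>
    (cos (s * statistic V + theta))%:C * stein_remainder V)).
Proof.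
have phase_real V : complex.Im (phase s theta V) = 0 by rewrite phaseE.
have dF := has_derivation_sin phase_real (has_derivation_phase s theta).
have SD := schwinger_dyson mu_haar B T dF.
have gsin : tame (fun V => (sin (complex.Re (phase s theta V)))%:C) by case: dF.
have gtr : tame (fun V => \tr (B *m cj T V)).
  by case: (has_derivation_tr_cj B T).
have gst := tameM gtr gsin.
have gph : tame (phase s theta) by case: (has_derivation_phase s theta).
have gcos := tame_comp (@continuous_cos R) (@cos_norm_le1 R) gph.
have gcr := tameM gcos tame_stein_remainder.
have lhsE : iE mu (fun V => statistic V * sin (s * statistic V + theta)) =
    complex.Re (rootN%:C * cE (fun V =>
      \tr (B *m cj T V) * (sin (complex.Re (phase s theta V)))%:C)).
  rewrite -cEZ// Re_cE; congr (iE mu); apply/funext => V.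
  rewrite phaseE mulrA [in RHS]mulrC cReZ mulrC; congr (_ * _).
  by rewrite /statistic /block -tr_inflate.
have rhsE : cE (fun V => (cos (complex.Re (phase s theta V)))%:C *
    Dphase s (V *m B *m V^t* *m T) V) =
    - ((s * rootN / 2)%:C * cE (fun V =>
      (cos (s * statistic V + theta))%:C * stein_remainder V)).
  have gcr' : tame (fun V => (cos (s * statistic V + theta))%:C * stein_remainder V).
    by move: gcr; under eq_fun do rewrite phaseE.
  have gn : tame (fun V => - (cos (s * statistic V + theta))%:C * stein_remainder V).
    by under eq_fun do rewrite mulNr; exact: tameN.
  rewrite -mulrN -cEN// -cEZ; last exact: tameN.
  apply: eq_cE => V VU; rewrite phaseE /Dphase !cj_commutator// (block_products A T V t_inj) -/(stein_remainder V).
  by rewrite !mulrN mulrCA.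
move: SD; rewrite T_tr mulr0 mul0r sub0r rhsE opprK => SD.
rewrite lhsE; move: SD; set X := cE _; set Y := cE _ => SD.
have NE : (N%:R : C) = rootN%:C * rootN%:C.
  by rewrite -rmorphM -expr2 rootN_sqr rmorph_nat.
have r0 : rootN%:C != 0.
  by apply/eqP => -[] /eqP; rewrite gt_eqF.
have -> : rootN%:C * X = (s / 2)%:C * Y; last by rewrite cReZ.
apply: (mulfI r0); rewrite mulrA -NE SD !mulrA -rmorphM; congr (_%:C * _).
by ring.
Qed.

End MainIdentity.

Lemma tr_centered (C : numClosedFieldType) n (S : 'M[C]_n) : (0 < n)%N ->
  \tr (S - (\tr S / n%:R)%:M) = 0.
Proof.
move=> n0; rewrite raddfB/= mxtrace_scalar -[X in _ - X]mulr_natr divfK ?subrr//.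
by rewrite pnatr_eq0 -lt0n.
Qed.

(** Removing the trace is an orthogonal projection *)
Lemma tr_centered_sq (C : numClosedFieldType) n (S : 'M[C]_n)
    (S0 := S - (\tr S / n%:R)%:M) : (0 < n)%N ->
  \tr (S0 *m S0^t*) <= \tr (S *m S^t*).
Proof.
move=> n0; have nN : (n%:R : C) != 0 by rewrite pnatr_eq0 -lt0n.
set c := \tr S / n%:R.
have adjE : S0^t* = S^t* - (c^*%R)%:M.
  by rewrite /S0 raddfB/= map_mxB tr_scalar_mx map_scalar_mx.
have S0c : \tr (S0 *m (c^*%R)%:M) = 0.
  by rewrite mul_mx_scalar mxtraceZ tr_centered// mulr0.
rewrite adjE mulmxBr raddfB/= S0c subr0 /S0 mulmxBl raddfB/= lerBlDr lerDl.
rewrite mul_scalar_mx mxtraceZ tr_adj /c mulrAC -normCK.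
by rewrite divr_ge0// exprn_ge0.
Qed.

Lemma tr_mulB_scalar (K : comNzRingType) n (B Q : 'M[K]_n) c :
  \tr (B *m (Q - c%:M)) = \tr (B *m Q) - \tr B * c.
Proof. by rewrite mulmxBr raddfB/= mul_mx_scalar mxtraceZ mulrC. Qed.

Lemma regroup_remainder (K : comNzRingType) (a b c d e f : K) :
  a + b - c - d - (e + f) = (a - e) + (b - f) + - (c + d).
Proof. ring. Qed.

Section RemainderEstimate.
Variables (R : realType) (N : nat).
Notation C := R[i].
Notation M := 'M[C]_N.
Variable mu : probability (borel M) R.
Hypothesis mu_haar : haar_unitary mu.
Hypothesis N_gt0 : (0 < N)%N.
Local Notation cE := (@cE R N mu).
Local Notation absmean := (@absmean R N mu).
Local Notation sqmean := (@sqmean R N mu).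
Variables (p : nat) (t : 'I_p -> 'I_N).
Hypothesis t_inj : injective t.
Implicit Types (S T : M) (A B : 'M[C]_p).

Definition mxabs m n (B : 'M[C]_(m, n)) : R := \sum_i \sum_j complex.Re `|B i j|.

Lemma absmean_tr (B : 'M[C]_p) (F : M -> 'M[C]_p) (b : R) :
  (forall i j, tame (fun V => F V i j)) ->
  (forall i j, absmean (fun V => F V i j) <= b) ->
  absmean (fun V => \tr (B *m F V)) <= mxabs B * b.
Proof.
move=> gF Fb.
have gBF i j : tame (fun V => B i j * F V j i).
  by apply: tameM; [exact: tame_cst|exact: gF].
have -> : (fun V => \tr (B *m F V)) = fun V => \sum_i \sum_j B i j * F V j i.
  by apply/funext => V; apply: eq_bigr => i _; rewrite mxE.
apply: (le_trans (absmean_sum mu_haar _ _)).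
  by move=> i; apply: tame_sum => j; exact: gBF.
rewrite mulr_suml; apply: ler_sum => i _.
apply: (le_trans (absmean_sum mu_haar _ _)); first by move=> j; exact: gBF.
rewrite mulr_suml; apply: ler_sum => j _.
by rewrite absmeanZ// ler_wpM2l// Re_norm_ge0.
Qed.

Lemma absmean_tr_quad (B B' : 'M[C]_p) S S' (b : R) :
  (forall i j, sqmean (fun V => block t S V i j) <= b) ->
  (forall i j, sqmean (fun V => block t S' V i j) <= b) ->
  absmean (fun V => \tr (B *m block t S V *m B' *m block t S' V)) <=
    mxabs B * (mxabs B' * b).
Proof.
move=> Sb S'b.
have -> : (fun V => \tr (B *m block t S V *m B' *m block t S' V)) =
    fun V => \tr (B *m (block t S V *m B' *m block t S' V)).
  by apply/funext => V; rewrite !mulmxA.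
apply: absmean_tr => i j.
  apply: tame_mul_entry; last by move=> *; exact: tame_block.
  by apply: tame_mul_entry => *; [exact: tame_block|exact: tame_cst_entry].
pose F l k V := B' k l * (block t S V i k * block t S' V l j).
have gF l k : tame (F l k).
  by apply: tameM; [exact: tame_cst|apply: tameM; exact: tame_block].
have -> : (fun V => (block t S V *m B' *m block t S' V) i j) =
    fun V => \sum_l \sum_k F l k V.
  apply/funext => V; rewrite mxE; apply: eq_bigr => l _.
  by rewrite mxE mulr_suml; apply: eq_bigr => k _; rewrite /F mulrCA mulrA.
apply: (le_trans (absmean_sum mu_haar _ _)).
  by move=> l; apply: tame_sum => k; exact: gF.
rewrite [mxabs B']exchange_big/= mulr_suml; apply: ler_sum => l _.
apply: (le_trans (absmean_sum mu_haar _ _)); first by move=> k; exact: gF.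
rewrite mulr_suml; apply: ler_sum => k _.
rewrite absmeanZ//; last by apply: tameM; exact: tame_block.
apply: ler_wpM2l; first exact: Re_norm_ge0.
apply: (le_trans (absmeanM mu (tame_block t S i k) (tame_block t S' l j))).
by rewrite ler_pdivrMr// mulr_natr mulr2n lerD.
Qed.

Let N_gt0R : 0 < (N%:R : R). Proof. by rewrite ltr0n. Qed.

(** One entry is bounded by the sum over the block, all terms being
    nonnegative *)
Lemma sqmean_block S (k : R) i j : \tr S = 0 ->
  complex.Re (\tr (S *m S^t*)) <= N%:R * k ->
  sqmean (fun V => block t S V i j) <= p%:R ^+ 2 * k / N%:R.
Proof.
move=> trS Sk; have := second_moment mu_haar t trS.
pose F i j := sqmean (fun V => cj S V (t i) (t j)) * N%:R ^+ 2.
rewrite -[X in X <= _]/(\sum_i \sum_j F i j) => sumF.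
have F0 i' j' : 0 <= F i' j'.
  by apply: mulr_ge0; [apply: sqmean_ge0 => //; exact: tame_cj_entry|rewrite exprn_ge0].
have Fij : F i j <= \sum_i \sum_j F i j.
  rewrite (bigD1 i)//= (bigD1 j)//= -addrA lerDl addr_ge0//.
    by apply: sumr_ge0.
  by apply: sumr_ge0 => i' _; apply: sumr_ge0.
have -> : sqmean (fun V => block t S V i j) = F i j / N%:R ^+ 2.
  rewrite /F mulfK; last by rewrite expf_neq0// gt_eqF.
  by congr sqmean; apply/funext => V; rewrite mxE.
rewrite ler_pdivrMr ?exprn_gt0//; apply: (le_trans Fij).
apply: (le_trans sumF).
rewrite [leRHS](_ : _ = p%:R ^+ 2 * (N%:R * k)); last first.
  by field; rewrite gt_eqF.
by rewrite ler_wpM2l// exprn_ge0.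
Qed.

(** After removal of the mean [Tr S / N] the entries of the block have second
    moment [O(1/N)] by [sqmean_block] *)
Lemma absmean_block S c (k : R) i j :
  complex.Re (\tr (S *m S^t*)) <= N%:R * k ->
  absmean (fun V => (block t S V - c%:M) i j) <=
    (1 + p%:R ^+ 2 * k) / (2 * Num.sqrt N%:R) + complex.Re `|\tr S / N%:R - c|.
Proof.
move=> Sk; pose m := \tr S / N%:R; pose S0 := S - m%:M.
have S0k : complex.Re (\tr (S0 *m S0^t*)) <= N%:R * k.
  apply: le_trans Sk; have := tr_centered_sq S N_gt0.
  by rewrite lecE => /andP[].
have trS0 : \tr S0 = 0 := tr_centered S N_gt0.
have gS0 := tame_block t S0 i j.
have gc : tame (fun _ : M => ((m - c)%:M : 'M[C]_p) i j) by exact: tame_cst.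
have -> : absmean (fun V => (block t S V - c%:M) i j) =
    absmean (fun V => block t S0 V i j + ((m - c)%:M : 'M[C]_p) i j).
  congr complex.Re; apply: eq_cE => V VU; congr (`|_|).
  rewrite /block /S0 cjB compressB cj_scalar// compress_scalar//.
  by rewrite !mxE mulrnBl addrA subrK.
apply: (le_trans (absmeanD mu gS0 gc)); apply: lerD; last first.
  rewrite absmean_cst// mxE; case: (i == j); first by rewrite mulr1n.
  by rewrite mulr0n normr0; exact: Re_norm_ge0.
have r0 : 0 < Num.sqrt (N%:R : R) by rewrite sqrtr_gt0.
(* [e = 1 / sqrt N] balances the two terms of [absmean_sqmean]. *)
have e0 : 0 < (Num.sqrt (N%:R : R))^-1 by rewrite invr_gt0.
apply: (le_trans (absmean_sqmean mu_haar e0 gS0)).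
have := sqmean_block i j trS0 S0k; set q := sqmean _ => qb.
rewrite invrK invfM [2^-1 * _]mulrC mulrA ler_wpM2r ?invr_ge0//.
rewrite mulrDl mul1r lerD2l.
have -> : p%:R ^+ 2 * k / Num.sqrt N%:R = p%:R ^+ 2 * k / N%:R * Num.sqrt N%:R.
  rewrite -{2}(@sqr_sqrtr _ N%:R)// expr2 invfM mulrA mulfVK//.
  by rewrite gt_eqF.
by rewrite ler_wpM2r// ltW.
Qed.

(** The two linear terms concentrate at [tau] and [sigma] by [absmean_block];
    the two quadratic terms are products of centred blocks and are
    [O(1/N)] *)
Lemma remainder_bound T A (tau sigma : C) (k2 k4 : R) : \tr T = 0 ->
  complex.Re (\tr (T *m T^t*)) <= N%:R * k2 ->
  complex.Re (\tr ((T *m T) *m (T *m T)^t*)) <= N%:R * k4 ->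
  complex.Re (\tr ((T *m T^t*) *m (T *m T^t*)^t*)) <= N%:R * k4 ->
  absmean (fun V => stein_remainder t T A V
             - (\tr (A *m A) * tau + \tr (A^t* *m A) * sigma)) <=
  mxabs (A *m A) * ((1 + p%:R ^+ 2 * k4) / (2 * Num.sqrt N%:R)
                    + complex.Re `|\tr (T *m T) / N%:R - tau|)
  + mxabs (A^t* *m A) * ((1 + p%:R ^+ 2 * k4) / (2 * Num.sqrt N%:R)
                    + complex.Re `|\tr (T *m T^t*) / N%:R - sigma|)
  + (mxabs A * mxabs A + mxabs (A^t*) * mxabs A) * (p%:R ^+ 2 * k2 / N%:R).
Proof.
move=> trT Tk2 Tk4 Tk4'.
have trT' : \tr (T^t*) = 0 by rewrite tr_adj trT rmorph0.
have Tk2' : complex.Re (\tr (T^t* *m (T^t*)^t*)) <= N%:R * k2.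
  suff -> : \tr (T^t* *m (T^t*)^t*) = \tr (T *m T^t*) by [].
  have -> : (T^t*)^t* = T by rewrite -map_trmx map_mxCK trmxK.
  exact: mxtrace_mulC.
pose f1 V := \tr (A *m A *m (block t (T *m T) V - tau%:M)).
pose f2 V := \tr (A^t* *m A *m (block t (T *m T^t*) V - sigma%:M)).
pose f3 V := \tr (A *m block t T V *m A *m block t T V).
pose f4 V := \tr (A^t* *m block t (T^t*) V *m A *m block t T V).
have gb S c i j : tame (fun V => (block t S V - c%:M) i j).
  have E : (fun V => (block t S V - c%:M) i j) =
      fun V => block t S V i j + - (c%:M : 'M[C]_p) i j.
    have mxB (P Q : 'M[C]_p) : (P - Q) i j = P i j - Q i j by rewrite !mxE.
    by apply/funext => V; exact: mxB.
  by rewrite E; apply: tameD; [exact: tame_block|exact: tame_cst].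
have gf B S c : tame (fun V => \tr (B *m (block t S V - c%:M))).
  by apply: tame_tr; apply: tame_mul_entry; [exact: tame_cst_entry|exact: gb].
have gf1 : tame f1 := gf _ _ _; have gf2 : tame f2 := gf _ _ _.
have gf3 : tame f3 := tame_tr_block2 t A A T T.
have gf4 : tame f4 := tame_tr_block2 t (A^t*) A (T^t*) T.
have -> : (fun V => stein_remainder t T A V
    - (\tr (A *m A) * tau + \tr (A^t* *m A) * sigma)) =
    fun V => f1 V + f2 V + - (f3 V + f4 V).
  apply/funext => V; rewrite /f1 /f2 !tr_mulB_scalar.
  exact: regroup_remainder.
apply: (le_trans (absmeanD mu (tameD gf1 gf2) (tameN (tameD gf3 gf4)))).
rewrite absmeanN; apply: lerD.
  apply: (le_trans (absmeanD mu gf1 gf2)); apply: lerD.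
    by apply: absmean_tr => // i j; exact: absmean_block.
  by apply: absmean_tr => // i j; exact: absmean_block.
apply: (le_trans (absmeanD mu gf3 gf4)); rewrite mulrDl.
apply: lerD; rewrite -[_ * _ * (_ / _)]mulrA.
  by apply: absmean_tr_quad => i j; exact: sqmean_block.
by apply: absmean_tr_quad => i j; exact: sqmean_block.
Qed.

End RemainderEstimate.

Section CharFunEstimate.
Variables (R : realType) (N : nat).
Notation C := R[i].
Notation M := 'M[C]_N.
Variable mu : probability (borel M) R.
Hypothesis mu_haar : haar_unitary mu.
Hypothesis N_gt0 : (0 < N)%N.
Local Notation cE := (@cE R N mu).
Variables (p : nat) (t : 'I_p -> 'I_N).
Hypothesis t_inj : injective t.

Lemma tame_statistic (T : M) (A : 'M[C]_p) :
  tame (fun V => (statistic t T A V)%:C).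
Proof.
have gf : tame (fun V => (Num.sqrt N%:R : R)%:C * \tr (A *m block t T V)).
  by apply: tameM; [exact: tame_cst|exact: tame_tr_block].
have [cf [B fB]] := gf; split.
  move=> V; apply: (@continuous_comp _ _ _ (statistic t T A) (fun x : R => x%:C) V).
    exact: (cfun_Re cf).
  exact: continuous_real_complex.
exists B => V /fB; apply: le_trans.
by rewrite norm_realc [leRHS]normc_ReE lecR normr_Re.
Qed.

(** With [g s = E cos (s Y + theta)], the main identity reads
    [g' s = - s/2 Re E (cos (s Y + theta) W)], and replacing [W] by the constant
    [c] costs [e / 2] because the cosine is bounded by one *)
Lemma charfun_estimate (T : M) (A : 'M[C]_p) (c : C) (e theta : R) :
  \tr T = 0 ->
  absmean mu (fun V => stein_remainder t T A V - c) <= e ->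
  `|iE mu (fun V => cos (statistic t T A V + theta))
     - cos theta * expR (- (complex.Re c / 2) / 2)| <=
  e / 2 * expR `|complex.Re c / 2|.
Proof.
move=> trT Pe; set Y := statistic t T A.
have gY : tame (fun V => (Y V)%:C) := tame_statistic T A.
have glin s : tame (fun V => s%:C * (Y V)%:C + theta%:C).
  by apply: tameD; [apply: tameM => //|]; exact: tame_cst.
have linE s V : complex.Re (s%:C * (Y V)%:C + theta%:C) = s * Y V + theta.
  by rewrite cReD cReZ.
have gcos s : tame (fun V => (cos (s * Y V + theta))%:C).
  have := tame_comp (@continuous_cos R) (@cos_norm_le1 R) (glin s).
  by under eq_fun do rewrite linE.
have gsin s : tame (fun V => (sin (s * Y V + theta))%:C).
  have := tame_comp (@continuous_sin R) (@sin_norm_le1 R) (glin s).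
  by under eq_fun do rewrite linE.
have gYsin s : tame (fun V => (Y V * sin (s * Y V + theta))%:C).
  rewrite (_ : (fun V => _) = fun V => (Y V)%:C * (sin (s * Y V + theta))%:C).
    exact: (tameM gY (gsin s)).
  by apply/funext => V; rewrite rmorphM.
pose g s := iE mu (fun V => cos (s * Y V + theta)).
pose d s := - iE mu (fun V => Y V * sin (s * Y V + theta)).
have [B B0 YB] := tame_bound gY.
have gE s : g s = complex.Re (cE (fun V => (cos (s * Y V + theta))%:C)) by [].
have dE s : d s = - complex.Re (cE (fun V => (Y V * sin (s * Y V + theta))%:C)) by [].
have g_taylor s h : `|g (s + h) - g s - h * d s| <= B ^+ 2 * h ^+ 2.
  have gAB := tameD (gcos (s + h)) (tameN (gcos s)).
  have ghC := tameM (@tame_cst R N h%:C) (gYsin s).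
  rewrite !gE dE mulrN opprK -cReZ -cReN -!cReD -(cEZ mu h%:C (gYsin s)).
  rewrite -(cEN mu (gcos s)) -(cED mu (gcos (s + h)) (tameN (gcos s))).
  rewrite -(cED mu gAB ghC).
  rewrite -[leRHS]/(complex.Re (B ^+ 2 * h ^+ 2)%:C) -(cE_cst mu_haar (B ^+ 2 * h ^+ 2)%:C).
  apply: le_norm_Re_cE; last move=> V VU.
  - exact: tameD gAB ghC.
  - exact: tame_cst.
  rewrite cReD cReD cReZ cReN !/(complex.Re _%:C) /=.
  have := cos_taylor (s * Y V + theta) ((s + h) * Y V + theta).
  have -> : (s + h) * Y V + theta - (s * Y V + theta) = h * Y V by ring.
  rewrite -[h * Y V * _]mulrA => /le_trans; apply.
  rewrite exprMn mulrC ler_wpM2r ?sqr_ge0// -[X in X <= _]real_normK ?num_real//.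
  rewrite lerXn2r ?nnegrE// -lecR -norm_realc; exact: YB.
have d_ode s : 0 <= s <= 1 -> `|d s + complex.Re c / 2 * s * g s| <= e / 2.
  move=> /andP[s0 s1].
  rewrite /d (stein_main_identity mu_haar N_gt0 t_inj A trT) gE -/Y.
  have gr := tame_stein_remainder t T A.
  have grc : tame (fun V => stein_remainder t T A V - c).
    by apply: tameD => //; exact: tame_cst.
  have gcr := tameM (gcos s) grc.
  have -> : cE (fun V => (cos (s * Y V + theta))%:C * stein_remainder t T A V) =
      cE (fun V => (cos (s * Y V + theta))%:C * (stein_remainder t T A V - c))
      + c * cE (fun V => (cos (s * Y V + theta))%:C).
    rewrite -cEZ// -cED//; last by apply: tameM => //; exact: tame_cst.
    by apply: eq_cE => V _; ring.
  set E1 := cE _; set E2 := cE _.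
  have E2r : complex.Im E2 = 0.
    by have -> : E2 = (complex.Re E2)%:C by apply: cE_real.
  rewrite cReD [complex.Re (c * E2)]cReM E2r mulr0 subr0.
  have -> : - (s / 2 * (complex.Re E1 + complex.Re c * complex.Re E2))
    + complex.Re c / 2 * s * complex.Re E2 = - (s / 2 * complex.Re E1) by ring.
  rewrite normrN normrM ger0_norm ?divr_ge0// mulrC.
  have E1e : `|complex.Re E1| <= e.
    apply: le_trans Pe; apply: le_trans (le_Re_cE mu gcr) _.
    apply: (le_absmean mu gcr grc) => V VU.
    rewrite normrM ler_piMl// norm_realc -[1]/(1%:C) lecR.
    exact: cos_norm_le1.
  apply: ler_pM => //; first by rewrite divr_ge0.
  by rewrite ler_piMl// invr_ge0.
have := gaussian_ode g_taylor d_ode.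
have -> : g 1 = iE mu (fun V => cos (Y V + theta)).
  by congr iE; apply/funext => V; rewrite mul1r.
have -> : g 0 = cos theta; last by [].
rewrite gE (_ : (fun V => _) = fun=> (cos theta)%:C); last first.
  by apply/funext => V; rewrite mul0r add0r.
by rewrite cE_cst.
Qed.

End CharFunEstimate.

(** * The Gaussian limit matrix *)

Section MeasurableVector.
Context {R : realType} d (Omega : measurableType d) (m : nat).
Notation RR := (measurableTypeR R).

Definition row_of (Z : 'I_m -> Omega -> R) (w : Omega) : 'rV[R]_m := \row_i Z i w.

(** An open set is a countable union of boxes with rational end points, and
    the preimage of a box is a finite intersection *)
Lemma measurable_row (Z : 'I_m -> Omega -> RR) :
  (forall i, measurable_fun setT (Z i)) ->
  measurable_fun setT (row_of Z : Omega -> borel 'rV[R]_m).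
Proof.
move=> mZ.
apply: (@measurability _ _ Omega (borel 'rV[R]_m) setT _ (@open 'rV[R]_m)) => //.
move=> _ [ O oO <-]; rewrite setTI.
pose box (q : {ffun 'I_m -> rat * rat}) : set 'rV[R]_m :=
  [set x | forall i, ratr (q i).1 < x 0 i < ratr (q i).2].
pose F q : set Omega := if `[< box q `<=` O >] then row_of Z @^-1` box q else set0.
have -> : row_of Z @^-1` O = \bigcup_q F q.
  apply/seteqP; split => w /=; last first.
    by move=> [q _]; rewrite /F; case: asboolP => // qO wq; exact: qO.
  move=> Ow; have /nbhs_ballP[e /= e0 eO] := open_nbhs_nbhs (conj oO Ow).
  have /choice[q qP] : forall i, exists q : rat * rat,
      [/\ Z i w - e < ratr q.1, ratr q.1 < Z i w, Z i w < ratr q.2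
        & ratr q.2 < Z i w + e].
    move=> i.
    have [|q1 q1P] := @rat_in_itvoo R (Z i w - e) (Z i w); first by rewrite ltrBlDr ltrDl.
    have [|q2 q2P] := @rat_in_itvoo R (Z i w) (Z i w + e); first by rewrite ltrDl.
    move: q1P q2P; rewrite !in_itv /= => /andP[? ?] /andP[? ?].
    by exists (q1, q2).
  exists [ffun i => q i] => //; rewrite /F; case: asboolP => [_|[]].
    by move=> i; rewrite ffunE mxE; have [_ -> -> _] := qP i.
  move=> x xq; apply: eO; split => // i j; rewrite ord1 mxE -ball_normE /=.
  have [q1 _ _ q2] := qP j; have := xq j; rewrite ffunE => /andP[x1 x2].
  by rewrite ltr_norml; apply/andP; split; lra.
apply: countable_bigcupT_measurable => // q; rewrite /F.
case: asboolP => // _.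
have -> : row_of Z @^-1` box q =
    \bigcap_(i in [set: 'I_m]) (Z i @^-1` `]ratr (q i).1, ratr (q i).2[%classic).
  apply/seteqP; split => w /= wP i.
    by move=> _; rewrite /= in_itv /=; have := wP i; rewrite mxE.
  by have := wP i I; rewrite /= in_itv /= mxE.
apply: fin_bigcap_measurable; first exact: finite_finset.
move=> i _; rewrite -[X in measurable X]setTI; apply: mZ => //.
Qed.

End MeasurableVector.

Section GramTrace.
Variables (C : numClosedFieldType) (p m : nat).
Variables (g : 'I_p -> 'I_p -> 'I_m -> C) (sigma tau : C).
Hypothesis g_gram : forall i j k l,
  \sum_q g i j q * g k l q = (i == l)%:R * (j == k)%:R * tau /\
  \sum_q g i j q * Num.conj (g k l q) = (i == k)%:R * (j == l)%:R * sigma.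
Variable A : 'M[C]_p.

(** The coordinates of [Tr (A G)] on the underlying standard normal family *)
Definition trace_coefficient (q : 'I_m) : C := \sum_i \sum_j A i j * g j i q.

Let sum_mul (a b : 'I_p -> 'I_p -> C) (f h : 'I_p -> 'I_p -> 'I_m -> C) :
  \sum_q (\sum_i \sum_j a i j * f i j q) * (\sum_k \sum_l b k l * h k l q) =
  \sum_i \sum_j \sum_k \sum_l a i j * b k l * (\sum_q f i j q * h k l q).
Proof.
under eq_bigr => q _ do rewrite mulr_suml.
rewrite exchange_big /=; apply: eq_bigr => i _.
under eq_bigr => q _ do rewrite mulr_suml.
rewrite exchange_big /=; apply: eq_bigr => j _.
under eq_bigr => q _ do rewrite mulr_sumr.
rewrite exchange_big /=; apply: eq_bigr => k _.
under eq_bigr => q _ do rewrite mulr_sumr.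
rewrite exchange_big /=; apply: eq_bigr => l _.
by rewrite mulr_sumr; apply: eq_bigr => q _; ring.
Qed.

Let sum_delta2 (F : 'I_p -> 'I_p -> C) i j :
  \sum_k \sum_l (k == i)%:R * (l == j)%:R * F k l = F i j.
Proof.
rewrite (bigD1 i)//= [X in _ + X]big1 ?addr0; last first.
  by move=> k /negPf->; rewrite big1// => l _; rewrite !mul0r.
rewrite (bigD1 j)//= big1 ?addr0; last first.
  by move=> l /negPf->; rewrite mulr0 mul0r.
by rewrite !eqxx !mul1r.
Qed.

Lemma trace_coefficient_square :
  \sum_q trace_coefficient q * trace_coefficient q = \tr (A *m A) * tau.
Proof.
rewrite /trace_coefficient (sum_mul A A (fun i j => g j i) (fun i j => g j i)).
rewrite /mxtrace mulr_suml; apply: eq_bigr => i _.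
rewrite mxE mulr_suml; apply: eq_bigr => j _.
under eq_bigr do under eq_bigr do rewrite (g_gram _ _ _ _).1.
rewrite -(sum_delta2 (fun k l => A i j * A k l * tau) j i).
apply: eq_bigr => k _; apply: eq_bigr => l _.
by rewrite (eq_sym j) (eq_sym i); ring.
Qed.

Lemma trace_coefficient_norm :
  \sum_q trace_coefficient q * Num.conj (trace_coefficient q) =
  \tr (A^t* *m A) * sigma.
Proof.
have conjE q : Num.conj (trace_coefficient q) =
    \sum_k \sum_l Num.conj (A k l) * Num.conj (g l k q).
  rewrite rmorph_sum; apply: eq_bigr => i _; rewrite rmorph_sum.
  by apply: eq_bigr => j _; rewrite rmorphM.
under eq_bigr do rewrite conjE.
rewrite /trace_coefficient (sum_mul A (fun k l => Num.conj (A k l))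
  (fun i j => g j i) (fun i j q => Num.conj (g j i q))).
rewrite exchange_big /mxtrace mulr_suml /=; apply: eq_bigr => j _.
rewrite mxE mulr_suml; apply: eq_bigr => i _.
under eq_bigr do under eq_bigr do rewrite (g_gram _ _ _ _).2.
rewrite !mxE -(sum_delta2 (fun k l => Num.conj (A k l) * A i j * sigma) i j).
apply: eq_bigr => k _; apply: eq_bigr => l _.
by rewrite (eq_sym j) (eq_sym i); ring.
Qed.

End GramTrace.

Section ComplexCombination.
Context {R : realType} d (Omega : measurableType d) (Q : probability Omega R) (m : nat).
Notation RR := (measurableTypeR R).
Variable Z : 'I_m -> Omega -> RR.
Hypothesis Z_std : standard_family Q Z.
Implicit Types (g h : 'I_m -> R[i]).

Definition ccombination g (w : Omega) : R[i] :=
  Complex (combination Z (fun q => complex.Re (g q)) w)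
          (combination Z (fun q => complex.Im (g q)) w).

Lemma ccombinationE g w : ccombination g w = \sum_q g q * (Z q w)%:C.
Proof.
apply: complexRI; rewrite ?Re_sum ?Im_sum /= /combination;
  apply: eq_bigr => q _; case: (g q) => a b /=; ring.
Qed.

Lemma ccombination_conj g w :
  Num.conj (ccombination g w) = ccombination (fun q => Num.conj (g q)) w.
Proof.
rewrite !ccombinationE rmorph_sum; apply: eq_bigr => q _.
rewrite rmorphM; congr (_ * _).
by apply: complexRI => /=; rewrite ?oppr0.
Qed.

Lemma ccombination_mean g : complex_mean Q (ccombination g) 0.
Proof.
by split; rewrite unlock; exact: (combination_mean Z_std _).2.
Qed.

Lemma ccombination_covariance g h :
  complex_mean Q (fun w => ccombination g w * ccombination h w) (\sum_q g q * h q).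
Proof.
pose re (f : 'I_m -> R[i]) q := complex.Re (f q).
pose im (f : 'I_m -> R[i]) q := complex.Im (f q).
have [i1 E1] := combination_covariance Z_std (re g) (re h).
have [i2 E2] := combination_covariance Z_std (im g) (im h).
have [i3 E3] := combination_covariance Z_std (re g) (im h).
have [i4 E4] := combination_covariance Z_std (im g) (re h).
split; rewrite unlock.
- transitivity (\int[Q]_w ((combination Z (re g) w * combination Z (re h) w)%:E
     - (combination Z (im g) w * combination Z (im h) w)%:E))%E; first by [].
  rewrite (integralB measurableT i1 i2) E1 E2 -EFinB Re_sum -sumrB.
  by congr _%:E; apply: eq_bigr => q _; rewrite cReM.
- transitivity (\int[Q]_w ((combination Z (re g) w * combination Z (im h) w)%:E
     + (combination Z (im g) w * combination Z (re h) w)%:E))%E; first by [].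
  rewrite (integralD measurableT i3 i4) E3 E4 -EFinD Im_sum -big_split.
  by congr _%:E; apply: eq_bigr => q _; rewrite cImM.
Qed.

(** A real linear combination of real and imaginary parts is again a real
    combination of the family *)
Lemma ccombination_gaussian (I : finType) (g : I -> 'I_m -> R[i]) :
  centered_complex_gaussian Q (fun i => ccombination (g i)).
Proof.
split=> [a b|i]; last exact: ccombination_mean.
have := combination_gaussian Z_std (fun q =>
  \sum_i (a i * complex.Re (g i q) + b i * complex.Im (g i q))).
congr gaussian_variable; apply/funext => w; rewrite /combination /=.
under eq_bigr do rewrite mulr_suml.
rewrite exchange_big; apply: eq_bigr => i _.
by rewrite !mulr_sumr -big_split; apply: eq_bigr => q _; rewrite /=; ring.
Qed.

End ComplexCombination.

Section GaussianMatrix.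
Context {R : realType} (p : nat).
Notation moment M := (\sum_i \sum_j (complex.Re ((M : 'M[R[i]]_p) i j) ^+ 2
                                     + complex.Im ((M : 'M[R[i]]_p) i j) ^+ 2)).

(** The variance of [Re Tr (A G)] is half the real part of
    [E (Tr (A G))^2 + E |Tr (A G)|^2], and the Gram identities evaluate both
    terms *)
Theorem gaussian_matrix_exists (sigma : R) (tau : R[i]) : `|tau| <= sigma%:C ->
  exists (d : measure_display) (Omega : measurableType d)
    (Q : probability Omega R) (G : {RV Q >-> borel 'M[R[i]]_p}),
    [/\ centered_complex_gaussian Q
          (fun (ij : 'I_p * 'I_p) w => (G w : 'M[R[i]]_p) ij.1 ij.2),
        forall i j k l : 'I_p,
          complex_mean Q
            (fun w => (G w : 'M[R[i]]_p) i j * (G w : 'M[R[i]]_p) k l)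
            ((i == l)%:R * (j == k)%:R * tau) /\
          complex_mean Q
            (fun w => (G w : 'M[R[i]]_p) i j
                      * Num.conj ((G w : 'M[R[i]]_p) k l))
            ((i == k)%:R * (j == l)%:R * sigma%:C),
        forall (A : 'M[R[i]]_p) theta,
          \int[Q]_w cos (complex.Re (\tr (A *m (G w : 'M[R[i]]_p))) + theta) =
          cos theta * expR (- (complex.Re
            (\tr (A *m A) * tau + \tr (A^t* *m A) * sigma%:C) / 2) / 2)
      & exists K : R, (\int[Q]_w (moment (G w))%:E <= K%:E)%E].
Proof.
move=> /(elliptic_gram p)[m [g g_gram]].
have [d [ Omega [Q [Z Z_std]]]] := @standard_family_exists R m.
pose L (x : 'rV[R]_m) : 'M[R[i]]_p :=
  \matrix_(i, j) \sum_q g i j q * (x 0 q)%:C.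
pose G w : borel 'M[R[i]]_p := L (row_of Z w).
have GE w i j : (G w : 'M[R[i]]_p) i j = ccombination Z (g i j) w.
  by rewrite mxE ccombinationE; apply: eq_bigr => q _; rewrite mxE.
have cL : continuous L.
  apply: matrix_continuous => i j.
  under eq_fun do rewrite mxE.
  apply: cfun_sum => q.
  have cg : continuous (fun _ : 'rV[R]_m => g i j q) by apply: cst_continuous.
  have cx : continuous (fun x : 'rV[R]_m => (x 0 q)%:C).
    move=> x; apply: (@continuous_comp _ _ _ (fun x : 'rV[R]_m => x 0 q) (fun u : R => u%:C) x).
      exact: coord_continuous.
    exact: continuous_real_complex.
  exact: (cfunM cg cx).
have mG : measurable_fun setT G.
  exact: measurableT_comp (borel_continuous_measurable2 cL) (measurable_row Z_std.1).
pose G' : {RV Q >-> borel 'M[R[i]]_p} :=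
  HB.pack G (isMeasurableFun.Build _ _ _ _ G mG).
exists d, Omega, Q, G'; split.
- have := ccombination_gaussian Z_std (fun ij : 'I_p * 'I_p => g ij.1 ij.2).
  congr centered_complex_gaussian; apply/funext => ij; apply/funext => w.
  exact/esym/GE.
- move=> i j k l; split.
    rewrite -(g_gram i j k l).1.
    have := ccombination_covariance Z_std (g i j) (g k l).
    by congr complex_mean; apply/funext => w; rewrite -!GE.
  rewrite -(g_gram i j k l).2.
  have := ccombination_covariance Z_std (g i j) (fun q => Num.conj (g k l q)).
  by congr complex_mean; apply/funext => w; rewrite -ccombination_conj -!GE.
- move=> A theta.
  pose H := trace_coefficient g A.
  have trE w : complex.Re (\tr (A *m (G w : 'M[R[i]]_p))) =
      combination Z (fun q => complex.Re (H q)) w.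
    transitivity (complex.Re (ccombination Z H w)); last by [].
    congr complex.Re; rewrite ccombinationE /mxtrace.
    under [RHS]eq_bigr do rewrite mulr_suml.
    rewrite exchange_big; apply: eq_bigr => i _; rewrite mxE.
    under [RHS]eq_bigr do rewrite mulr_suml.
    rewrite exchange_big; apply: eq_bigr => j _; rewrite GE ccombinationE.
    by rewrite mulr_sumr; apply: eq_bigr => q _; rewrite mulrA.
  transitivity (\int[Q]_w cos (combination Z (fun q => complex.Re (H q)) w + theta)).
    by apply: eq_Rintegral => w _; rewrite trE.
  rewrite (combination_charfun Z_std); congr (_ * expR (- _ / 2)).
  rewrite -(trace_coefficient_square g_gram) -(trace_coefficient_norm g_gram).
  rewrite -big_split Re_sum mulr_suml; apply: eq_bigr => q _.
  rewrite -/(H q); case: (H q) => a b /=.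
  by field.
- have iG i j : Q.-integrable setT (fun w =>
      (complex.Re ((G w : 'M[R[i]]_p) i j) ^+ 2 + complex.Im ((G w : 'M[R[i]]_p) i j) ^+ 2)%:E).
    have [i1 _] := combination_square Z_std (fun q => complex.Re (g i j q)).
    have [i2 _] := combination_square Z_std (fun q => complex.Im (g i j q)).
    have := integrableD measurableT i1 i2.
    by congr (_.-integrable _ _); apply/funext => w; rewrite GE.
  have iM : Q.-integrable setT (fun w => (moment (G w))%:E).
    rewrite (_ : (fun w => _) = fun w => (\sum_i \sum_j (complex.Re ((G w : 'M[R[i]]_p) i j) ^+ 2
        + complex.Im ((G w : 'M[R[i]]_p) i j) ^+ 2)%:E)%E); last first.
      apply/funext => w; rewrite -sumEFin; apply: eq_bigr => i _.
      by rewrite -sumEFin.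
    by apply: integrable_sum => // i _; apply: integrable_sum => // j _; exact: iG.
  exists (fine (\int[Q]_w (moment (G w))%:E)).
  by rewrite fineK//; exact: integrable_fin_num iM.
Qed.

End GaussianMatrix.

(** * Characteristic functions and convergence in distribution *)

Section MomentGap.
Context {R : realType} d (Omega : measurableType d) (P : probability Omega R) (m : nat).
Variable X : Omega -> borel 'rV[R]_m.
Hypothesis mX : measurable_fun setT X.
Implicit Types f g : 'rV[R]_m -> R.

Definition sqnorm2 (x : 'rV[R]_m) : R := \sum_k x 0 k ^+ 2.

Lemma sqnorm2_ge0 x : 0 <= sqnorm2 x.
Proof. by apply: sumr_ge0 => k _; exact: sqr_ge0. Qed.

Lemma continuous_sqnorm2 : continuous sqnorm2.
Proof.
apply: real_continuous_sum => k x.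
apply: (@continuous_comp _ _ _ (fun x : 'rV[R]_m => x 0 k) (fun y : R => y ^+ 2) x).
  exact: coord_continuous.
exact: exprn_continuous.
Qed.

Lemma measurable_continuous_comp f : continuous f ->
  measurable_fun setT (f \o X : Omega -> R).
Proof. by move=> cf; exact: measurableT_comp (borel_continuous_measurable cf) mX. Qed.

Lemma bounded_continuous_integrable f B : continuous f ->
  (forall x, `|f x| <= B) -> P.-integrable setT (EFin \o (f \o X)).
Proof.
move=> cf fB; apply: measurable_bounded_integrable.
- exact: measurableT.
- by rewrite (le_lt_trans (probability_le1 _ measurableT))// ltry.
- exact: measurable_continuous_comp.
- exists B; split; [exact: num_real|move=> b Bb w _ /=].
  by apply/ltW; apply: le_lt_trans Bb; exact: fB.
Qed.

(** Closeness up to a quadratic weight becomes closeness of expectations once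
    second moments are under control *)
Lemma moment_gap f g B B' e K : continuous f -> continuous g ->
  (forall x, `|f x| <= B) -> (forall x, `|g x| <= B') ->
  0 <= e -> (forall x, `|f x - g x| <= e * (1 + sqnorm2 x)) ->
  (\int[P]_w (sqnorm2 (X w))%:E <= K%:E)%E ->
  `|\int[P]_w f (X w) - \int[P]_w g (X w)| <= e * (1 + K).
Proof.
move=> cf cg fB gB e0 fg XK.
have jf := bounded_continuous_integrable cf fB.
have jg := bounded_continuous_integrable cg gB.
rewrite -(RintegralB measurableT jf jg) -lee_fin.
have jfg : P.-integrable setT (EFin \o (fun w => f (X w) - g (X w))).
  by have := integrableB measurableT jf jg.
have msq := measurable_continuous_comp continuous_sqnorm2.
have mEsq : measurable_fun setT (fun w => (sqnorm2 (X w))%:E) by exact/measurable_EFinP.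
have finI := integrable_fin_num measurableT jfg.
rewrite /Rintegral -[leLHS]/(`|(fine _)%:E|%E) fineK//.
apply: (le_trans (le_abse_integral P measurableT (measurable_int P jfg))).
apply: (@le_trans _ _ (\int[P]_w (e%:E * (1 + (sqnorm2 (X w))%:E)))%E).
  apply: ge0_le_integral => //.
  - by apply: measurableT_comp => //; exact: (measurable_int P jfg).
  - by apply: measurable_funeM; apply: emeasurable_funD.
  - by move=> w _; rewrite /= -EFinD -EFinM lee_fin; exact: fg.
rewrite ge0_integralZl//; first last.
- by move=> w _; rewrite adde_ge0// lee_fin sqnorm2_ge0.
- by apply: emeasurable_funD.
rewrite ge0_integralD//; last by move=> w _; rewrite lee_fin sqnorm2_ge0.
rewrite integral_cst// mul1e [X in (X + _)%E]probability_setT.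
by rewrite EFinM EFinD; apply: lee_wpmul2l => //; exact: leeD2l.
Qed.

End MomentGap.

Lemma real_continuousD (R : realType) (T : topologicalType) (f g : T -> R) :
  continuous f -> continuous g -> continuous (fun x => f x + g x).
Proof. by move=> cf cg x; apply: cvgD; [exact: cf|exact: cg]. Qed.

Section TrigpolyRegularity.
Variables (R : realType) (m : nat).

Lemma trigpoly_continuous (g : 'rV[R]_m -> R) : trigpoly g -> continuous g.
Proof.
elim=> {g} [a th|f g _ cf _ cg|c f _ cf] x.
- have ca : continuous (dotr a).
    apply: real_continuous_sum => k y.
    have ck : {for y, continuous (fun x : 'rV[R]_m => x 0 k)} by exact: coord_continuous.
    by apply: (@continuous_comp _ _ _ (fun x : 'rV[R]_m => x 0 k) (fun u : R => a 0 k * u) y ck);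
      exact: mulrl_continuous.
  have cc : continuous (fun u : R => cos (u + th)).
    move=> u; apply: (@continuous_comp _ _ _ (fun u : R => u + th) cos u); last exact: continuous_cos.
    by apply: cvgD; [exact: cvg_id|exact: cvg_cst].
  by apply: (@continuous_comp _ _ _ (dotr a) (fun u : R => cos (u + th)) x (ca x)); exact: cc.
- exact: (real_continuousD cf cg).
- by apply: (@continuous_comp _ _ _ f (fun u : R => c * u) x (cf x)); exact: mulrl_continuous.
Qed.

Lemma trigpoly_bounded (g : 'rV[R]_m -> R) : trigpoly g ->
  exists B, forall x, `|g x| <= B.
Proof.
elim=> {g} [a th|f g _ [B fB] _ [B' gB]|c f _ [B fB]].
- by exists 1 => x; exact: cos_norm_le1.
- exists (B + B') => x; apply: (le_trans (ler_normD _ _)).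
  by apply: lerD; [exact: fB|exact: gB].
- by exists (`|c| * B) => x; rewrite normrM ler_wpM2l.
Qed.

End TrigpolyRegularity.

Section ConvergenceCriterion.
Context {R : realType} (d : nat -> measure_display) (m : nat).
Context (Omega : forall n, measurableType (d n)) (P : forall n, probability (Omega n) R).
Context d' (Omega' : measurableType d') (Q : probability Omega' R).
Variables (X : forall n, Omega n -> borel 'rV[R]_m) (Y : Omega' -> borel 'rV[R]_m).
Arguments X : clear implicits.
Hypotheses (mX : forall n, measurable_fun setT (X n)) (mY : measurable_fun setT Y).
Arguments mX : clear implicits.
Hypothesis charfun_cvg : forall a theta,
  \int[P n]_w cos (dotr a (X n w) + theta) @[n --> \oo] -->
  \int[Q]_w cos (dotr a (Y w) + theta).
Variable K : R.
Hypotheses (X_moment : \forall n \near \oo, (\int[P n]_w (sqnorm2 (X n w))%:E <= K%:E)%E)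
  (Y_moment : (\int[Q]_w (sqnorm2 (Y w))%:E <= K%:E)%E).

Lemma trigpoly_cvg g : trigpoly g ->
  \int[P n]_w g (X n w) @[n --> \oo] --> \int[Q]_w g (Y w).
Proof.
have jX n f : trigpoly f -> (P n).-integrable setT (EFin \o (f \o X n)).
  move=> tf; have [B fB] := trigpoly_bounded tf.
  exact: (bounded_continuous_integrable _ (mX n) (trigpoly_continuous tf) fB).
have jY f : trigpoly f -> Q.-integrable setT (EFin \o (f \o Y)).
  move=> tf; have [B fB] := trigpoly_bounded tf.
  exact: (bounded_continuous_integrable _ mY (trigpoly_continuous tf) fB).
elim=> {g} [a th|f g tf cf tg cg|c f tf cf]; first exact: charfun_cvg.
- rewrite (RintegralD measurableT (jY f tf) (jY g tg)).
  under eq_fun => n do rewrite (RintegralD measurableT (jX n f tf) (jX n g tg)).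
  exact: cvgD cf cg.
- rewrite (RintegralZl c measurableT (jY f tf)).
  under eq_fun => n do rewrite (RintegralZl c measurableT (jX n f tf)).
  by apply: cvgM; [exact: cvg_cst|exact: cf].
Qed.

(** Approximate [f] by a trigonometric polynomial, uniformly in [n] by
    [moment_gap], and use the convergence of its expectation *)
Theorem cvg_in_distribution_charfun : cvg_in_distribution P (X : forall n, Omega n -> 'rV[R]_m) Q (Y : Omega' -> 'rV[R]_m).
Proof.
move=> f cf [M [_ fM]].
pose B := `|M| + 1.
have fB x : `|f x| <= B.
  by apply: (fM B) => //; rewrite /B ltr_pwDr// ler_norm.
have EX n : ('E_(P n)[f \o X n] = (\int[P n]_w f (X n w))%:E)%E.
  rewrite unlock fineK//; apply: (integrable_fin_num measurableT).
  exact: (bounded_continuous_integrable _ (mX n) cf fB).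
have EY : ('E_Q[f \o Y] = (\int[Q]_w f (Y w))%:E)%E.
  rewrite unlock fineK//; apply: (integrable_fin_num measurableT).
  exact: (bounded_continuous_integrable _ mY cf fB).
rewrite EY; under eq_fun => n do rewrite EX.
apply: cvg_EFin; first by apply: nearW => n.
apply/cvgrPdist_le => /= e e0.
have K1 : 0 < 1 + K.
  rewrite ltr_pwDl// -lee_fin; apply: le_trans Y_moment.
  by apply: integral_ge0 => w _; rewrite lee_fin sqnorm2_ge0.
pose e' := e / (3 * (1 + K)).
have e'0 : 0 < e' by rewrite divr_gt0// mulr_gt0.
have [g tg fg] := trig_approx cf fB e'0.
have cg := trigpoly_continuous tg; have [B' gB] := trigpoly_bounded tg.
have gapY := moment_gap mY cf cg fB gB (ltW e'0) fg Y_moment.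
have /cvgrPdist_le/(_ (e / 3)) := trigpoly_cvg tg.
rewrite divr_gt0// => /(_ isT) g_cvg.
near=> n.
have XK : (\int[P n]_w (sqnorm2 (X n w))%:E <= K%:E)%E by near: n.
have gapX := moment_gap (mX n) cf cg fB gB (ltW e'0) fg XK.
have gn : `|\int[Q]_w g (Y w) - \int[P n]_w g (X n w)| <= e / 3 by near: n.
have e'E : e' * (1 + K) = e / 3 by rewrite /e'; field; rewrite gt_eqF.
rewrite e'E in gapX gapY.
have -> : e = e / 3 + e / 3 + e / 3 by field.
have -> : fine (\int[Q]_w f (Y w))%:E - fine (\int[P n]_w f (X n w))%:E =
  (\int[Q]_w f (Y w) - \int[Q]_w g (Y w))
  + (\int[Q]_w g (Y w) - \int[P n]_w g (X n w))
  - (\int[P n]_w f (X n w) - \int[P n]_w g (X n w)) by rewrite /=; ring.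
apply: (le_trans (ler_normB _ _)); apply: lerD => //.
by apply: (le_trans (ler_normD _ _)); apply: lerD.
Unshelve. all: by end_near.
Qed.

End ConvergenceCriterion.

Section RealCoordinates.
Variables (R : realType) (p : nat).
Notation index := ('I_p * 'I_p * bool)%type.
Notation dim := #|{: index}|.
Implicit Types (M : 'M[R[i]]_p) (x a : 'rV[R]_dim).

Definition real_part (b : bool) (z : R[i]) : R :=
  if b then complex.Im z else complex.Re z.

Definition coordinates M : 'rV[R]_dim :=
  \row_q real_part (enum_val q).2 (M (enum_val q).1.1 (enum_val q).1.2).

Definition of_coordinates x : 'M[R[i]]_p :=
  \matrix_(i, j) Complex (x 0 (enum_rank (i, j, false))) (x 0 (enum_rank (i, j, true))).

(** Every real linear form on complex matrices is [Re Tr (A M)]; the sign and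
    the transposition come from [Re (z w)] and from the trace *)
Definition dual_matrix a : 'M[R[i]]_p :=
  \matrix_(i, j) Complex (a 0 (enum_rank (j, i, false))) (- a 0 (enum_rank (j, i, true))).

Lemma coordinatesK M : of_coordinates (coordinates M) = M.
Proof.
apply/matrixP => i j; rewrite mxE !mxE !enum_rankK /=.
by case: (M i j).
Qed.

Let sum_index (F : index -> R) :
  \sum_(q < dim) F (enum_val q) = \sum_i \sum_j (F (i, j, false) + F (i, j, true)).
Proof.
transitivity (\sum_q F q).
  by rewrite [RHS](reindex (fun q : 'I_dim => enum_val q))//; exact: onW_bij (enum_val_bij _).
transitivity (\sum_r \sum_s F (r, s)).
  by rewrite pair_bigA; apply: eq_bigr => -[].
transitivity (\sum_i \sum_j \sum_s F (i, j, s)).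
  rewrite (pair_bigA _ (fun i j => \sum_s F (i, j, s))).
  by apply: eq_bigr => -[].
by apply: eq_bigr => i _; apply: eq_bigr => j _; rewrite big_bool addrC.
Qed.

Lemma dotr_coordinates a M :
  dotr a (coordinates M) = complex.Re (\tr (dual_matrix a *m M)).
Proof.
rewrite /dotr.
under eq_bigr => q _ do rewrite mxE -[q in a 0 q](enum_valK q).
rewrite (sum_index (fun q => a 0 (enum_rank q) * real_part q.2 (M q.1.1 q.1.2))).
rewrite exchange_big /mxtrace Re_sum; apply: eq_bigr => i _.
rewrite mxE Re_sum; apply: eq_bigr => j _.
by rewrite !mxE cReM /=; ring.
Qed.

Lemma sqnorm2_coordinates M : sqnorm2 (coordinates M) =
  \sum_i \sum_j (complex.Re (M i j) ^+ 2 + complex.Im (M i j) ^+ 2).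
Proof.
rewrite /sqnorm2; under eq_bigr => q _ do rewrite mxE.
by rewrite (sum_index (fun q => real_part q.2 (M q.1.1 q.1.2) ^+ 2)).
Qed.

Lemma continuous_coordinates : continuous coordinates.
Proof.
apply: row_continuous => q; under eq_fun do rewrite mxE.
have ce := @entry_continuous R p p (enum_val q).1.1 (enum_val q).1.2.
by case: (enum_val q).2; [exact: (cfun_Im ce)|exact: (cfun_Re ce)].
Qed.

Lemma continuous_of_coordinates : continuous of_coordinates.
Proof.
apply: matrix_continuous => i j.
have cx q : continuous (fun x : 'rV[R]_dim => (x 0 q)%:C).
  move=> x; apply: (@continuous_comp _ _ _ (fun x : 'rV[R]_dim => x 0 q) (fun u : R => u%:C) x).
    exact: coord_continuous.
  exact: continuous_real_complex.
have ci : continuous (fun _ : 'rV[R]_dim => 'i : R[i]) by apply: cst_continuous.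
rewrite (_ : (fun x => _) = fun x : 'rV[R]_dim =>
    (x 0 (enum_rank (i, j, false)))%:C + 'i * (x 0 (enum_rank (i, j, true)))%:C).
  exact: (cfunD (cx (enum_rank (i, j, false))) (cfunM ci (cx (enum_rank (i, j, true))))).
apply/funext => x; rewrite mxE.
by apply: complexRI; rewrite /=; ring.
Qed.

End RealCoordinates.

Section MatrixCriterion.
Context {R : realType} (p : nat) (d : nat -> measure_display).
Context (Omega : forall n, measurableType (d n)) (P : forall n, probability (Omega n) R).
Context d' (Omega' : measurableType d') (Q : probability Omega' R).
Variables (X : forall n, Omega n -> borel 'M[R[i]]_p) (Y : Omega' -> borel 'M[R[i]]_p).
Arguments X : clear implicits.
Hypotheses (mX : forall n, measurable_fun setT (X n)) (mY : measurable_fun setT Y).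
Arguments mX : clear implicits.
Hypothesis charfun_cvg : forall (A : 'M[R[i]]_p) theta,
  \int[P n]_w cos (complex.Re (\tr (A *m X n w)) + theta) @[n --> \oo] -->
  \int[Q]_w cos (complex.Re (\tr (A *m Y w)) + theta).
Variable K : R.
Notation moment M := (\sum_i \sum_j (complex.Re ((M : 'M[R[i]]_p) i j) ^+ 2
                                     + complex.Im ((M : 'M[R[i]]_p) i j) ^+ 2)).
Hypotheses
  (X_moment : \forall n \near \oo, (\int[P n]_w (moment (X n w))%:E <= K%:E)%E)
  (Y_moment : (\int[Q]_w (moment (Y w))%:E <= K%:E)%E).

(** The criterion transported along the homeomorphism between complex
    matrices and real vectors *)
Theorem cvg_in_distribution_matrix :
  cvg_in_distribution P (X : forall n, Omega n -> 'M[R[i]]_p) Q (Y : Omega' -> 'M[R[i]]_p).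
Proof.
move=> f cf [B [Br fB]].
pose X' n w : borel 'rV[R]__ := coordinates (X n w).
pose Y' w : borel 'rV[R]__ := coordinates (Y w).
have mcoord := borel_continuous_measurable2 (@continuous_coordinates R p).
have mX' n : measurable_fun setT (X' n) := measurableT_comp mcoord (mX n).
have mY' : measurable_fun setT Y' := measurableT_comp mcoord mY.
have X'_moment : \forall n \near \oo, (\int[P n]_w (sqnorm2 (X' n w))%:E <= K%:E)%E.
  by apply: filterS X_moment => n; under eq_integral do rewrite -sqnorm2_coordinates.
have Y'_moment : (\int[Q]_w (sqnorm2 (Y' w))%:E <= K%:E)%E.
  by move: Y_moment; under eq_integral do rewrite -sqnorm2_coordinates.
have X'_cvg a theta : \int[P n]_w cos (dotr a (X' n w) + theta) @[n --> \oo] -->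
    \int[Q]_w cos (dotr a (Y' w) + theta).
  have EX n : \int[P n]_w cos (dotr a (X' n w) + theta) =
      \int[P n]_w cos (complex.Re (\tr (dual_matrix a *m X n w)) + theta).
    by apply: eq_Rintegral => w _; rewrite dotr_coordinates.
  have -> : \int[Q]_w cos (dotr a (Y' w) + theta) =
      \int[Q]_w cos (complex.Re (\tr (dual_matrix a *m Y w)) + theta).
    by apply: eq_Rintegral => w _; rewrite dotr_coordinates.
  under eq_fun => n do rewrite EX.
  exact: charfun_cvg.
have cg : continuous (fun x => f (of_coordinates x)).
  move=> x; apply: (@continuous_comp _ _ _ (@of_coordinates R p) f x).
    exact: continuous_of_coordinates.
  exact: cf.
have := cvg_in_distribution_charfun mX' mY' X'_cvg X'_moment Y'_moment cg.
have gY : (fun x => f (of_coordinates x)) \o Y' = f \o Y.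
  by apply/funext => w; rewrite /Y' /= coordinatesK.
have gX n : (fun x => f (of_coordinates x)) \o X' n = f \o X n.
  by apply/funext => w; rewrite /X' /= coordinatesK.
rewrite gY => cvg_f.
have -> : (fun n => 'E_(P n)[f \o X n])%E =
    (fun n => 'E_(P n)[(fun x => f (of_coordinates x)) \o X' n])%E.
  by apply/funext => n; rewrite gX.
by apply: cvg_f; exists B; split => // b Bb x _; exact: fB.
Qed.

End MatrixCriterion.

(** * Columns of a Haar unitary matrix *)

Lemma haar_unitaries1 (R : realType) N (mu : probability (borel 'M[R[i]]_N) R) :
  haar_unitary mu -> mu (@unitaries R N) = 1%E.
Proof. by case. Qed.

Section HaarTransfer.
Context {R : realType} (N : nat) d (Omega : measurableType d) (P : probability Omega R).
Variables (U : Omega -> borel 'M[R[i]]_N) (mu : probability (borel 'M[R[i]]_N) R).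
Hypothesis mU : measurable_fun setT U.
Hypothesis U_law : forall A : set (borel 'M[R[i]]_N), measurable A -> P (U @^-1` A) = mu A.
Hypothesis mu_haar : haar_unitary mu.
Implicit Types F : 'M[R[i]]_N -> R.

Let mUN : measurable (@unitaries R N) := @measurable_unitaries R N.

Let mu1 := haar_unitaries1 mu_haar.

Let negl : mu (~` (@unitaries R N)) = 0.
Proof. by rewrite (probability_setC mu mUN) [X in (1 - X)%E]mu1 subee. Qed.

(** The complement of the unitary matrices is negligible, and a nonnegative
    integrand may be unbounded there *)
Lemma haar_ge0_integral F : continuous F -> (forall V, 0 <= F V) ->
  (\int[P]_w (F (U w))%:E = \int[mu]_(V in @unitaries R N) (F V)%:E)%E.
Proof.
move=> cF F0; have mF := borel_continuous_measurable cF.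
have mEF : measurable_fun setT (EFin \o (F : borel 'M[R[i]]_N -> R)) by exact/measurable_EFinP.
transitivity (\int[mu]_V (EFin \o F) V)%E.
  transitivity (\int[pushforward P U]_V (EFin \o F) V)%E.
    rewrite ge0_integral_pushforward//.
    by move=> V _; rewrite lee_fin.
  by apply: eq_measure_integral => A mA _; exact: U_law.
rewrite (ge0_negligible_integral (measurableC mUN) measurableT mEF _ negl).
  by rewrite setTD setCK.
by move=> V _; rewrite lee_fin.
Qed.

(** Reduced to the nonnegative case by adding a bound of [F] *)
Lemma haar_integral F B : continuous F -> (forall V, `|F V| <= B) ->
  \int[P]_w F (U w) = iE mu F.
Proof.
move=> cF FB.
have cFB : continuous (fun V => F V + B).
  move=> V; apply: (@continuous_comp _ _ _ F (fun x : R => x + B) V (cF V)).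
  by apply: cvgD; [exact: cvg_id|exact: cvg_cst].
have FB0 V : 0 <= F V + B.
  by rewrite -lerBlDr sub0r; have := FB V; rewrite ler_norml => /andP[].
have H := haar_ge0_integral cFB FB0.
have jF : mu.-integrable (@unitaries R N) (EFin \o F).
  by apply: iE_integrable => //; exists B => V _; exact: FB.
have jB : mu.-integrable (@unitaries R N) (EFin \o cst B).
  by apply: iE_integrable; [exact: cst_continuous|exists `|B| => V _].
have mF := borel_continuous_measurable cF.
have mFU : measurable_fun setT (fun w => F (U w)) := measurableT_comp mF mU.
have jFU : P.-integrable setT (EFin \o (fun w => F (U w))).
  apply: measurable_bounded_integrable => //.
    by rewrite (le_lt_trans (probability_le1 _ measurableT))// ltry.
  exists B; split; [exact: num_real|move=> b Bb w _ /=].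
  by apply/ltW; apply: le_lt_trans Bb; exact: FB.
have jBU : P.-integrable setT (EFin \o (cst B : Omega -> R)).
  by apply: finite_measure_integrable_cst.
have := congr1 fine H; rewrite -[LHS]/(\int[P]_w (F (U w) + B)) -[RHS]/(iE mu (fun V => F V + B)).
rewrite /iE (RintegralD measurableT jFU jBU) (RintegralD mUN jF jB).
have PT : P setT = 1%E := probability_setT P.
rewrite (Rintegral_cst P measurableT) (Rintegral_cst mu mUN).
by rewrite [X in B * fine X]PT [X in _ = _ + B * fine X]mu1 => /addIr.
Qed.

End HaarTransfer.

Section BlockOfColumns.
Variables (R : realType) (N p : nat) (t : 'I_p -> 'I_N) (T V : 'M[R[i]]_N).

Lemma inner_col i j :
  inner (col i V) (T *m col j V) = cj T V i j.
Proof.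
rewrite /inner /cj -!mulmxA !mxE; apply: eq_bigr => k _; rewrite !mxE.
by congr (_ * _); apply: eq_bigr => l _; rewrite !mxE.
Qed.

Definition column_matrix : 'M[R[i]]_p :=
  \matrix_(i, j) ((Num.sqrt (N%:R : R))%:C
                  * inner (col (t i) V) (T *m col (t j) V)).

Lemma column_matrixE : column_matrix = (Num.sqrt (N%:R : R))%:C *: block t T V.
Proof.
by apply/matrixP => i j; rewrite mxE inner_col [RHS]mxE [block _ _ _ _ _]mxE.
Qed.

Lemma statistic_column_matrix A :
  complex.Re (\tr (A *m column_matrix)) = statistic t T A V.
Proof. by rewrite column_matrixE -scalemxAr mxtraceZ. Qed.

Lemma moment_column_matrix :
  \sum_i \sum_j (complex.Re (column_matrix i j) ^+ 2 + complex.Im (column_matrix i j) ^+ 2) =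
  complex.Re (\sum_i \sum_j N%:R * `|cj T V (t i) (t j)| ^+ 2).
Proof.
rewrite Re_sum; apply: eq_bigr => i _; rewrite Re_sum; apply: eq_bigr => j _.
rewrite mxE inner_col; move: (cj T V (t i) (t j)) => [a b].
rewrite normc_def -rmorphXn sqr_sqrtr ?addr_ge0 ?sqr_ge0//.
rewrite -[N%:R]/(N%:R) -(rmorph_nat (@real_complex R)) cReZ.
have NE : Num.sqrt (N%:R : R) ^+ 2 = N%:R by rewrite sqr_sqrtr.
rewrite /= !mul0r subr0 addr0 !exprMn NE; ring.
Qed.

End BlockOfColumns.

Section HaarColumns.
Context {R : realType} (N : nat) d (Omega : measurableType d) (P : probability Omega R).
Variables (U : Omega -> borel 'M[R[i]]_N) (mu : probability (borel 'M[R[i]]_N) R).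
Hypothesis mU : measurable_fun setT U.
Hypothesis U_law : forall A : set (borel 'M[R[i]]_N), measurable A -> P (U @^-1` A) = mu A.
Hypothesis mu_haar : haar_unitary mu.
Hypothesis N_gt0 : (0 < N)%N.
Variables (p : nat) (t : 'I_p -> 'I_N) (T : 'M[R[i]]_N).
Hypothesis T_tr : \tr T = 0.

Lemma continuous_column_matrix : continuous (column_matrix t T).
Proof.
apply: matrix_continuous => i j.
rewrite (_ : (fun V => _) = fun V => (Num.sqrt (N%:R : R))%:C * cj T V (t i) (t j)).
  have cc : continuous (fun _ : 'M[R[i]]_N => (Num.sqrt (N%:R : R))%:C) by apply: cst_continuous.
  exact: (cfunM cc (tame_cj_entry T (t i) (t j)).1).
by apply/funext => V; rewrite mxE inner_col.
Qed.

Lemma measurable_column_matrix :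
  measurable_fun setT (fun w => column_matrix t T (U w) : borel 'M[R[i]]_p).
Proof.
exact: measurableT_comp (borel_continuous_measurable2 continuous_column_matrix) mU.
Qed.

(** Tightness: the block of [V^* T V] has second moment [O(1/N)], and the
    normalisation contributes the factor [N] *)
Lemma column_matrix_moment (k : R) : complex.Re (\tr (T *m T^t*)) <= N%:R * k ->
  (\int[P]_w (\sum_i \sum_j (complex.Re (column_matrix t T (U w) i j) ^+ 2
     + complex.Im (column_matrix t T (U w) i j) ^+ 2))%:E <= (p%:R ^+ 2 * k)%:E)%E.
Proof.
move=> Tk.
pose f V := \sum_i \sum_j N%:R * `|cj T V (t i) (t j)| ^+ 2.
have gij i j : tame (fun V => `|cj T V (t i) (t j)| ^+ 2) := tame_norm2 (tame_cj_entry T (t i) (t j)).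
have gNij i j : tame (fun V => N%:R * `|cj T V (t i) (t j)| ^+ 2) := tameM (@tame_cst R N N%:R) (gij i j).
have gi i : tame (fun V => \sum_j N%:R * `|cj T V (t i) (t j)| ^+ 2) by exact: tame_sum.
have gf : tame f by exact: tame_sum.
have f0 V : 0 <= complex.Re (f V).
  by rewrite -moment_column_matrix; apply: sumr_ge0 => i _; apply: sumr_ge0 => j _;
    rewrite addr_ge0// sqr_ge0.
have H := haar_ge0_integral mU U_law mu_haar (cfun_Re gf.1) f0.
have -> : (\int[P]_w (\sum_i \sum_j (complex.Re (column_matrix t T (U w) i j) ^+ 2
     + complex.Im (column_matrix t T (U w) i j) ^+ 2))%:E =
    \int[P]_w (complex.Re (f (U w)))%:E)%E.
  by apply: eq_integral => w _; rewrite moment_column_matrix.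
rewrite H.
have jf := tame_Re_integrable mu gf.
rewrite -(fineK (integrable_fin_num (@measurable_unitaries R N) jf)) lee_fin.
rewrite -[leLHS]/(complex.Re (cE mu f)).
rewrite /f (cE_sum mu_haar _ _ gi).
have E i : cE mu (fun V => \sum_j N%:R * `|cj T V (t i) (t j)| ^+ 2) =
    \sum_j N%:R * cE mu (fun V => `|cj T V (t i) (t j)| ^+ 2).
  rewrite (cE_sum mu_haar _ _ (gNij i)); apply: eq_bigr => j _.
  exact: (cEZ mu N%:R (gij i j)).
under eq_bigr do rewrite E.
have NN : (N%:R : R[i]) = (N%:R : R)%:C by rewrite rmorph_nat.
have N0 : 0 < N%:R :> R by rewrite ltr0n.
have -> : complex.Re (\sum_i \sum_j N%:R * cE mu (fun V => `|cj T V (t i) (t j)| ^+ 2)) =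
    (\sum_i \sum_j sqmean mu (fun V => cj T V (t i) (t j)) * N%:R ^+ 2) / N%:R.
  rewrite Re_sum mulr_suml; apply: eq_bigr => i _; rewrite Re_sum mulr_suml.
  apply: eq_bigr => j _; rewrite NN cReZ /sqmean.
  by field; rewrite gt_eqF.
rewrite ler_pdivrMr// (le_trans (second_moment mu_haar t T_tr))//.
by rewrite -(mulrA (p%:R ^+ 2) k) (mulrC k) ler_wpM2l// exprn_ge0.
Qed.

Hypothesis t_inj : injective t.

Lemma column_matrix_charfun A (c : R[i]) e theta :
  absmean mu (fun V => stein_remainder t T A V - c) <= e ->
  `|\int[P]_w cos (complex.Re (\tr (A *m column_matrix t T (U w))) + theta)
     - cos theta * expR (- (complex.Re c / 2) / 2)| <=
  e / 2 * expR `|complex.Re c / 2|.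
Proof.
move=> Pe.
have -> : \int[P]_w cos (complex.Re (\tr (A *m column_matrix t T (U w))) + theta) =
    \int[P]_w cos (statistic t T A (U w) + theta).
  by apply: eq_Rintegral => w _; rewrite statistic_column_matrix.
have cs : continuous (fun V => cos (statistic t T A V + theta)).
  have cst := cfun_Re (tame_statistic t T A).1.
  have cth : continuous (fun u : R => cos (u + theta)).
    move=> u; apply: (@continuous_comp _ _ _ (fun u : R => u + theta) cos u); last exact: continuous_cos.
    by apply: cvgD; [exact: cvg_id|exact: cvg_cst].
  by move=> V; apply: (@continuous_comp _ _ _ (statistic t T A) (fun u : R => cos (u + theta)) V (cst V)); exact: cth.
rewrite (haar_integral mU U_law mu_haar cs (fun V => cos_norm_le1 _)).
exact: charfun_estimate.
Qed.

End HaarColumns.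

Section Limits.
Variable R : realType.

Lemma inv_sqrtn_cvg0 : (Num.sqrt (n.+1%:R : R))^-1 @[n --> \oo] --> (0 : R).
Proof.
have H : Num.sqrt (@harmonic R n) @[n --> \oo] --> Num.sqrt (0 : R).
  exact: (cvg_comp _ _ (@cvg_harmonic R) (@sqrt_continuous R 0)).
rewrite sqrtr0 in H; apply: cvg_trans H; apply: near_eq_cvg; apply: nearW => n.
by rewrite /harmonic sqrtrV.
Qed.

Lemma cvg_dist0 (u : nat -> R[i]) (l : R[i]) : u n @[n --> \oo] --> l ->
  complex.Re `|u n - l| @[n --> \oo] --> (0 : R).
Proof.
move=> ul; apply/cvgrPdist_le => /= e e0.
have e0' : 0 < e%:C by rewrite ltcR.
move/cvgrPdist_le : ul => /(_ _ e0'); apply: filterS => n.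
rewrite distrC normc_ReE lecR => une.
by rewrite sub0r normrN ger0_norm// Re_norm_ge0.
Qed.

Lemma cvg_Re_le (u : nat -> R[i]) (s e : R) : u n @[n --> \oo] --> s%:C -> 0 < e ->
  \forall n \near \oo, complex.Re (u n) <= s + e.
Proof.
move=> us e0; have /cvgrPdist_le/(_ _ e0) := cvg_dist0 us.
apply: filterS => n; rewrite sub0r normrN ger0_norm ?Re_norm_ge0//.
have := le_trans (ler_norm _) (normr_Re (u n - s%:C)).
rewrite cReD cReN /= lerBlDl => le1 le2; apply: (le_trans le1).
by rewrite lerD2l.
Qed.

Lemma bigO1_Re_le (u : nat -> R[i]) : u =O_\oo (fun=> 1 : R[i]) ->
  exists k : R, \forall n \near \oo, complex.Re (u n) <= k.
Proof.
move=> /eqO_exP[k _ uk]; exists (complex.Re k).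
apply: filterS uk => n; rewrite normr1 mulr1 normc_ReE lecE /= => /andP[_].
exact: le_trans (le_trans (ler_norm _) (normr_Re _)).
Qed.

End Limits.

Section NormalizedTraces.
Variable R : realType.

Lemma Re_normalized (n : nat) (z : R[i]) :
  complex.Re ((n.+1%:R)^-1 * z) = (n.+1%:R)^-1 * complex.Re z.
Proof. by rewrite -(rmorph_nat (@real_complex R)) -fmorphV cReZ. Qed.

Lemma normalized_le (n : nat) (z : R[i]) k : complex.Re ((n.+1%:R)^-1 * z) <= k ->
  complex.Re z <= n.+1%:R * k.
Proof. by rewrite Re_normalized mulrC ler_pdivrMr ?ltr0n// [_ * k]mulrC. Qed.

Variables (sigma2 : R) (tau2 : R[i]) (T : forall n : nat, 'M[R[i]]_n.+1).
Hypotheses (T_diag : forall n, is_diag_mx (T n)) (T_tr : forall n, \tr (T n) = 0).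
Hypothesis T_sigma : (n.+1%:R)^-1 * \tr (T n *m (T n) ^t*) @[n --> \oo] --> sigma2%:C.
Hypothesis T_tau : (n.+1%:R)^-1 * \tr (T n *m T n) @[n --> \oo] --> tau2.

(** Limit of the Cauchy-Schwarz type inequality [|Tr (T T)| <= Tr (T T^* )] *)
Lemma norm_tau_le_sigma : `|tau2| <= sigma2%:C.
Proof.
rewrite normc_ReE lecR; apply/ler_addgt0Pr => e e0.
have e2 : 0 < e / 2 by rewrite divr_gt0.
have /cvgrPdist_le/(_ _ e2) near_tau := cvg_dist0 T_tau.
have near_sigma := cvg_Re_le T_sigma e2.
(* One index that is far enough for both limits. *)
have [n [tn sn]] : exists n, `|0 - complex.Re `|(n.+1%:R)^-1 * \tr (T n *m T n) - tau2| | <= e / 2 /\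
    complex.Re ((n.+1%:R)^-1 * \tr (T n *m (T n) ^t*)) <= sigma2 + e / 2.
  by near \oo => n; exists n; split; near: n.
move: tn; rewrite sub0r normrN ger0_norm ?Re_norm_ge0// => tn.
set u := _^-1 * \tr (T n *m T n) in tn.
have un : complex.Re `|u| <= sigma2 + e / 2.
  apply: le_trans sn; rewrite /u normrM.
  have -> : `|(n.+1%:R)^-1 : R[i]| = (n.+1%:R)^-1 by rewrite ger0_norm// invr_ge0.
  rewrite !Re_normalized ler_wpM2l ?invr_ge0//.
  by have := diag_trace_square_le (T_diag n); rewrite lecE => /andP[].
have -> : sigma2 + e = e / 2 + (sigma2 + e / 2) by field.
apply: le_trans (lerD tn un).
rewrite -cReD.
have : `|tau2| <= `|u - tau2| + `|u|.
  have {1}-> : tau2 = u - (u - tau2) by ring.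
  by rewrite [leRHS]addrC; exact: ler_normB.
by rewrite lecE => /andP[].
Unshelve. all: by end_near.
Qed.

Hypothesis T_bounded : (fun n => (n.+1%:R)^-1 * \tr ((T n *m (T n) ^t*) ^+ 2) : R[i])
  =O_\oo (fun=> 1 : R[i]).
Variables (d : nat -> measure_display) (Omega : forall n, measurableType (d n)).
Variables (P : forall n, probability (Omega n) R).
Variable U : forall n, {RV (P n) >-> borel 'M[R[i]]_n.+1}.
Hypothesis U_haar : forall n, haar_unitary (distribution (P n) (U n)).
Variables (p : nat) (t : forall n : nat, 'I_p -> 'I_n.+1).
Arguments t : clear implicits.
Hypothesis t_inj : forall n, (p <= n.+1)%N -> injective (t n).
Arguments T_tr : clear implicits.
Arguments U_haar : clear implicits.
Arguments t_inj : clear implicits.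

Let law n (A : set (borel 'M[R[i]]_n.+1)) (mA : measurable A) :
  P n (U n @^-1` A) = distribution (P n) (U n) A := erefl.

Lemma column_matrix_moment_bounded : exists K : R, \forall n \near \oo,
  (\int[P n]_w (\sum_i \sum_j (complex.Re (column_matrix (t n) (T n) (U n w) i j) ^+ 2
     + complex.Im (column_matrix (t n) (T n) (U n w) i j) ^+ 2))%:E <= K%:E)%E.
Proof.
exists (p%:R ^+ 2 * (sigma2 + 1)).
apply: filterS (cvg_Re_le T_sigma ltr01) => n /normalized_le.
exact: (column_matrix_moment (measurable_funPT (U n)) (@law n) (U_haar n) _ (t n) (T_tr n)).
Qed.

(** The bound on [Tr (T T^* )^2] controls the Hilbert-Schmidt norms of [T T] and
    of [T T^*], hence the fluctuations of their blocks *)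
Lemma column_matrix_charfun_cvg (A : 'M[R[i]]_p) theta :
  \int[P n]_w cos (complex.Re (\tr (A *m column_matrix (t n) (T n) (U n w))) + theta)
    @[n --> \oo] -->
  cos theta * expR (- (complex.Re
    (\tr (A *m A) * tau2 + \tr (A^t* *m A) * sigma2%:C) / 2) / 2).
Proof.
set c := _ + _ * sigma2%:C.
have [k4 near_k4] := bigO1_Re_le T_bounded.
pose a n : R := (1 + p%:R ^+ 2 * k4) / 2 * (Num.sqrt (n.+1%:R : R))^-1.
pose s n : R := complex.Re `|(n.+1%:R)^-1 * \tr (T n *m T n) - tau2|.
pose s' n : R := complex.Re `|(n.+1%:R)^-1 * \tr (T n *m (T n)^t*) - sigma2%:C|.
pose e n : R := mxabs (A *m A) * (a n + s n) + mxabs (A^t* *m A) * (a n + s' n)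
  + (mxabs A * mxabs A + mxabs (A^t*) * mxabs A) * (p%:R ^+ 2 * (sigma2 + 1)) * harmonic n.
have e0 : e n @[n --> \oo] --> (0 : R).
  have a0 : a n @[n --> \oo] --> (0 : R).
    by rewrite -[X in _ --> X](mulr0 ((1 + p%:R ^+ 2 * k4) / 2));
      apply: cvgM; [exact: cvg_cst|exact: inv_sqrtn_cvg0].
  have s0 := cvg_dist0 T_tau; have s'0 := cvg_dist0 T_sigma.
  have Z (x : R) (u v : nat -> R) : u n @[n --> \oo] --> (0 : R) -> v n @[n --> \oo] --> (0 : R) ->
      x * (u n + v n) @[n --> \oo] --> (0 : R).
    move=> u0 v0; rewrite -[X in _ --> X](mulr0 x) -[X in x * X](addr0 0).
    by apply: cvgM; [exact: cvg_cst|exact: cvgD u0 v0].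
  have H0 (x : R) : x * harmonic n @[n --> \oo] --> (0 : R).
    by rewrite -[X in _ --> X](mulr0 x); apply: cvgM; [exact: cvg_cst|exact: cvg_harmonic].
  rewrite -[X in _ --> X](addr0 0); apply: cvgD.
    by rewrite -[X in _ --> X](addr0 0); apply: cvgD; [exact: Z a0 s0|exact: Z a0 s'0].
  exact: H0.
pose E n := e n / 2 * expR `|complex.Re c / 2|.
have E0 : E n @[n --> \oo] --> (0 : R).
  rewrite -[X in _ --> X](mul0r (expR `|complex.Re c / 2|)).
  rewrite -[X in X * expR _](mul0r (2^-1 : R)).
  apply: cvgM; last exact: cvg_cst.
  by apply: cvgM; [exact: e0|exact: cvg_cst].
apply/cvgrPdist_le => /= r r0; move/cvgrPdist_le : E0 => /(_ _ r0) near_E.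
near=> n.
rewrite distrC.
have np : (p <= n.+1)%N by apply: leqW; near: n; exists p.
have En : `|0 - E n| <= r by near: n.
have k2n : complex.Re (\tr (T n *m (T n)^t*)) <= n.+1%:R * (sigma2 + 1).
  by apply: normalized_le; near: n; exact: (cvg_Re_le T_sigma ltr01).
have k4n : complex.Re (\tr ((T n *m (T n)^t*) *m (T n *m (T n)^t*))) <= n.+1%:R * k4.
  by apply: normalized_le; near: n.
apply: (@le_trans _ _ (E n)); last first.
  by apply: le_trans En; rewrite sub0r normrN ler_norm.
apply: (column_matrix_charfun (measurable_funPT (U n)) (@law n) (U_haar n) _ (T_tr n) (t_inj n np)) => //.
have k4n1 := k4n; rewrite -(diag_square_norm (T_diag n)) in k4n1.
have k4n2 := k4n; rewrite -{2}(adj_self_adjoint (T n)) in k4n2.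
have := remainder_bound (U_haar n) (ltn0Sn n) (t_inj n np) A tau2 sigma2%:C (T_tr n) k2n k4n1 k4n2.
move=> /le_trans; apply.
rewrite /e /a /s /s' /harmonic.
rewrite ![_^-1 * \tr _]mulrC.
rewrite invfM !mulrA; exact: lexx.
Unshelve. all: by end_near.
Qed.

End NormalizedTraces.

(** * The theorem *)

Theorem theoremA3 (R : realType)
  (sigma2 : R) (tau2 : R[i])
  (T : forall n : nat, 'M[R[i]]_n.+1)
  (sigma2_ge0 : 0 <= sigma2)
  (T_diag : forall n, is_diag_mx (T n))
  (T_tr : forall n, \tr (T n) = 0)
  (T_sigma : (n.+1%:R)^-1 * \tr (T n *m (T n) ^t*) @[n --> \oo]
               --> sigma2%:C)
  (T_tau : (n.+1%:R)^-1 * \tr (T n *m T n) @[n --> \oo] --> tau2)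
  (T_bounded : forall k : nat, (1 <= k)%N ->
     (fun n => (n.+1%:R)^-1 * \tr ((T n *m (T n) ^t*) ^+ k) : R[i])
       =O_\oo (fun=> 1 : R[i]))
  (d : nat -> measure_display)
  (Omega : forall n, measurableType (d n))
  (P : forall n, probability (Omega n) R)
  (U : forall n, {RV (P n) >-> borel 'M[R[i]]_n.+1})
  (U_haar : forall n, haar_unitary (distribution (P n) (U n)))
  (p : nat)
  (t : forall n : nat, 'I_p -> 'I_n.+1)
  (t_inj : forall n, (p <= n.+1)%N -> injective (t n)) :
  exists (d' : measure_display) (Omega' : measurableType d')
    (Q : probability Omega' R) (G : {RV Q >-> borel 'M[R[i]]_p}),
    [/\ centered_complex_gaussian Q
          (fun (ij : 'I_p * 'I_p) w => (G w : 'M[R[i]]_p) ij.1 ij.2),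
        forall i j k l : 'I_p,
          complex_mean Q
            (fun w => (G w : 'M[R[i]]_p) i j * (G w : 'M[R[i]]_p) k l)
            ((i == l)%:R * (j == k)%:R * tau2) /\
          complex_mean Q
            (fun w => (G w : 'M[R[i]]_p) i j
                      * Num.conj ((G w : 'M[R[i]]_p) k l))
            ((i == k)%:R * (j == l)%:R * sigma2%:C)
      & cvg_in_distribution P
          (fun n w => \matrix_(i < p, j < p)
             ((Num.sqrt (n.+1%:R : R))%:C
              * inner (col (t n i) (U n w)) (T n *m col (t n j) (U n w))))
          Q (G : Omega' -> 'M[R[i]]_p)].
Proof.
have [d' [ Omega' [Q [G [G_gauss G_cov G_charfun [K' G_moment]]]]]] :=
  gaussian_matrix_exists p (norm_tau_le_sigma T_diag T_sigma T_tau).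
exists d', Omega', Q, G; split => //.
have [K X_moment] := column_matrix_moment_bounded T_tr T_sigma U_haar t.
pose X n w : borel 'M[R[i]]_p := column_matrix (t n) (T n) (U n w).
have mX n : measurable_fun setT (X n) :=
  measurable_column_matrix (measurable_funPT (U n)) (t n) (T n).
apply: (@cvg_in_distribution_matrix R p _ _ P _ _ Q X G mX (measurable_funPT G) _ (Num.max K K')).
- move=> A theta; rewrite G_charfun.
  exact: (column_matrix_charfun_cvg T_diag T_tr T_sigma T_tau (T_bounded 2%N isT) U_haar t_inj).
- by apply: filterS X_moment => n /le_trans; apply; rewrite lee_fin le_max lexx.
- by apply: (le_trans G_moment); rewrite lee_fin le_max lexx orbT.
Qed.
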